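(* Let $K$ be an algebraically closed field complete with respect to a nontrivial nonarchimedean absolute value, let $\varphi:\mathbb{P}^N\to\mathbb{P}^N$ be a morphism of degree $d\ge2$ defined over $K$, let $\Phi$ be a lift of $\varphi$, and define $g_\Phi:\mathbb{P}^N(K)\to\mathbb{R}$ by $g_\Phi(P)=\frac1d\log\|\Phi(x)\|-\log\|x\|$ for any $x\in\pi^{-1}(P)$. Then $g_\Phi$ is Lipschitz continuous with respect to the chordal metric; more precisely, for all $P,Q\in\mathbb{P}^N(K)$, $$|g_\Phi(P)-g_\Phi(Q)|\le\frac{\log(|\operatorname{Res}(\varphi)|^{-1})}{d\,|\operatorname{Res}(\varphi)|}\,\Delta(P,Q).$$ Further, $g_\Phi(P)=g_\Phi(Q)$ whenever $\Delta(P,Q)<|\operatorname{Res}(\varphi)|$; in particular $g_\Phi$ is uniformly locally constant.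
   Context: For $x\in K^{N+1}$, $\|x\|=\max_i|x_i|$, and $\pi:K^{N+1}\setminus\{0\}\to\mathbb{P}^N(K)$ is the projection. The chordal distance of $P=\pi(x)$, $Q=\pi(y)$ is $\Delta(P,Q)=\max_{i,j}|x_iy_j-x_jy_i|/(\|x\|\,\|y\|)$. A lift of $\varphi$ is a tuple $\Phi=(\Phi_0,\dots,\Phi_N)$ of degree-$d$ homogeneous polynomials over $K$ with no common nontrivial zero and $\varphi\circ\pi=\pi\circ\Phi$ ($g_\Phi$ is well defined by homogeneity). The norm $\|\Phi\|$ is the maximum absolute value of the coefficients; $\Phi$ is a minimal lift if $\|\Phi\|=1$. $\operatorname{Res}(\Phi)$ is the Macaulay resultant of $\Phi_0,\dots,\Phi_N$, and a minimal resultant $\operatorname{Res}(\varphi)$ is $\operatorname{Res}(\Phi)$ for a minimal lift $\Phi$; $|\operatorname{Res}(\varphi)|$ is well defined and $0<|\operatorname{Res}(\varphi)|\le1$. *)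

(* Defs.v *)
From mathcomp Require Import all_boot all_algebra.
From mathcomp Require Import mpoly.
From mathcomp Require Import Rstruct.
From Stdlib Require Import Reals.
Set Implicit Arguments. Unset Strict Implicit. Unset Printing Implicit Defensive.
Import GRing.Theory Num.Theory.
Local Open Scope ring_scope.

Definition nonarch_abs (K : fieldType) (absv : K -> R) : Prop :=
  [/\ forall x, 0 <= absv x,
      forall x, absv x = 0 <-> x = 0,
      forall x y, absv (x * y) = absv x * absv y &
      forall x y, absv (x + y) <= Num.max (absv x) (absv y)].

Definition nontrivial_abs (K : fieldType) (absv : K -> R) : Prop :=
  exists x : K, absv x != 0 /\ absv x != 1.

Definition complete_abs (K : fieldType) (absv : K -> R) : Prop :=
  forall u : nat -> K,
    (forall eps : R, 0 < eps -> exists M : nat,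
        forall m n : nat, leq M m -> leq M n -> absv (u m - u n) < eps) ->
    exists l : K, forall eps : R, 0 < eps -> exists M : nat,
        forall n : nat, leq M n -> absv (u n - l) < eps.

Definition nzv (K : fieldType) (n : nat) (x : 'I_n -> K) : Prop :=
  exists i, x i != 0.

Definition vnorm (K : fieldType) (absv : K -> R) (n : nat) (x : 'I_n -> K) : R :=
  \big[Num.max/0]_(i < n) absv (x i).

(* chordal distance of pi(x), pi(y), computed on representatives *)
Definition chordal (K : fieldType) (absv : K -> R) (n : nat) (x y : 'I_n -> K) : R :=
  (\big[Num.max/0]_(i < n) \big[Num.max/0]_(j < n) absv (x i * y j - x j * y i))
  / (vnorm absv x * vnorm absv y).

Definition evalv (K : fieldType) (N : nat) (Phi : 'I_N.+1 -> {mpoly K[N.+1]})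
  (x : 'I_N.+1 -> K) : 'I_N.+1 -> K := fun i => (Phi i).@[x].

Definition is_lift (K : fieldType) (N d : nat) (Phi : 'I_N.+1 -> {mpoly K[N.+1]}) : Prop :=
  (forall i, Phi i \is ishomog1 d mdeg) /\
  (forall x : 'I_N.+1 -> K, nzv x -> nzv (evalv Phi x)).

Definition same_map (K : fieldType) (N : nat) (Phi Psi : 'I_N.+1 -> {mpoly K[N.+1]}) : Prop :=
  forall x : 'I_N.+1 -> K, nzv x ->
    exists c : K, c != 0 /\ forall i, evalv Psi x i = c * evalv Phi x i.

Definition lift_norm (K : fieldType) (absv : K -> R) (N : nat)
  (Phi : 'I_N.+1 -> {mpoly K[N.+1]}) : R :=
  \big[Num.max/0]_(i < N.+1) \big[Num.max/0]_(m <- msupp (Phi i)) absv (Phi i)@_m.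

Definition gPhi (K : fieldType) (absv : K -> R) (N d : nat)
  (Phi : 'I_N.+1 -> {mpoly K[N.+1]}) (x : 'I_N.+1 -> K) : R :=
  ln (vnorm absv (evalv Phi x)) / d%:R - ln (vnorm absv x).

Definition detT (R' : comRingType) (T : finType) (A : T -> T -> R') : R' :=
  \det (\matrix_(i < #|T|, j < #|T|) A (enum_val i) (enum_val j)).

Section Macaulay.
Variables (K : fieldType) (N d : nat).

Definition macD : nat := (N.+1 * d.-1).+1.

Definition macMono : finType := {m : 'X_{1..N.+1 < macD.+1} | mdeg m == macD}.

Definition mexp (a : macMono) : 'X_{1..N.+1} := val (val a).

(* the smallest i with x_i^d dividing x^a (exists by pigeonhole, d >= 1) *)
Definition macPiv (a : macMono) : 'I_N.+1 :=
  odflt ord0 [pick i : 'I_N.+1 | leq d (mexp a i) &&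
                                 [forall j : 'I_N.+1, (j < i)%nat ==> (mexp a j < d)%nat]].

Definition macReduced (a : macMono) : bool :=
  #|[pred i : 'I_N.+1 | leq d (mexp a i)]| == 1%nat.

Definition macRow (F : 'I_N.+1 -> {mpoly K[N.+1]}) (a : macMono) : {mpoly K[N.+1]} :=
  'X_[(mexp a - U_(macPiv a) *+ d)%MM] * F (macPiv a).

Definition macM (F : 'I_N.+1 -> {mpoly K[N.+1]}) (a b : macMono) : K :=
  (macRow F a)@_(mexp b).

Definition macG : 'I_N.+1 -> {mpoly K[N.+1]} := fun i => 'X_i ^+ d.

Definition macMt (F : 'I_N.+1 -> {mpoly K[N.+1]}) (a b : macMono) : {poly K} :=
  (macM F a b)%:P + 'X * (macM macG a b)%:P.

(* Macaulay: det M(F) = Res(F) * det M'(F) identically in the coefficients,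
   M' the submatrix on the non-reduced monomials; moreover det M'(G) = 1,
   so det M'(F + tG) is a nonzero polynomial in t.  Hence Res(F + tG) is the
   exact quotient of these two polynomials in K[t], and Res(F) is its value
   at t = 0.  (Normalisation: Res(x_0^d,...,x_N^d) = 1.) *)
Definition macaulay_res (F : 'I_N.+1 -> {mpoly K[N.+1]}) : K :=
  let A := macMt F in
  let A' := fun a b : {x : macMono | ~~ macReduced x} => A (val a) (val b) in
  ((detT A %/ detT A').[0]).

End Macaulay.

(* Main.v *)
(* A nonarchimedean absolute value enters only through pairs (O, E) of its
   valuation ring and a ball E that is an ideal of O, so that estimates become
   congruences modulo E.

   Macaulay's quotient.  Write M(F) for the Macaulay matrix and M'(F) for its
   nonreduced part.  Permuting the variables cyclically changes both
   determinants, but det M / det M' is, up to a constant, independent of the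
   permutation as long as the minors for fewer forms do not vanish.  In the
   pencil F + s H + t G, with G = (x_i^d) and H its cyclic shift, the minors of
   the permuted system are units for |t| <= |s| and those of the original one
   for |t| > |s| > 1.  So at every root t at least one of the two descriptions
   is nondegenerate, det M' divides det M for generic s, and by continuity of
   monic division also at s = 0, with an integral quotient.

   Lower bound.  For |x| = 1 and F integral, |Res F| <= |F(x)|: move F within
   |F(x)| to a system vanishing at x, whose resultant is 0 because the monomials
   evaluated at x form a kernel vector of M.  Conversely Res F = 0 would give
   arbitrarily small perturbations of F, nondegenerate for the permuted
   variables, whose ideal misses a form of large degree, whereas by the
   Nullstellensatz the ideal of F, hence that of a nearby system, contains all
   of them.

   Thus |Res Psi| <= |Psi(x)| <= 1 when |x| = 1.  If the chordal distance of P
   and Q is below |Res Psi|, both can be normalised at the same coordinate, their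
   values under Psi differ by less than |Res Psi|, and their norms agree; at
   larger distance the bound -log|Res Psi| / d on the oscillation of the height
   suffices.  Two lifts of one map are proportional, so the height of Phi differs
   from that of Psi by a constant. *)
Require Import Defs.
From mathcomp Require Import all_boot all_algebra.
From mathcomp Require Import mpoly.
From mathcomp Require Import ring lra zify.
From mathcomp Require Import perm.
From Stdlib Require Import Classical.
Import GRing.Theory Num.Theory.
Local Open Scope ring_scope.
Set Implicit Arguments. Unset Strict Implicit. Unset Printing Implicit Defensive.

(** * Determinants indexed by sequences *)

(** The quotient det M / det M' survives a permutation of the variables because the two families of
    pivoted rows are bases of the same graded piece of the ideal. The determinant of the change of
    basis is, up to constants, the quotient of the two det M; by a recursion on the number of forms
    it is also the quotient of the two det M'. The shift in the pencil is cyclic because x_j^d + c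
    x_(j-1)^d, taken only for j < N, never closes a cycle of indices: these systems are triangular
    and have all minors equal to 1, whatever c is. The estimates on the pencil hold only for |s| >
    1, whereas the limit needs small s. The bridge is elimination of t: two polynomials in t without
    common root at some suitable large s have a resultant that is a nonzero polynomial in s. Only
    finitely many s are then excluded, and arbitrarily small ones remain. *)

Section DetOverSeq.
Variables (A : comNzRingType) (T : eqType).
Implicit Types (s : seq T) (M P Q : T -> T -> A).

(** Rows and columns share one index sequence, so the value depends on it only up to reordering
    ([perm_detq]); submatrices become subsequences and block decompositions become
    concatenations. *)
Definition detq s M : A :=
  \det (\matrix_(i < size s, j < size s)
          M (tnth (in_tuple s) i) (tnth (in_tuple s) j)).

Lemma detq_tuple n (t : n.-tuple T) M :
  detq t M = \det (\matrix_(i < n, j < n) M (tnth t i) (tnth t j)).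
Proof.
case: t => s Hs; have E := eqP Hs; subst n; rewrite /detq.
congr (\det _); apply/matrixP => i j; rewrite !mxE.
by have x0 := tnth (in_tuple s) i; rewrite !(tnth_nth x0).
Qed.

Lemma eq_detq s M P : {in s &, M =2 P} -> detq s M = detq s P.
Proof.
move=> H; congr (\det _); apply/matrixP => i j; rewrite !mxE.
by rewrite H // mem_tnth.
Qed.

Lemma perm_detq s1 s2 M : perm_eq s1 s2 -> detq s1 M = detq s2 M.
Proof.
move=> Hp; have /tuple_permP[p Hs] : perm_eq s1 (in_tuple s2) by [].
rewrite {}Hs detq_tuple /detq; set B := RHS.
have -> : \matrix_(i, j) M (tnth [tuple tnth (in_tuple s2) (p i0) | i0 < size s2] i)
     (tnth [tuple tnth (in_tuple s2) (p i0) | i0 < size s2] j) =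
   row_perm p (col_perm p (\matrix_(i, j) M (tnth (in_tuple s2) i) (tnth (in_tuple s2) j))).
  by apply/matrixP => i j; rewrite !mxE !tnth_mktuple.
by rewrite row_permE col_permE !det_mulmx !det_perm odd_permV mulrCA -signr_addb addbb mulr1.
Qed.

Lemma detq_cat s1 s2 M :
  {in s1 & s2, forall a b, M a b = 0} ->
  detq (s1 ++ s2) M = detq s1 M * detq s2 M.
Proof.
move=> H.
rewrite -[s1 ++ s2]/(val [tuple of in_tuple s1 ++ in_tuple s2]) detq_tuple.
have -> : \matrix_(i, j) M (tnth [tuple of in_tuple s1 ++ in_tuple s2] i)
   (tnth [tuple of in_tuple s1 ++ in_tuple s2] j) =
   block_mx (\matrix_(i, j) M (tnth (in_tuple s1) i) (tnth (in_tuple s1) j)) 0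
    (\matrix_(i, j) M (tnth (in_tuple s2) i) (tnth (in_tuple s1) j))
    (\matrix_(i, j) M (tnth (in_tuple s2) i) (tnth (in_tuple s2) j)).
  apply/matrixP => i j; rewrite !mxE.
  case: (split_ordP i) => i' ->; rewrite ?(tnth_lshift, tnth_rshift) mxE;
  case: (split_ordP j) => j' ->; rewrite ?(tnth_lshift, tnth_rshift) !mxE //.
  by rewrite H // mem_tnth.
by rewrite det_lblock.
Qed.

Lemma detq_mul s M P Q :
  {in s &, forall a b, M a b = \sum_(c <- s) P a c * Q c b} ->
  detq s M = detq s P * detq s Q.
Proof.
move=> H; rewrite /detq -det_mulmx; congr (\det _).
apply/matrixP => i j; rewrite !mxE H ?mem_tnth // big_tnth.
by apply: eq_bigr => k _; rewrite !mxE.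
Qed.

Lemma detqZ s c M : detq s (fun a b => c * M a b) = c ^+ size s * detq s M.
Proof.
by rewrite /detq -detZ; congr (\det _); apply/matrixP => i j; rewrite !mxE.
Qed.

Lemma detq1 s M : uniq s -> {in s &, forall a b, M a b = (a == b)%:R} -> detq s M = 1.
Proof.
move=> U H; rewrite /detq -[RHS](det1 A (size s)); congr (\det _).
apply/matrixP => i j; rewrite !mxE H ?mem_tnth //.
by have x0 := tnth (in_tuple s) i; rewrite !(tnth_nth x0) nth_uniq.
Qed.

(* The weight need not be injective: only distinct entries are compared. *)
Lemma detq_trig (w : T -> nat) s M : uniq s ->
  {in s, forall a, M a a = 1} ->
  {in s &, forall a b, a != b -> (w a <= w b)%N -> M a b = 0} ->
  detq s M = 1.
Proof.
move=> U Hd H0; pose le := relpre w leq.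
have Htot : total le by move=> a b; apply: leq_total.
have Hp : perm_eq (sort le s) s by exact: (permEl (perm_sort le s)).
rewrite -(perm_detq _ Hp).
have {}U : uniq (sort le s) by rewrite sort_uniq.
have Hm := mem_sort le s.
have Hs := sort_sorted Htot s.
move: Hm Hs U; move: (sort le s) => s' Hm Hs U {Hp}.
rewrite /detq det_trig.
  by rewrite big1 // => i _; rewrite mxE Hd // -Hm mem_tnth.
apply/is_trig_mxP => i j lij; rewrite mxE H0 -?Hm ?mem_tnth //.
  have x0 := tnth (in_tuple s') i; rewrite !(tnth_nth x0) nth_uniq //.
  by apply: contraTneq lij => /val_inj ->; rewrite ltnn.
have x0 := tnth (in_tuple s') i; rewrite !(tnth_nth x0).
apply: (sorted_ltn_nth (leT:=le)) => //; rewrite ?inE ?ltn_ord //.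
by move=> a b c; apply: leq_trans.
Qed.

End DetOverSeq.

Lemma detq_map (A : comNzRingType) (T T' : eqType) (h : T' -> T) s (M : T -> T -> A) :
  detq (map h s) M = detq s (fun a b => M (h a) (h b)).
Proof.
rewrite -[map h s]/(val [tuple of map h (in_tuple s)]) detq_tuple /detq.
by congr (\det _); apply/matrixP => i j; rewrite !mxE !tnth_map.
Qed.

Lemma rmorph_detq (A B : comNzRingType) (f : {rmorphism A -> B}) (T : eqType)
  (s : seq T) (M : T -> T -> A) :
  f (detq s M) = detq s (fun a b => f (M a b)).
Proof.
by rewrite /detq -det_map_mx; congr (\det _); apply/matrixP => i j; rewrite !mxE.
Qed.

Lemma detT_detq (A : comNzRingType) (T : finType) (M : T -> T -> A) :
  detT M = detq (enum T) M.
Proof.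
rewrite /detT -[enum T]/(val [tuple of enum T]) detq_tuple.
congr (\det _); apply/matrixP => i j; rewrite !mxE.
have x0 := enum_default i; by rewrite !(enum_val_nth x0) !(tnth_nth x0).
Qed.

Section DetField.
Variables (K : fieldType) (T : eqType).
Implicit Types (s : seq T) (M : T -> T -> K).

Lemma detq_null s M (v : T -> K) : has (fun b => v b != 0) s ->
  {in s, forall a, \sum_(b <- s) M a b * v b = 0} -> detq s M = 0.
Proof.
case/hasP => b bs vb H.
pose u := \col_(i < size s) v (tnth (in_tuple s) i).
apply/eqP; rewrite /detq -det_tr; apply/det0P; exists u^T.
  apply: contraNneq vb => /matrixP; have /tnthP[i ->] : b \in in_tuple s by [].
  by move=> /(_ 0 i); rewrite !mxE => ->.
rewrite -trmx_mul; apply/eqP; rewrite trmx_eq0; apply/eqP/matrixP => i j; rewrite !mxE.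
transitivity (\sum_(b <- s) M (tnth (in_tuple s) i) b * v b); last by rewrite H ?mem_tnth.
rewrite [RHS]big_tnth.
by apply: eq_bigr => k _; rewrite !mxE.
Qed.

Lemma detq_span s M (u : T -> K) : uniq s -> detq s M != 0 ->
  exists c : T -> K, {in s, forall b, u b = \sum_(a <- s) c a * M a b}.
Proof.
rewrite /detq => U; set B := (\matrix_(i, j) _) => HB.
have HBu : B \in unitmx by rewrite unitmxE unitfE.
pose r := \row_(i < size s) u (tnth (in_tuple s) i).
pose x := r *m invmx B.
pose c a := if insub (index a s) is Some i then x 0 i else 0.
have Hc i : c (tnth (in_tuple s) i) = x 0 i.
  have x0 := tnth (in_tuple s) i; rewrite /c (tnth_nth x0) index_uniq //.
  by rewrite valK.
exists c => b; have : b \in in_tuple s = (b \in s) by [].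
move=> <- /tnthP[j ->]; rewrite big_tnth.
have : (x *m B) 0 j = r 0 j by rewrite mulmxKV.
by rewrite !mxE => <-; apply: eq_bigr => k _; rewrite Hc !mxE.
Qed.

Lemma detq_free s M (c : T -> K) : detq s M != 0 ->
  {in s, forall b, \sum_(a <- s) c a * M a b = 0} -> {in s, forall a, c a = 0}.
Proof.
move=> nz H a as_; apply: contraNeq nz => ca.
have -> : detq s M = detq s (fun a b => M b a).
  by rewrite /detq -det_tr; congr (\det _); apply/matrixP => i j; rewrite !mxE.
apply/eqP; apply: (detq_null (v := c)); first by apply/hasP; exists a.
by move=> b bs; rewrite -[RHS](H b bs); apply: eq_bigr => x _; rewrite mulrC.
Qed.

End DetField.

(** * Congruences modulo an ideal of a subring *)

Record ideal_pair (A : comNzRingType) (O E : A -> Prop) : Prop := IdealPair {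
  ip_O1 : O 1;
  ip_OB : forall a b, O a -> O b -> O (a - b);
  ip_OM : forall a b, O a -> O b -> O (a * b);
  ip_E0 : E 0;
  ip_ED : forall a b, E a -> E b -> E (a + b);
  ip_EM : forall a b, O a -> E b -> E (a * b) }.

Section IdealPair.
Variables (A : comNzRingType) (O E : A -> Prop) (ip : ideal_pair O E).

Lemma ip_O0 : O 0.
Proof. by rewrite -[0](subrr 1); apply: (ip_OB ip); apply: (ip_O1 ip). Qed.

Lemma ip_ON a : O a -> O (- a).
Proof. by rewrite -sub0r => Oa; apply: (ip_OB ip) => //; apply: ip_O0. Qed.

Lemma ip_OD a b : O a -> O b -> O (a + b).
Proof. by move=> Oa Ob; rewrite -[b]opprK; apply: (ip_OB ip) => //; apply: ip_ON. Qed.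

Lemma ip_EN a : E a -> E (- a).
Proof.
rewrite -mulN1r; apply: (ip_EM ip); apply: ip_ON; exact: (ip_O1 ip).
Qed.

Lemma ip_EB a b : E a -> E b -> E (a - b).
Proof. by move=> Ea Eb; apply: (ip_ED ip) => //; apply: ip_EN. Qed.

Lemma ip_EMr a b : E a -> O b -> E (a * b).
Proof. by rewrite mulrC => Ea Ob; apply: (ip_EM ip). Qed.

Lemma ip_O_sum (I : eqType) (s : seq I) (f : I -> A) :
  {in s, forall i, O (f i)} -> O (\sum_(i <- s) f i).
Proof.
move=> H; rewrite big_seq; apply: (big_ind O) => //; first exact: ip_O0.
exact: ip_OD.
Qed.

Lemma ip_E_sum (I : eqType) (s : seq I) (f : I -> A) :
  {in s, forall i, E (f i)} -> E (\sum_(i <- s) f i).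
Proof.
move=> H; rewrite big_seq; apply: (big_ind E) => //; first exact: (ip_E0 ip).
exact: (ip_ED ip).
Qed.

Lemma ip_O_prod (I : Type) (s : seq I) (f : I -> A) :
  (forall i, O (f i)) -> O (\prod_(i <- s) f i).
Proof.
by move=> H; apply: (big_ind O) => //; [exact: (ip_O1 ip) | exact: (ip_OM ip)].
Qed.

Lemma ip_OX a n : O a -> O (a ^+ n).
Proof.
by move=> Oa; elim: n => [|n IH]; rewrite ?expr0 ?exprS; [exact: (ip_O1 ip) | apply: (ip_OM ip)].
Qed.

Lemma ip_mul_cong a b a' b' : O a -> O b' -> E (a - a') -> E (b - b') -> E (a * b - a' * b').
Proof.
move=> Oa Ob' Ea Eb.
have -> : a * b - a' * b' = a * (b - b') + (a - a') * b' by ring.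
by apply: (ip_ED ip); [apply: (ip_EM ip) | apply: ip_EMr].
Qed.

Lemma ip_prod_cong (I : Type) (s : seq I) (f g : I -> A) :
  (forall i, O (f i)) -> (forall i, O (g i)) -> (forall i, E (f i - g i)) ->
  E (\prod_(i <- s) f i - \prod_(i <- s) g i).
Proof.
move=> Of Og Efg; elim: s => [|i s IH]; first by rewrite !big_nil subrr; apply: (ip_E0 ip).
by rewrite !big_cons; apply: ip_mul_cong => //; apply: ip_O_prod.
Qed.

Lemma ip_X_cong a b n : O a -> O b -> E (a - b) -> E (a ^+ n - b ^+ n).
Proof.
move=> Oa Ob Eab; elim: n => [|n IH]; first by rewrite subrr; apply: (ip_E0 ip).
by rewrite !exprS; apply: ip_mul_cong => //; apply: ip_OX.
Qed.

Lemma ip_O_detq (T : eqType) (s : seq T) (M : T -> T -> A) :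
  {in s &, forall a b, O (M a b)} -> O (detq s M).
Proof.
move=> H; apply: ip_O_sum => p _; apply: (ip_OM ip).
  by apply: ip_OX; apply: ip_ON; apply: (ip_O1 ip).
by apply: ip_O_prod => i; rewrite mxE; apply: H; rewrite mem_tnth.
Qed.

Lemma ip_detq_cong (T : eqType) (s : seq T) (M P : T -> T -> A) :
  {in s &, forall a b, O (M a b)} -> {in s &, forall a b, O (P a b)} ->
  {in s &, forall a b, E (M a b - P a b)} -> E (detq s M - detq s P).
Proof.
move=> OM OP EMP; rewrite /detq /determinant -sumrB; apply: ip_E_sum => p _.
rewrite -mulrBr; apply: (ip_EM ip).
  by apply: ip_OX; apply: ip_ON; apply: (ip_O1 ip).
apply: ip_prod_cong => i; rewrite !mxE.
- by apply: OM; rewrite mem_tnth.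
- by apply: OP; rewrite mem_tnth.
- by apply: EMP; rewrite mem_tnth.
Qed.

Lemma ip_meval_O n (p : {mpoly A[n]}) (x : 'I_n -> A) :
  (forall m, O p@_m) -> (forall i, O (x i)) -> O p.@[x].
Proof.
move=> Op Ox; rewrite mevalE; apply: ip_O_sum => m _; apply: (ip_OM ip) => //.
by apply: ip_O_prod => i; apply: ip_OX.
Qed.

Lemma ip_meval_cong n (p : {mpoly A[n]}) (x y : 'I_n -> A) :
  (forall m, O p@_m) -> (forall i, O (x i)) -> (forall i, O (y i)) ->
  (forall i, E (x i - y i)) -> E (p.@[x] - p.@[y]).
Proof.
move=> Op Ox Oy Exy; rewrite !mevalE -sumrB; apply: ip_E_sum => m _.
rewrite -mulrBr; apply: (ip_EM ip) => //.
by apply: ip_prod_cong => i; [exact: ip_OX | exact: ip_OX | exact: ip_X_cong].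
Qed.

Definition coefs_in (S : A -> Prop) (p : {poly A}) : Prop := forall i, S p`_i.

Lemma ip_poly : ideal_pair (coefs_in O) (coefs_in E).
Proof.
split.
- by move=> i; rewrite coefC; case: eqP => _; [exact: (ip_O1 ip) | exact: ip_O0].
- by move=> p q Op Oq i; rewrite coefB; apply: (ip_OB ip).
- by move=> p q Op Oq i; rewrite coefM; apply: ip_O_sum => j _; apply: (ip_OM ip).
- by move=> i; rewrite coef0; apply: (ip_E0 ip).
- by move=> p q Op Oq i; rewrite coefD; apply: (ip_ED ip).
- by move=> p q Op Oq i; rewrite coefM; apply: ip_E_sum => j _; apply: (ip_EM ip).
Qed.

Lemma coefs_in_polyC (S : A -> Prop) c : S 0 -> S c -> coefs_in S c%:P.
Proof. by move=> S0 Sc i; rewrite coefC; case: eqP. Qed.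

Lemma coefs_in_mulX (S : A -> Prop) p : S 0 -> coefs_in S p -> coefs_in S ('X * p).
Proof. by move=> S0 Sp i; rewrite coefXM; case: eqP. Qed.

End IdealPair.

(** * Continuity of division by monic polynomials *)

Section MonicDivision.
Variables (K : fieldType) (O E : K -> Prop) (ip : ideal_pair O E).

(** As B is monic, each step of the long division only subtracts a coefficient of the current
    remainder times a shift of B, so no denominators arise and nothing leaves [E]. *)
Lemma ip_monic_div (B p : {poly K}) : B \is monic -> coefs_in O B -> coefs_in E p ->
  coefs_in E (p %/ B) /\ coefs_in E (p %% B).
Proof.
move=> mB OB Ep.
suff [q [r [Eq Er Dp sr]]] : exists q r, [/\ coefs_in E q, coefs_in E r,
    p = q * B + r & (size r < size B)%N].
  by rewrite -(divpP Dp sr) -(modpP Dp sr).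
have ipP := ip_poly ip.
have [n] := ubnP (size p); elim: n p Ep => // n IH p Ep ltn.
have [ltpB|leBp] := ltnP (size p) (size B).
  exists 0, p; split => //; first exact: (ip_E0 ipP).
  by rewrite mul0r add0r.
have p0 : p != 0.
  rewrite -size_poly_gt0; apply: leq_trans leBp; rewrite size_poly_gt0.
  exact: monic_neq0.
pose c : {poly K} := (lead_coef p)%:P * 'X^(size p - size B).
have Ec : coefs_in E c.
  move=> i; rewrite coefCM coefXn; case: eqP => _; rewrite ?mulr1 ?mulr0.
    exact: Ep.
  exact: (ip_E0 ip).
have EcB : coefs_in E (c * B) by apply: (ip_EMr ipP).
have sB : (0 < size B)%N by rewrite size_poly_gt0 monic_neq0.
have c0 : c != 0 by rewrite /c mulf_eq0 polyC_eq0 lead_coef_eq0 (negbTE p0) monic_neq0 // monicXn.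
have scB : size (c * B) = size p.
  rewrite size_mul ?(monic_neq0 mB) // /c size_Cmul ?lead_coef_eq0 // size_polyXn.
  by rewrite addSn /= subnK.
have lcB : lead_coef (c * B) = lead_coef p.
  by rewrite lead_coefM (monicP mB) mulr1 /c lead_coefM lead_coefC lead_coefXn mulr1.
have lt2 : (size (p - c * B)%R < size p)%N.
  have sp : (0 < size p)%N by rewrite size_poly_gt0.
  rewrite -(prednK sp) ltnS; apply/leq_sizeP => j lej.
  rewrite coefB; have [->|nej] := eqVneq j (size p).-1.
    by have := lcB; rewrite !lead_coefE scB => ->; rewrite subrr.
  have ltj : (size p <= j)%N by rewrite -(prednK sp) ltn_neqAle eq_sym nej.
  by rewrite !nth_default ?subrr ?scB.
have [||q [r [Eq Er Dq sr]]] := IH (p - c * B).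
- exact: (ip_EB ipP).
- by rewrite (leq_trans lt2).
exists (c + q), r; split => //; first exact: (ip_ED ipP).
by rewrite mulrDl -addrA -Dq addrC subrK.
Qed.

(** With q, r and q', r' the two quotients and remainders, A - A' - q'(B - B') = (q - q')B + (r -
    r'). As B and B' have equal size, this is a division by B of a polynomial with coefficients in
    [E]. *)
Lemma ip_monic_div_cong (A B A' B' : {poly K}) :
  B \is monic -> B' \is monic -> coefs_in O B -> coefs_in O B' -> coefs_in O A' ->
  size B' = size B ->
  coefs_in E (A - A') -> coefs_in E (B - B') -> coefs_in O (A' %/ B') ->
  coefs_in E (A %/ B - A' %/ B') /\ coefs_in E (A %% B - A' %% B').
Proof.
move=> mB mB' OB OB' OA' sB EA EB Oq.
have ipP := ip_poly ip.
have [H1 H2] := @ip_monic_div B (A - A' - (A' %/ B') * (B - B')) mB OB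
  (ip_EB ipP EA (ip_EM ipP Oq EB)).
set q := A %/ B; set q' := A' %/ B'; set r := A %% B; set r' := A' %% B'.
have D : A - A' - q' * (B - B') = (q - q') * B + (r - r').
  have e1 : A = q * B + r := divp_eq A B.
  have e2 : A' = q' * B' + r' := divp_eq A' B'.
  by rewrite {1}e1 {1}e2; ring.
have sr : (size (r - r')%R < size B)%N.
  rewrite (leq_ltn_trans (size_polyD _ _)) // size_polyN gtn_max.
  by rewrite ltn_modp monic_neq0 //= -sB ltn_modp monic_neq0.
by rewrite (divpP D sr) (modpP D sr).
Qed.

End MonicDivision.

Lemma ip_self (A : comNzRingType) (O E : A -> Prop) : ideal_pair O E -> ideal_pair O O.
Proof.
move=> ip; split; first exact: (ip_O1 ip).
- exact: (ip_OB ip).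
- exact: (ip_OM ip).
- exact: (ip_O0 ip).
- exact: (ip_OD ip).
- exact: (ip_OM ip).
Qed.

(** Congruence modulo sO expresses an error of order s; it replaces the limit s -> 0. *)
Lemma ip_principal (A : comNzRingType) (O E : A -> Prop) (s : A) : ideal_pair O E ->
  ideal_pair O (fun y => exists2 z, O z & y = s * z).
Proof.
move=> ip; split; [exact: ip_O1 ip | exact: ip_OB ip | exact: ip_OM ip | | |].
- by exists 0; [exact: ip_O0 ip | rewrite mulr0].
- move=> _ _ [z Oz ->] [z' Oz' ->]; exists (z + z'); last by rewrite mulrDr.
  exact: ip_OD ip _ _ Oz Oz'.
- move=> y _ Oy [z Oz ->]; exists (y * z); last by rewrite mulrCA.
  exact: ip_OM ip _ _ Oy Oz.
Qed.

(** * Macaulay rows and minors *)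

Lemma filter_split (T : eqType) (P Q : pred T) s :
  perm_eq (filter P s) (filter (predI P Q) s ++ filter (predI P (predC Q)) s).
Proof.
rewrite perm_sym; have := permEl (perm_filterC Q (filter P s)).
by rewrite -!filter_predI (eq_filter (a2 := predI P Q)) 1?(eq_filter (a1 := predI (predC Q) P) (a2 := predI P (predC Q))) // => x /=; rewrite andbC.
Qed.

Section Monomials.
Variable n : nat.

Definition ms e : seq 'X_{1..n} :=
  [seq val m | m <- [seq m <- enum {: 'X_{1..n < e.+1}} | mdeg (val m) == e]].

Lemma mem_ms e m : (m \in ms e) = (mdeg m == e).
Proof.
apply/mapP/idP => [[m' + ->]|/eqP Hm]; first by rewrite mem_filter => /andP[].
have lt : (mdeg m < e.+1)%N by rewrite Hm.
by exists (BMultinom lt) => //; rewrite mem_filter mem_enum /= Hm eqxx.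
Qed.

Lemma ms_uniq e : uniq (ms e).
Proof. by rewrite map_inj_uniq; [rewrite filter_uniq ?enum_uniq | exact: val_inj]. Qed.

Lemma mem_filter_ms (P : pred 'X_{1..n}) e m : (m \in filter P (ms e)) = P m && (mdeg m == e).
Proof. by rewrite mem_filter mem_ms. Qed.

Lemma mnm_le_mdeg (m : 'X_{1..n}) i : (m i <= mdeg m)%N.
Proof. by rewrite mdegE (bigD1 i) //= leq_addr. Qed.

Lemma dhomog_ms (K : fieldType) (p : {mpoly K[n]}) e : p \is e.-homog ->
  p = \sum_(m <- ms e) p@_m *: 'X_[m].
Proof.
move=> Hp; apply/mpolyP => m; rewrite raddf_sum /=.
have [Hm|Hm] := eqVneq (mdeg m) e; last first.
  rewrite (dhomog_nemf_coeff Hp Hm) big_seq big1 // => m'; rewrite mem_ms => /eqP Hm'.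
  by rewrite mcoeffZ mcoeffX; have [E|_] := eqVneq m' m; [rewrite -E Hm' eqxx in Hm | rewrite mulr0].
rewrite (bigD1_seq m) ?ms_uniq ?mem_ms ?Hm //= mcoeffZ mcoeffX eqxx mulr1.
by rewrite big1 ?addr0 // => m' /negbTE nm; rewrite mcoeffZ mcoeffX nm mulr0.
Qed.

Lemma eq_dhomog (K : fieldType) (p q : {mpoly K[n]}) e : p \is e.-homog -> q \is e.-homog ->
  {in ms e, forall m, p@_m = q@_m} -> p = q.
Proof.
move=> Hp Hq H; rewrite (dhomog_ms Hp) (dhomog_ms Hq) big_seq [RHS]big_seq.
by apply: eq_bigr => m /H ->.
Qed.

Lemma mnm_subK (m : 'X_{1..n}) i d : (d <= m i)%N -> (m - U_(i) *+ d + U_(i) *+ d)%MM = m.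
Proof.
move=> le; apply: submK; apply/mnm_lepP => j; rewrite mulmnE mnm1E.
by case: eqP => [<-|_]; rewrite ?mul1n ?mul0n.
Qed.

End Monomials.

Section InSpan.
Variables (K : fieldType) (V : lmodType K) (T : eqType).

Definition inspan (s : seq T) (r : T -> V) (p : V) : Prop :=
  exists c : T -> K, p = \sum_(b <- s) c b *: r b.

Lemma inspan0 s r : inspan s r 0.
Proof. by exists (fun _ => 0); rewrite big1 // => b _; rewrite scale0r. Qed.

Lemma inspanD s r p q : inspan s r p -> inspan s r q -> inspan s r (p + q).
Proof.
move=> [c ->] [c' ->]; exists (fun b => c b + c' b).
by rewrite -big_split; apply: eq_bigr => b _; rewrite scalerDl.
Qed.

Lemma inspanZ s r a p : inspan s r p -> inspan s r (a *: p).
Proof.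
move=> [c ->]; exists (fun b => a * c b).
by rewrite scaler_sumr; apply: eq_bigr => b _; rewrite scalerA.
Qed.

Lemma inspan_sum (I : eqType) (t : seq I) (f : I -> V) s r :
  {in t, forall i, inspan s r (f i)} -> inspan s r (\sum_(i <- t) f i).
Proof.
move=> H; rewrite big_seq; apply: (big_ind (inspan s r)) => //; first exact: inspan0.
exact: inspanD.
Qed.

Lemma inspan_mem s r b : uniq s -> b \in s -> inspan s r (r b).
Proof.
move=> U Hb; exists (fun b' => (b' == b)%:R).
rewrite (bigD1_seq b) //= eqxx scale1r big1 ?addr0 // => b' /negbTE ->.
by rewrite scale0r.
Qed.

Lemma inspan_sub s s' r r' p : uniq s' -> {subset s <= s'} -> {in s, r =1 r'} ->
  inspan s r p -> inspan s' r' p.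
Proof.
move=> U sub e [c ->]; apply: inspan_sum => b bs; apply: inspanZ.
by rewrite e //; apply: inspan_mem => //; apply: sub.
Qed.

End InSpan.

Lemma seq_choice (T : eqType) (A : Type) (a0 : A) (s : seq T) (P : T -> A -> Prop) :
  {in s, forall x, exists a, P x a} -> exists f : T -> A, {in s, forall x, P x (f x)}.
Proof.
elim: s => [|x s IH] H; first by exists (fun _ => a0).
have [|f Hf] := IH; first by move=> y ys; apply: H; rewrite inE ys orbT.
have [|a Ha] := H x; first by rewrite mem_head.
exists (fun y => if y == x then a else f y) => y; rewrite inE.
by case: eqP => [-> //|_ /=]; apply: Hf.
Qed.

Section Rows.
Variables (K : fieldType) (N d : nat).
Hypothesis d_gt0 : (0 < d)%N.
Local Notation V := N.+1.
Local Notation poly := {mpoly K[V]}.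
Implicit Types (F : 'I_V -> poly) (a b : 'X_{1..V}) (k e : nat).

(** The number of forms is a natural number k, with indices recovered by [inord], to allow induction
    on k inside one polynomial ring. *)
Definition cnt k a : nat := \sum_(j < k) (d <= a (inord j))%N.
Definition hit k a := (0 < cnt k a)%N.
Definition nonred k a := (1 < cnt k a)%N.

(* Macaulay's pivot: the row of a monomial is obtained from the first form
   F_j, j < k, whose d-th power x_j^d divides it; k = N.+1 is the full system. *)
Fixpoint row F k a : poly :=
  if k is k'.+1 then
    if hit k' a then row F k' a else
    if (d <= a (inord k'))%N then 'X_[a - U_(inord k') *+ d] * F (inord k') else 'X_[a]
  else 'X_[a].

Definition hits k e := [seq a <- ms V e | hit k a].
Definition stds k e := [seq a <- ms V e | ~~ hit k a].
Definition nonreds k e := [seq a <- ms V e | nonred k a].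
Definition minor U F k : K := detq U (fun a b => (row F k a)@_b).

Local Notation u_ k := (U_(inord k) *+ d)%MM.

Lemma cntS k a : cnt k.+1 a = (cnt k a + (d <= a (inord k)))%N.
Proof. by rewrite /cnt big_ord_recr. Qed.

Lemma hitS k a : hit k.+1 a = hit k a || (d <= a (inord k))%N.
Proof. by rewrite /hit cntS addn_gt0; case: (d <= _)%N; rewrite ?orbT ?orbF. Qed.

Lemma nonredS k a : nonred k.+1 a = nonred k a || hit k a && (d <= a (inord k))%N.
Proof. by rewrite /nonred /hit cntS; case: (d <= _)%N; lia. Qed.

Lemma nonred_hit k a : nonred k a -> hit k a.
Proof. exact: ltnW. Qed.

Lemma hit_le j k a : (j <= k)%N -> hit j a -> hit k a.
Proof.
by move=> /subnK <-; elim: (k - j)%N => // i IH /IH; rewrite addSn hitS => ->.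
Qed.

Lemma rowS_hit F k a : hit k a -> row F k.+1 a = row F k a.
Proof. by move=> /= ->. Qed.

Lemma row_std F k a : ~~ hit k a -> row F k a = 'X_[a].
Proof.
elim: k => //= k IH; rewrite hitS negb_or => /andP[/negbTE h /negbTE h'].
by rewrite h h'.
Qed.

Lemma shiftE a k : ((a + u_ k)%MM (inord k : 'I_V) = a (inord k) + d)%N.
Proof. by rewrite mnmDE mulmnE mnm1E eqxx mul1n. Qed.

Lemma shift_neqE a k j : (j <= N)%N -> (k <= N)%N -> j != k ->
  ((a + u_ k)%MM (inord j : 'I_V) = a (inord j))%N.
Proof.
move=> jN kN jk; rewrite mnmDE mulmnE mnm1E; case: eqP => [/(congr1 val)|_].
  by rewrite /= !inordK // => E; rewrite E eqxx in jk.
by rewrite mul0n addn0.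
Qed.

Lemma mdeg_shift a k : mdeg (a + u_ k) = (mdeg a + d)%N.
Proof. by rewrite mdegD mdegMn mdeg1 mul1n. Qed.

Lemma cnt_shift k a j : (k <= j)%N -> (j <= N)%N -> cnt k (a + u_ j) = cnt k a.
Proof.
move=> kj jN; apply: eq_bigr => i _.
have ij : (i < j)%N by rewrite (leq_trans (ltn_ord i)).
by rewrite shift_neqE ?(ltnW (leq_trans ij jN)) // ?(ltn_eqF ij).
Qed.

Lemma hit_shift k a : (k <= N)%N -> hit k (a + u_ k) = hit k a.
Proof. by move=> kN; rewrite /hit cnt_shift. Qed.

Lemma hitS_shift k a : hit k.+1 (a + u_ k).
Proof. by rewrite hitS shiftE leq_addl orbT. Qed.

Lemma row_new F k a : (k <= N)%N -> ~~ hit k a ->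
  row F k.+1 (a + u_ k) = 'X_[a] * F (inord k).
Proof.
by move=> kN h /=; rewrite hit_shift // (negbTE h) shiftE leq_addl addmK.
Qed.

Lemma rowP F k a : (k <= V)%N -> hit k a ->
  exists j, [/\ (j < k)%N, (d <= a (inord j))%N & row F k a = 'X_[a - u_ j] * F (inord j)].
Proof.
elim: k => [|k IH] kV; first by rewrite /hit /cnt big_ord0.
have [h _|h] := boolP (hit k a).
  have [|//|j [jk dj E]] := IH; first exact: ltnW.
  by exists j; split; [exact: ltnW | | rewrite rowS_hit].
by rewrite hitS (negbTE h) /= => da; exists k; rewrite (negbTE h) da.
Qed.

Lemma row_homog F k a : (forall j, F j \is d.-homog) -> (k <= V)%N ->
  row F k a \is (mdeg a).-homog.
Proof.
move=> HF kV; have [h|h] := boolP (hit k a); last by rewrite row_std // dhomogX.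
have [j [jk dj ->]] := rowP F kV h.
rewrite -[X in X.-homog](subnK (_ : d <= mdeg a)%N).
  apply: dhomogM => //; rewrite dhomogX /=.
  by rewrite -{2}(mnm_subK dj) mdeg_shift addnK.
exact: leq_trans dj (mnm_le_mdeg _ _).
Qed.

(** The pivot only depends on exponents of index below k, so a factor x_j^d with j >= k does not
    change it. *)
Lemma row_shift F k a j : (k <= j)%N -> (j <= N)%N -> hit k a ->
  row F k (a + u_ j) = row F k a * 'X_[u_ j].
Proof.
move=> kj jN; elim: k kj => [|k IH] kj; first by rewrite /hit /cnt big_ord0.
have kN : (k <= N)%N by rewrite (leq_trans _ jN) // ltnW.
rewrite hitS /= /hit (cnt_shift _ (ltnW kj)) // -/(hit k a).
case: ifP => h /=; first by rewrite IH // ltnW.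
have kj' : k != j by rewrite ltn_eqF.
rewrite shift_neqE // => dk; rewrite dk.
rewrite -{1}(mnm_subK dk) -addmA [X in (_ + X)%MM]addmC addmA addmK.
by rewrite mpolyXD mulrAC.
Qed.

Lemma row_supp F k a b j : (k <= j)%N -> (j <= N)%N -> hit k a ->
  (row F k a)@_b != 0 -> (a (inord j) <= b (inord j))%N.
Proof.
move=> kj jN h; have [i [ik di ->]] := rowP F (leqW (leq_trans kj jN)) h.
rewrite -mcoeff_msupp mulrC (perm_mem (msuppMX _ _)) => /mapP[m _ ->].
rewrite mnmDE (leq_trans _ (leq_addr _ _)) // mnmBE mulmnE mnm1E.
case: eqP => [/(congr1 val)|_]; last by rewrite mul0n subn0.
rewrite /= !inordK // ?(leq_trans ik) //; first by move=> E; rewrite E ltnNge kj in ik.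
exact: leq_trans kj (leqW jN).
Qed.

Lemma hits_uniq k e : uniq (hits k e).
Proof. by rewrite filter_uniq ?ms_uniq. Qed.

Lemma hits_lt k e : (e < d)%N -> hits k e = [::].
Proof.
move=> ed; apply/eqP; rewrite -[_ == _]negbK -has_filter; apply/hasPn => a.
rewrite mem_ms => /eqP Ha; rewrite -leqNgt leqn0 /cnt; apply/eqP; apply: big1 => j _.
by rewrite leqNgt (leq_ltn_trans (mnm_le_mdeg _ _)) // Ha.
Qed.

Lemma nonreds_lt k e : (e < d)%N -> nonreds k e = [::].
Proof.
move=> ed; apply/eqP; rewrite -[_ == _]negbK -has_filter; apply/hasPn => a Ha.
apply/negP => /nonred_hit h; have : a \in hits k e by rewrite mem_filter h.
by rewrite hits_lt.
Qed.

Lemma minor_nil F k : minor [::] F k = 1.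
Proof. exact: detq1. Qed.

Lemma perm_ms k e : perm_eq (ms V e) (hits k e ++ stds k e).
Proof. by rewrite perm_sym; apply: permEl; apply: perm_filterC. Qed.

(** A row without pivot is its own monomial, so these rows contribute an identity block. *)
Lemma minor_full F k e : detq (ms V e) (fun a b => (row F k a)@_b) = minor (hits k e) F k.
Proof.
have pe : perm_eq (ms V e) (stds k e ++ hits k e).
  by rewrite (permPl (perm_ms k e)) perm_catC.
rewrite (perm_detq _ pe) detq_cat.
  rewrite (detq1 (s := stds k e)) ?mul1r ?filter_uniq ?ms_uniq // => a b.
  by rewrite mem_filter => /andP[h _] _; rewrite row_std // mcoeffX.
move=> a b; rewrite !mem_filter => /andP[h _] /andP[h' _]; rewrite row_std // mcoeffX.
by case: eqP h => // ->; rewrite h'.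
Qed.

Lemma perm_shift (P : pred 'X_{1..V}) k e : (forall a, P (a + u_ k) = P a)%MM ->
  perm_eq [seq a <- ms V (e + d) | P a && (d <= a (inord k))%N]
          [seq (a + u_ k)%MM | a <- [seq a <- ms V e | P a]].
Proof.
move=> HP; apply: uniq_perm; first by rewrite filter_uniq ?ms_uniq.
  by rewrite map_inj_uniq ?filter_uniq ?ms_uniq // => a b; apply: addIm.
move=> a; rewrite mem_filter_ms; apply/idP/mapP.
  move=> /andP[/andP[Pa da] /eqP ea]; exists (a - u_ k)%MM; last by rewrite mnm_subK.
  by rewrite mem_filter_ms -HP mnm_subK // Pa -(eqn_add2r d) -(mdeg_shift _ k) mnm_subK // ea /=.
move=> [b]; rewrite mem_filter_ms => /andP[Pb /eqP eb] ->.
by rewrite HP Pb shiftE leq_addl mdeg_shift eb /=.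
Qed.

Lemma minor_shift (P : pred 'X_{1..V}) F k e : (k <= N)%N -> (forall a, P a -> hit k a) ->
  (forall a, P (a + u_ k) = P a)%MM ->
  minor [seq a <- ms V (e + d) | P a && (d <= a (inord k))%N] F k =
  minor [seq a <- ms V e | P a] F k.
Proof.
move=> kN Ph HP; rewrite /minor (perm_detq _ (perm_shift e HP)) detq_map.
apply: eq_detq => a b; rewrite mem_filter => /andP[Pa _] _.
by rewrite row_shift ?Ph // addmC mcoeffMX.
Qed.

(* A row with a_k >= d only meets columns with b_k >= d, and dividing by x_k^d
   identifies that block with one in degree e. *)
Lemma nonreds_rec F k e : (k <= N)%N ->
  minor (nonreds k.+1 (e + d)) F k.+1 * minor (nonreds k e) F k =
  minor (nonreds k (e + d)) F k * minor (hits k e) F k.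
Proof.
move=> kN; pose Q a := (d <= a (inord k : 'I_V))%N.
(* Both nonreduced minors of degree e + d contain this block. Their complements are the shifts by
   x_k^d of the hit, respectively nonreduced, monomials of degree e. *)
pose B := [seq a <- ms V (e + d) | nonred k a && ~~ Q a].
have split1 : forall P : pred 'X_{1..V}, (forall a, P a -> hit k a) ->
    minor ([seq a <- ms V (e + d) | P a && Q a] ++ B) F k =
    minor [seq a <- ms V (e + d) | P a && Q a] F k * minor B F k.
  move=> P Ph; apply: detq_cat => a b; rewrite !mem_filter.
  move=> /andP[/andP[Pa Qa] _] /andP[/andP[_ Qb] _]; apply: contraNeq Qb => nz.
  exact: leq_trans Qa (row_supp (leqnn k) kN (Ph _ Pa) nz).
have e1 : minor (nonreds k.+1 (e + d)) F k.+1 =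
    minor ([seq a <- ms V (e + d) | hit k a && Q a] ++ B) F k.
  rewrite /minor (@eq_detq _ _ _ _ (fun a b => (row F k a)@_b)); last first.
    move=> a b; rewrite mem_filter nonredS => /andP[h _] _; rewrite rowS_hit //.
    by case/orP: h => [/nonred_hit|/andP[]].
  apply: perm_detq; rewrite (permPl (filter_split _ Q _)); apply: perm_cat.
    apply/seq.permP => p; congr (count p _); apply: eq_filter => a /=.
    rewrite nonredS -/(Q a); case: (Q a); rewrite ?andbT ?andbF //.
    by case: (boolP (nonred k a)) => // /nonred_hit ->.
  apply/seq.permP => p; congr (count p _); apply: eq_filter => a /=.
  by rewrite nonredS -/(Q a); case: (Q a); rewrite ?andbT ?andbF ?orbF.
have e2 : minor (nonreds k (e + d)) F k =
    minor ([seq a <- ms V (e + d) | nonred k a && Q a] ++ B) F k.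
  by apply: perm_detq; apply: filter_split.
rewrite e1 e2 (split1 (hit k)) // (split1 (nonred k)); last exact: nonred_hit.
rewrite !minor_shift //; first by rewrite -/(nonreds k e) -/(hits k e); ring.
- exact: nonred_hit.
- by move=> a; rewrite /nonred cnt_shift.
- by move=> a; rewrite hit_shift.
Qed.

(** By [nonreds_rec] the minor for k + 1 forms divides a product of minors for k forms.
    Nondegeneracy of the systems with fewer forms therefore controls det M'. *)
Lemma nonreds_neq0 F k e : (k <= V)%N ->
  (forall j e', (j < k)%N -> (e' <= e)%N -> minor (hits j e') F j != 0) ->
  minor (nonreds k e) F k != 0.
Proof.
elim: k e => [|k IH] e kV H.
  rewrite (_ : nonreds 0 e = [::]) ?minor_nil ?oner_eq0 //.
  by apply/eqP; rewrite -[_ == _]negbK -has_filter; apply/hasPn => a _; rewrite /nonred /cnt big_ord0.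
have [ed|de] := ltnP e d; first by rewrite nonreds_lt // minor_nil oner_eq0.
have H' e' : (e' <= e)%N -> minor (nonreds k e') F k != 0.
  move=> le; apply: IH; first exact: ltnW.
  by move=> j e'' jk le'; apply: H; [apply: ltnW | apply: leq_trans le].
have := @nonreds_rec F k (e - d) kV; rewrite subnK // => E.
have : minor (nonreds k.+1 e) F k.+1 * minor (nonreds k (e - d)) F k != 0.
  by rewrite E mulf_neq0 ?H' ?H ?leq_subr.
by rewrite mulf_eq0 negb_or => /andP[].
Qed.

End Rows.

(** * Row spans and the ideal in a fixed degree *)

Section Spans.
Variables (K : fieldType) (N d : nat).
Hypothesis d_gt0 : (0 < d)%N.
Local Notation V := N.+1.
Local Notation poly := {mpoly K[V]}.
Implicit Types (F : 'I_V -> poly) (a b : 'X_{1..V}) (k e : nat).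
Local Notation u_ k := (U_(inord k) *+ d)%MM.

Definition hform F := forall j, F j \is d.-homog.

Lemma rows_span F k e p : hform F -> (k <= V)%N -> minor d (hits N d k e) F k != 0 ->
  p \is e.-homog -> inspan (ms V e) (row d F k) p.
Proof.
move=> HF kV; rewrite -minor_full => nz Hp.
have [c Hc] := detq_span (fun b => p@_b) (ms_uniq V e) nz.
exists c; apply: (eq_dhomog Hp); last first.
  by move=> b be; rewrite raddf_sum /= Hc //; apply: eq_bigr => a _; rewrite mcoeffZ.
rewrite big_seq; apply: rpred_sum => a; rewrite mem_ms => /eqP <-.
by apply: rpredZ; apply: row_homog.
Qed.

Lemma hits_lift F k e p : inspan (hits N d k e) (row d F k) p ->
  inspan (hits N d k.+1 e) (row d F k.+1) p.
Proof.
apply: inspan_sub => [|a|a]; first exact: hits_uniq.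
  by rewrite !mem_filter hitS => /andP[-> ->].
by rewrite mem_filter => /andP[h _]; rewrite rowS_hit.
Qed.

(* The ideal of the first k forms is, degree by degree, spanned by the rows
   with a pivot: multiply F_k by a basis of rows, and recurse on the products
   that already involve an earlier form. *)
Lemma ideal_span F k e : hform F -> (k <= V)%N ->
  (forall j, (j < k)%N -> minor d (hits N d j e) F j != 0) ->
  forall j q, (j < k)%N -> q \is e.-homog ->
  inspan (hits N d k (e + d)) (row d F k) (q * F (inord j)).
Proof.
move=> HF; elim: k => // k IH kV nz j q jk Hq.
have IH' i q' : (i < k)%N -> q' \is e.-homog ->
    inspan (hits N d k (e + d)) (row d F k) (q' * F (inord i)).
  by apply: IH => [|i' ik]; [exact: ltnW | apply: nz; exact: ltnW].
move: jk; rewrite ltnS leq_eqVlt => /orP[/eqP ->|jk]; last by apply: hits_lift; apply: IH'.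
have [c ->] := rows_span HF (ltnW kV) (nz k (ltnSn k)) Hq.
rewrite mulr_suml; apply: inspan_sum => b; rewrite mem_ms => /eqP be.
rewrite -scalerAl; apply: inspanZ.
have [h|h] := boolP (hit d k b).
  have [i [ik di ->]] := rowP F (ltnW kV) h.
  rewrite mulrAC; apply: hits_lift; apply: IH' => //.
  rewrite -(_ : (e - d + d)%N = e).
    apply: dhomogM => //; rewrite dhomogX /=.
    by rewrite -be -{2}(mnm_subK di) mdeg_shift addnK.
  by rewrite subnK // -be (leq_trans di) ?mnm_le_mdeg.
rewrite row_std // -(@row_new _ _ d F k b kV h); apply: inspan_mem; first exact: hits_uniq.
by rewrite mem_filter_ms hitS_shift mdeg_shift be /=.
Qed.

(** The coefficients expressing the monomials through the rows form a left inverse of the matrix of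
    rows. *)
Lemma minor_neq0_span F k e : hform F -> (k <= V)%N ->
  {in ms V e, forall m, inspan (ms V e) (row d F k) 'X_[m]} ->
  minor d (hits N d k e) F k != 0.
Proof.
move=> HF kV H; rewrite -minor_full.
have [C HC] := @seq_choice _ _ (fun _ => 0) _ _ H.
have E : detq (ms V e) (fun a b => C a b) * detq (ms V e) (fun a b => (row d F k a)@_b) = 1.
  rewrite -(@detq_mul _ _ _ (fun a b => (a == b)%:R)); first by rewrite detq1 ?ms_uniq.
  move=> a b ae be; rewrite -mcoeffX HC // raddf_sum /=.
  by apply: eq_bigr => c _; rewrite mcoeffZ.
by apply: contra_eq_neq E => ->; rewrite mulr0 eq_sym oner_eq0.
Qed.

End Spans.

(** * Permuting the variables *)

Section Compare.
Variables (K : fieldType) (N d : nat).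
Hypothesis d_gt0 : (0 < d)%N.
Local Notation V := N.+1.
Local Notation poly := {mpoly K[V]}.
Implicit Types (F : 'I_V -> poly) (a b : 'X_{1..V}) (k e : nat).
Local Notation u_ k := (U_(inord k) *+ d)%MM.
Variable (s : 'S_V).

(** The variables move but the forms keep their positions, so form j is matched with a different
    variable as its pivot. *)
Definition symf F : 'I_V -> poly := fun j => msym s (F j).
Local Notation g := (@msym V K s).
Local Notation h := (@msym V K s^-1%g).

Lemma msym_sum (t : 'S_V) (I : Type) (l : seq I) (f : I -> poly) :
  msym t (\sum_(i <- l) f i) = \sum_(i <- l) msym t (f i).
Proof. exact: raddf_sum. Qed.

Lemma msymK : cancel g h.
Proof. by move=> p; rewrite -msymMm mulgV msym1m. Qed.

Lemma msymVK : cancel h g.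
Proof. by move=> p; rewrite -msymMm mulVg msym1m. Qed.

Lemma msym_homog (t : 'S_V) (p : poly) e : p \is e.-homog -> msym t p \is e.-homog.
Proof.
move=> Hp; rewrite (dhomog_ms Hp) msym_sum big_seq; apply: rpred_sum => m.
rewrite mem_ms => me; rewrite msymZ msymX; apply: rpredZ.
by rewrite dhomogX /= mdeg_mperm.
Qed.

Lemma symf_hform F : hform d F -> hform d (symf F).
Proof. by move=> HF j; apply: msym_homog. Qed.

(** Carried back to the original variables, a pivoted row of the permuted system is again a monomial
    times one of the same forms F_j, so [row] and [row'] can be compared inside one ideal. *)
Definition row' F k b : poly := h (row d (symf F) k b).

Definition symdet e : K := detq (ms V e) (fun c b => (h 'X_[c])@_b).

Lemma symdet_neq0 e : symdet e != 0.
Proof.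
have E : detq (ms V e) (fun c b => (g 'X_[c])@_b) * symdet e = 1.
  rewrite -(@detq_mul _ _ _ (fun a b => (a == b)%:R)); first by rewrite detq1 ?ms_uniq.
  move=> a b; rewrite mem_ms => ae _; rewrite -mcoeffX -{1}(msymK 'X_[a]).
  have Hg : g 'X_[a] \is e.-homog by apply: msym_homog; rewrite dhomogX.
  rewrite {1}(dhomog_ms Hg) msym_sum raddf_sum; apply: eq_bigr => c _.
  by rewrite msymZ; exact: mcoeffZ.
by apply: contra_eq_neq E => ->; rewrite mulr0 eq_sym oner_eq0.
Qed.

Lemma detq_row' F k e : hform d F -> (k <= V)%N ->
  detq (ms V e) (fun a b => (row' F k a)@_b) = minor d (hits N d k e) (symf F) k * symdet e.
Proof.
move=> HF kV; rewrite -minor_full; apply: detq_mul => a b; rewrite mem_ms => /eqP ae _.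
have H : row d (symf F) k a \is e.-homog by rewrite -ae; apply: row_homog => //; apply: symf_hform.
rewrite /row' {1}(dhomog_ms H) msym_sum raddf_sum; apply: eq_bigr => c _.
by rewrite msymZ; exact: mcoeffZ.
Qed.

Definition generic F k e := forall j e', (j < k)%N -> (e' <= e)%N ->
  minor d (hits N d j e') F j != 0 /\ minor d (hits N d j e') (symf F) j != 0.

Lemma inspan_row' F k l p : inspan l (row d (symf F) k) (g p) -> inspan l (row' F k) p.
Proof. by move=> [c E]; exists c; rewrite -(msymK p) E msym_sum; apply: eq_bigr => b _; rewrite msymZ. Qed.

(* Extends the change of basis on the pivoted rows to all rows of degree e. *)
Lemma full_transition F k e (Th : 'X_{1..V} -> 'X_{1..V} -> K) : hform d F -> (k <= V)%N ->
  minor d (hits N d k e) (symf F) k != 0 ->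
  {in hits N d k e, forall a, row d F k a = \sum_(b <- hits N d k e) Th a b *: row' F k b} ->
  exists Tf : 'X_{1..V} -> 'X_{1..V} -> K,
   [/\ {in ms V e, forall a, row d F k a = \sum_(b <- ms V e) Tf a b *: row' F k b} &
    minor d (hits N d k e) F k =
    detq (hits N d k e) Th * detq (stds N d k e) Tf *
      (minor d (hits N d k e) (symf F) k * symdet e)].
Proof.
move=> HF kV nz HTh.
have [S HS] : exists S : 'X_{1..V} -> 'X_{1..V} -> K,
    {in ms V e, forall a, row d F k a = \sum_(b <- ms V e) S a b *: row' F k b}.
  apply: (@seq_choice _ _ (fun _ => 0) _ (fun a c => row d F k a = \sum_(b <- ms V e) c b *: row' F k b)) => a; rewrite mem_ms => /eqP ae.
  apply: inspan_row'; apply: rows_span => //; first exact: symf_hform.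
  by apply: msym_homog; rewrite -ae; apply: row_homog.
pose Tf a b := if hit d k a then if hit d k b then Th a b else 0 else S a b.
have HTf : {in ms V e, forall a, row d F k a = \sum_(b <- ms V e) Tf a b *: row' F k b}.
  move=> a ae; rewrite /Tf; case: (boolP (hit d k a)) => ha; last exact: HS.
  rewrite (perm_big _ (perm_ms N d k e)) big_cat /= [X in _ + X]big_seq [X in _ + X]big1.
    rewrite addr0 HTh ?mem_filter ?ha // big_seq [RHS]big_seq; apply: eq_bigr => b.
    by rewrite mem_filter => /andP[-> _].
  by move=> b; rewrite mem_filter => /andP[/negbTE -> _]; rewrite scale0r.
exists Tf; split => //.
rewrite -minor_full -detq_row' // (@detq_mul _ _ _ _ Tf (fun a b => (row' F k a)@_b)).
  congr (_ * _); rewrite (perm_detq _ (perm_ms N d k e)) detq_cat.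
    congr (_ * _); apply: eq_detq => a b; rewrite !mem_filter /Tf => /andP[-> _].
    by move=> /andP[-> _].
  move=> a b; rewrite !mem_filter /Tf => /andP[-> _].
  by move=> /andP[/negbTE -> _].
move=> a b ae _; rewrite HTf // raddf_sum /=; apply: eq_bigr => c _; exact: mcoeffZ.
Qed.

(** [Th] is the change of basis between the two families of pivoted rows, and c does not depend on
    F. For k + 1 forms in degree e + d the rows are those for k forms together with x^a F_k, a
    standard of degree e. Hence [Th] is block triangular, with blocks coming from degrees e + d and
    e, and its determinant follows the same recursion as the quotient of the two nonreduced
    minors. *)
Lemma transition k e : (k <= V)%N -> exists2 c : K, c != 0 &
  forall F, hform d F -> generic F k e ->
  exists Th : 'X_{1..V} -> 'X_{1..V} -> K,
   {in hits N d k e, forall a, row d F k a = \sum_(b <- hits N d k e) Th a b *: row' F k b} /\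
   minor d (nonreds N d k e) F k =
   c * detq (hits N d k e) Th * minor d (nonreds N d k e) (symf F) k.
Proof.
elim: k e => [|k IH] e kV.
  exists 1; first by rewrite oner_eq0.
  move=> F HF gF; exists (fun _ _ => 0).
  have E P : (forall a, P a = false) -> [seq a <- ms V e | P a] = [::].
    by move=> HP; rewrite (eq_filter HP) filter_pred0.
  rewrite /hits /nonreds !E ?minor_nil; first by split => //; rewrite detq1 // !mulr1.
    by move=> a; rewrite /nonred /cnt big_ord0.
  by move=> a; rewrite /hit /cnt big_ord0.
have [ed|de] := ltnP e d.
  exists 1; first by rewrite oner_eq0.
  move=> F HF gF; exists (fun _ _ => 0).
  by rewrite hits_lt // nonreds_lt // !minor_nil; split => //; rewrite detq1 // !mulr1.
rewrite -(subnK de); move: (e - d)%N => {}e {de}.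
have [c1 c1nz H1] := IH (e + d)%N (ltnW kV).
have [c2 c2nz H2] := IH e (ltnW kV).
(* Dividing [nonreds_rec] for F by that for the permuted system leaves c1 from degree e + d, 1 / c2
   from degree e, and [symdet e] from the full minors of degree e. *)
exists (c1 * symdet e / c2); first by rewrite !mulf_neq0 ?invr_neq0 ?symdet_neq0.
move=> F HF gF.
have HgF := symf_hform HF.
have [Th1 [HTh1 w1]] : exists Th : 'X_{1..V} -> 'X_{1..V} -> K,
   {in hits N d k (e + d), forall a, row d F k a = \sum_(b <- hits N d k (e + d)) Th a b *: row' F k b} /\
   minor d (nonreds N d k (e + d)) F k =
   c1 * detq (hits N d k (e + d)) Th * minor d (nonreds N d k (e + d)) (symf F) k.
  by apply: H1 => // j e' jk le; apply: gF => //; apply: ltnW.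
have [Th2 [HTh2 w2]] : exists Th : 'X_{1..V} -> 'X_{1..V} -> K,
   {in hits N d k e, forall a, row d F k a = \sum_(b <- hits N d k e) Th a b *: row' F k b} /\
   minor d (nonreds N d k e) F k =
   c2 * detq (hits N d k e) Th * minor d (nonreds N d k e) (symf F) k.
  by apply: H2 => // j e' jk le; apply: gF; [apply: ltnW | apply: leq_trans le (leq_addr _ _)].
have [nzF nzgF] := gF k e (ltnSn k) (leq_addr _ _).
have [Tf [HTf mE]] := full_transition HF (ltnW kV) nzgF HTh2.
(* The off-diagonal block: a hit row times F_k stays in the ideal of the first k forms and is
   expanded again in degree e + d. *)
have [X HX] : exists X : 'X_{1..V} -> 'X_{1..V} -> K, {in stds N d k e, forall a,
    \sum_(b <- hits N d k e) Tf a b *: (row' F k b * F (inord k)) =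
    \sum_(b <- hits N d k (e + d)) X a b *: row' F k b}.
  apply: (@seq_choice _ _ (fun _ => 0) _ (fun a c => \sum_(b <- hits N d k e) Tf a b *: (row' F k b * F (inord k)) = \sum_(b <- hits N d k (e + d)) c b *: row' F k b)) => a _.
  apply: inspan_sum => b; rewrite mem_filter_ms => /andP[hb /eqP be]; apply: inspanZ.
  apply: inspan_row'; rewrite msymM msymVK -/(symf F (inord k)).
  have [j [jk dj ->]] := rowP (symf F) (ltnW kV) hb.
  rewrite mulrAC; apply: ideal_span => //; first exact: ltnW.
    move=> i ik; have [] // := gF i e (ltnW ik) (leq_addr _ _).
  have -> : e = ((e - d) + d)%N by rewrite subnK // -be (leq_trans dj) ?mnm_le_mdeg.
  apply: dhomogM => //; rewrite dhomogX /=.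
  by rewrite -be -{2}(mnm_subK dj) mdeg_shift addnK.
pose Th a b := if hit d k a then (if hit d k b then Th1 a b else 0)
  else if hit d k b then X (a - u_ k)%MM b else Tf (a - u_ k)%MM (b - u_ k)%MM.
have pe : perm_eq (hits N d k.+1 (e + d)) (hits N d k (e + d) ++ map (fun a => (a + u_ k)%MM) (stds N d k e)).
  rewrite (permPl (filter_split _ (hit d k) _)); apply: perm_cat.
    apply/seq.permP => p; congr (count p _); apply: eq_filter => a /=.
    by rewrite hitS; case: (hit d k a); rewrite ?andbF.
  rewrite -(permPr (perm_shift e (P := fun a => ~~ hit d k a) _)); last by move=> a; rewrite hit_shift.
  apply/seq.permP => p; congr (count p _); apply: eq_filter => a /=.
  by rewrite hitS; case: (hit d k a); rewrite ?andbF // andbT.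
have hs a : hit d k (a + u_ k) = hit d k a by apply: hit_shift.
have ThE : detq (hits N d k.+1 (e + d)) Th = detq (hits N d k (e + d)) Th1 * detq (stds N d k e) Tf.
  rewrite (perm_detq _ pe) detq_cat; last first.
    move=> a b; rewrite mem_filter => /andP[ha _] /mapP[b'].
    by rewrite mem_filter => /andP[hb _] ->; rewrite /Th ha hs (negbTE hb).
  rewrite detq_map; congr (_ * _); apply: eq_detq => a b.
    by rewrite !mem_filter /Th => /andP[-> _] /andP[-> _].
  rewrite !mem_filter /Th => /andP[/negbTE ha _] /andP[/negbTE hb _].
  by rewrite !hs ha hb !addmK.
exists Th; split.
  move=> a; rewrite (perm_mem pe) mem_cat => /orP[ha|].
    rewrite (perm_big _ pe) big_cat /= big_map [X in _ + X]big_seq [X in _ + X]big1.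
      have ha' : hit d k a by move: ha; rewrite mem_filter => /andP[].
      rewrite addr0 ha' HTh1 // big_seq [RHS]big_seq; apply: eq_bigr => b.
      by rewrite mem_filter => /andP[hb _]; rewrite /Th ha' hb /row' rowS_hit.
    move=> b; rewrite mem_filter => /andP[/negbTE hb _].
    by move: ha; rewrite mem_filter => /andP[ha _]; rewrite /Th ha hs hb scale0r.
  case/mapP => {}a astd ->; have := astd; rewrite mem_filter => /andP[ha ae].
  rewrite row_new // -(row_std F ha) HTf // (perm_big _ pe) (perm_big _ (perm_ms N d k e)) !big_cat /=.
  rewrite mulrDl; congr (_ + _).
    rewrite mulr_suml.
    transitivity (\sum_(b <- hits N d k e) Tf a b *: (row' F k b * F (inord k))); first by apply: eq_bigr => b _; rewrite scalerAl.
    rewrite HX // big_seq [RHS]big_seq; apply: eq_bigr => b.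
    rewrite mem_filter => /andP[hb _].
    by rewrite /Th hs (negbTE ha) hb addmK /row' rowS_hit.
  rewrite big_map mulr_suml big_seq [RHS]big_seq; apply: eq_bigr => b.
  rewrite mem_filter => /andP[hb _].
  rewrite /Th !hs (negbTE ha) (negbTE hb) !addmK -scalerAl /row' row_new // row_std //.
  by rewrite msymM msymK.
have nzw : minor d (nonreds N d k e) (symf F) k != 0.
  apply: nonreds_neq0 => // [|j e' jk le]; first exact: ltnW.
  by have [] := gF j e' (ltnW jk) (leq_trans le (leq_addr _ _)).
have nzT : detq (hits N d k e) Th2 != 0.
  by apply: contraNneq nzF => E; rewrite mE E !mul0r.
have r1 := nonreds_rec d_gt0 F e kV.
have r2 := nonreds_rec d_gt0 (symf F) e kV.
rewrite ThE; apply: (mulIf (mulf_neq0 (mulf_neq0 c2nz nzT) nzw)).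
transitivity (minor d (nonreds N d k.+1 (e + d)) F k.+1 * minor d (nonreds N d k e) F k).
  by rewrite w2; ring.
rewrite r1 w1 mE.
transitivity (c1 * detq (hits N d k (e + d)) Th1 * (detq (hits N d k e) Th2 * detq (stds N d k e) Tf * symdet e) *
   (minor d (nonreds N d k (e + d)) (symf F) k * minor d (hits N d k e) (symf F) k)).
  by ring.
rewrite -r2; field.
exact: c2nz.
Qed.

End Compare.

(** * The critical degree, and minors as functions of the coefficients *)

Section CrossIdentity.
Variables (K : fieldType) (N d : nat).
Hypothesis d_gt0 : (0 < d)%N.
Local Notation V := N.+1.
Implicit Types (F : 'I_V -> {mpoly K[V]}) (a b : 'X_{1..V}) (k e : nat).
Local Notation u_ k := (U_(inord k) *+ d)%MM.

Lemma hit_crit a : (V * d.-1 < mdeg a)%N -> hit d V a.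
Proof.
apply: contraTT; rewrite /hit -leqNgt leqn0 /cnt sum_nat_eq0 => /forallP H.
rewrite -leqNgt mdegE -[X in (X * _)%N](card_ord V) -sum_nat_const; apply: leq_sum => i _.
by have := H i; rewrite inord_val /= eqb0 -ltnNge; lia.
Qed.

Lemma hits_crit e : (V * d.-1 < e)%N -> hits N d V e = ms V e.
Proof.
move=> He; apply/all_filterP/allP => a; rewrite mem_ms => /eqP ae.
by apply: hit_crit; rewrite ae.
Qed.

(* The quotient det M / det M' is, up to a constant, unchanged by a permutation
   of the variables. *)
Lemma cross_identity (s : 'S_V) e : (V * d.-1 < e)%N -> exists c : K, exists c' : K,
  [/\ c != 0, c' != 0 & forall F, hform d F -> generic d s F V e ->
   c * (minor d (hits N d V e) F V * minor d (nonreds N d V e) (symf s F) V) =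
   c' * (minor d (hits N d V e) (symf s F) V * minor d (nonreds N d V e) F V)].
Proof.
move=> He; have [c c0 H] := transition K d_gt0 s e (leqnn V).
exists c, (symdet K s e); split => //; first exact: symdet_neq0.
move=> F HF gF; have [Th [H1 H2]] := H F HF gF.
have E : minor d (hits N d V e) F V =
    detq (hits N d V e) Th * (minor d (hits N d V e) (symf s F) V * symdet K s e).
  rewrite -detq_row' // -hits_crit //; apply: detq_mul => a b ae _.
  by rewrite H1 // raddf_sum; apply: eq_bigr => m _; apply: mcoeffZ.
by rewrite E H2; ring.
Qed.

(** The position (j, m) is chosen before F: each entry of a minor is one fixed coefficient of F or
    always zero. Homogeneity, congruences and polynomial dependence of minors rest on this. *)
Lemma row_coef k a b : (k <= V)%N -> hit d k a ->
  (forall F, (row d F k a)@_b = 0) \/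
  exists j m, (j < k)%N /\ forall F, (row d F k a)@_b = (F (inord j))@_m.
Proof.
move=> kV h.
have [j [jk dj E]] : exists j, [/\ (j < k)%N, (d <= a (inord j))%N &
    forall F, row d F k a = 'X_[a - u_ j] * F (inord j)].
  elim: k kV h => [|k IH] kV; first by rewrite /hit /cnt big_ord0.
  have [h _|h] := boolP (hit d k a).
    have [|//|j [jk dj E]] := IH; first exact: ltnW.
    by exists j; split; [exact: ltnW | | move=> F; rewrite rowS_hit].
  by rewrite hitS (negbTE h) /= => da; exists k; rewrite da; split => // F; rewrite (negbTE h).
have [le|nle] := boolP ((a - u_ j)%MM <= b)%MM; last first.
  left=> F; rewrite E mulrC; apply/eqP; rewrite mcoeff_eq0.
  rewrite (perm_mem (msuppMX _ _)); apply/mapP => -[m _ Eb].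
  by rewrite Eb lem_addr in nle.
right; exists j, (b - (a - u_ j))%MM; split => // F.
by rewrite E mulrC -{1}(submK le) addmC mcoeffMX.
Qed.

Definition all_hit k (U : seq 'X_{1..V}) := all (hit d k) U.

Lemma all_hit_hits k e : all_hit k (hits N d k e).
Proof. by apply/allP => a; rewrite mem_filter => /andP[]. Qed.

Lemma all_hit_nonreds k e : all_hit k (nonreds N d k e).
Proof. by apply/allP => a; rewrite mem_filter => /andP[/nonred_hit]. Qed.

Lemma minorZ F k U c : (k <= V)%N -> all_hit k U ->
  minor d U (fun j => c *: F j) k = c ^+ size U * minor d U F k.
Proof.
move=> kV /allP hU; rewrite -detqZ; apply: eq_detq => a b aU _.
have [E|[j [m [_ E]]]] := row_coef b kV (hU a aU); first by rewrite !E mulr0.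
by rewrite !E mcoeffZ.
Qed.

Lemma eq_minor F F' k U : (k <= V)%N -> all_hit k U ->
  (forall j, (j < k)%N -> F (inord j) = F' (inord j)) -> minor d U F k = minor d U F' k.
Proof.
move=> kV /allP hU H; apply: eq_detq => a b aU _.
have [E|[j [m [jk E]]]] := row_coef b kV (hU a aU); first by rewrite !E.
by rewrite !E H.
Qed.

Lemma minor_cong (O E : K -> Prop) F F' k U : ideal_pair O E -> (k <= V)%N -> all_hit k U ->
  (forall j m, (j < k)%N -> O (F (inord j))@_m) -> (forall j m, (j < k)%N -> O (F' (inord j))@_m) ->
  (forall j m, (j < k)%N -> E ((F (inord j))@_m - (F' (inord j))@_m)) ->
  E (minor d U F k - minor d U F' k).
Proof.
move=> ip kV /allP hU HF HF' HE; apply: (ip_detq_cong ip) => a b aU _;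
  have [e|[j [m [jk e]]]] := row_coef b kV (hU a aU); rewrite ?e; auto.
- exact: (ip_O0 ip).
- exact: (ip_O0 ip).
- by rewrite subrr; exact: (ip_E0 ip).
Qed.

(** The row of a is the monomial a plus c_j times a with x_j^d traded for a d-th power of smaller
    weight, so the matrix is unitriangular for the weight. *)
Lemma minor_trig F k U (tau : nat -> 'I_V) (c : nat -> K) (w : 'I_V -> nat) :
  (k <= V)%N -> all_hit k U -> uniq U ->
  (forall j, (j < k)%N -> F (inord j) = 'X_[u_ j] + c j *: 'X_[U_(tau j) *+ d]) ->
  (forall j, (j < k)%N -> c j != 0 -> (w (tau j) < w (inord j))%N) ->
  minor d U F k = 1.
Proof.
move=> kV /allP hU uU HF Hw.
pose wt a := (\sum_i a i * w i)%N.
have wtD a b : wt (a + b)%MM = (wt a + wt b)%N.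
  by rewrite /wt -big_split; apply: eq_bigr => i _; rewrite mnmDE mulnDl.
have wtU i : wt (U_(i) *+ d)%MM = (d * w i)%N.
  rewrite /wt (bigD1 i) //= big1 ?addn0; first by rewrite mulmnE mnm1E eqxx mul1n.
  by move=> j /negbTE ji; rewrite mulmnE mnm1E eq_sym ji !mul0n.
have H a : a \in U -> exists x b', (x != 0 -> (wt b' < wt a)%N) /\
    forall b, (row d F k a)@_b = (a == b)%:R + x * (b' == b)%:R.
  move=> aU; have [j [jk dj ->]] := rowP F kV (hU a aU).
  exists (c j), (a - u_ j + U_(tau j) *+ d)%MM; split.
    move=> /(Hw j jk) lt; rewrite -{2}(mnm_subK dj) !wtD !wtU ltn_add2l.
    by rewrite ltn_pmul2l.
  move=> b; rewrite HF // mulrDr -mpolyXD mnm_subK // -scalerAr -mpolyXD.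
  by rewrite mcoeffD mcoeffZ !mcoeffX.
apply: (detq_trig (w := wt)) => // [a aU|a b aU bU ab wab].
  have [x [b' [lt ->]]] := H a aU; rewrite eqxx.
  have [->|x0] := eqVneq x 0; first by rewrite mul0r addr0.
  by case: eqP => [E|_]; [have := lt x0; rewrite E ltnn | rewrite mulr0 addr0].
have [x [b' [lt ->]]] := H a aU; rewrite (negbTE ab) add0r.
have [->|x0] := eqVneq x 0; first by rewrite mul0r.
by case: eqP => [E|_]; [have := lt x0; rewrite E ltnNge wab | rewrite mulr0].
Qed.

End CrossIdentity.

(** * The pencil F + s H + t G *)

Section PolyFun2.
Variable K : closedFieldType.
Implicit Types (f g : K -> K -> K) (p q : {poly {poly K}}).

(** The inner variable is s and the outer one t, so that fixing s leaves a polynomial in t. *)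
Definition ev2 p s t : K := (map_poly (horner_eval s) p).[t].
Definition polyfun2 f : Prop := exists p, forall s t, f s t = ev2 p s t.

Lemma ev2_detq (T : eqType) (U : seq T) (M : T -> T -> {poly {poly K}}) s t :
  ev2 (detq U M) s t = detq U (fun a b => ev2 (M a b) s t).
Proof.
rewrite /ev2 (rmorph_detq (map_poly (horner_eval s))).
exact: (rmorph_detq (horner_eval t)).
Qed.

Lemma polyfun2_const c : polyfun2 (fun _ _ => c).
Proof. by exists c%:P%:P => s t; rewrite /ev2 map_polyC /= /horner_eval !hornerC. Qed.

Lemma polyfun2_s : polyfun2 (fun s _ => s).
Proof. by exists 'X%:P => s t; rewrite /ev2 map_polyC /= /horner_eval hornerC hornerX. Qed.

Lemma polyfun2_t : polyfun2 (fun _ t => t).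
Proof. by exists 'X => s t; rewrite /ev2 map_polyX hornerX. Qed.

Lemma polyfun2D f g : polyfun2 f -> polyfun2 g -> polyfun2 (fun s t => f s t + g s t).
Proof.
by move=> [p Hp] [q Hq]; exists (p + q) => s t; rewrite /ev2 rmorphD hornerD Hp Hq.
Qed.

Lemma polyfun2M f g : polyfun2 f -> polyfun2 g -> polyfun2 (fun s t => f s t * g s t).
Proof.
by move=> [p Hp] [q Hq]; exists (p * q) => s t; rewrite /ev2 rmorphM hornerM Hp Hq.
Qed.

Lemma eq_polyfun2 f g : f =2 g -> polyfun2 f -> polyfun2 g.
Proof. by move=> E [p Hp]; exists p => s t; rewrite -E. Qed.

Lemma polyfun2_prod (I : eqType) (l : seq I) (f : I -> K -> K -> K) :
  {in l, forall i, polyfun2 (f i)} -> polyfun2 (fun s t => \prod_(i <- l) f i s t).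
Proof.
elim: l => [|i l IH] H.
  by apply: eq_polyfun2 (polyfun2_const 1) => s t; rewrite big_nil.
apply: (eq_polyfun2 (f := fun s t => f i s t * \prod_(j <- l) f j s t)) => [s t|].
  by rewrite big_cons.
apply: polyfun2M; first by apply: H; rewrite mem_head.
by apply: IH => j jl; apply: H; rewrite inE jl orbT.
Qed.

Lemma polyfun2_detq (T : eqType) (U : seq T) (M : K -> K -> T -> T -> K) :
  {in U &, forall a b, polyfun2 (fun s t => M s t a b)} ->
  polyfun2 (fun s t => detq U (M s t)).
Proof.
move=> H; have [P HP] : exists P : T -> T -> {poly {poly K}},
    {in U, forall a, {in U, forall b, forall s t, M s t a b = ev2 (P a b) s t}}.
  apply: (@seq_choice _ _ (fun _ => 0) U (fun a Q => {in U, forall b, forall s t, M s t a b = ev2 (Q b) s t})).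
  by move=> a aU; apply: (@seq_choice _ _ 0 U (fun b Q => forall s t, M s t a b = ev2 Q s t)) => b bU; apply: H.
by exists (detq U P) => s t; rewrite ev2_detq; apply: eq_detq => a b aU bU; apply: HP.
Qed.

Lemma map_eval_neq0 p s : (lead_coef p).[s] != 0 -> map_poly (horner_eval s) p != 0.
Proof.
move=> H; apply: contraNneq H => E.
by have := coef_map (horner_eval s) p (size p).-1; rewrite E coef0 /= -lead_coefE /horner_eval => <-.
Qed.

Lemma ev2_neq0 p : p != 0 -> exists s t, ev2 p s t != 0.
Proof.
move=> p0; have /closed_nonrootP[s Hs] : lead_coef p != 0 by rewrite lead_coef_eq0.
have /closed_nonrootP[t Ht] := map_eval_neq0 Hs.
by exists s, t.
Qed.

(** Density: the product of the two polynomials vanishes at every point, and K[s][t] is a domain. *)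
Lemma polyfun2_cancel f g : polyfun2 f -> polyfun2 g -> (exists s t, f s t != 0) ->
  (forall s t, f s t != 0 -> g s t = 0) -> forall s t, g s t = 0.
Proof.
move=> [p Hp] [q Hq] [s0 [t0 f0]] H.
have p0 : p != 0 by apply: contraNneq f0 => E; rewrite Hp E /ev2 rmorph0 horner0.
suff /eqP q0 : q == 0 by move=> s t; rewrite Hq q0 /ev2 rmorph0 horner0.
apply/negP => /negP q0; have [s [t]] := ev2_neq0 (mulf_neq0 p0 q0).
rewrite /ev2 rmorphM hornerM -/(ev2 p s t) -/(ev2 q s t) -Hp -Hq mulf_eq0 negb_or.
by move=> /andP[/H ->]; rewrite eqxx.
Qed.

(* Elimination of t by the resultant. *)
Lemma no_common_root (S : K -> Prop) f g :
  (forall r : {poly K}, r != 0 -> exists2 s, S s & r.[s] != 0) ->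
  polyfun2 f -> polyfun2 g -> (exists s t, f s t != 0) -> (exists s t, g s t != 0) ->
  (forall s, S s -> forall t, f s t != 0 \/ g s t != 0) ->
  exists2 r : {poly K}, r != 0 & forall s, r.[s] != 0 -> forall t, f s t != 0 \/ g s t != 0.
Proof.
move=> HS [p Hp] [q Hq] [s1 [t1 f0]] [s2 [t2 g0]] H.
have p0 : p != 0 by apply: contraNneq f0 => E; rewrite Hp E /ev2 rmorph0 horner0.
have q0 : q != 0 by apply: contraNneq g0 => E; rewrite Hq E /ev2 rmorph0 horner0.
have const (w : {poly {poly K}}) : w != 0 -> (size w <= 1)%N ->
    exists2 c : {poly K}, c != 0 & forall s t, ev2 w s t = c.[s].
  move=> w0 /size1_polyC E; exists w`_0; first by apply: contraNneq w0 => e; rewrite E e.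
  by move=> s t; rewrite [in LHS]E /ev2 map_polyC /= /horner_eval !hornerC.
have [sp|sp] := leqP (size p) 1.
  have [c c0 Hc] := const p p0 sp; exists c => // s cs t; left; by rewrite Hp Hc.
have [sq|sq] := leqP (size q) 1.
  have [c c0 Hc] := const q q0 sq; exists c => // s cs t; right; by rewrite Hq Hc.
(* At such a point of S the degrees in t are kept, so the resultant specialises to that of two
   polynomials without common root; it is therefore not the zero polynomial. *)
have [s0 S0] : exists2 s, S s & (lead_coef p * lead_coef q).[s] != 0.
  by apply: HS; rewrite mulf_neq0 ?lead_coef_eq0.
rewrite hornerM mulf_eq0 negb_or => /andP[lp lq].
have [[u v] /= _ R] := resultant_in_ideal sp sq.
exists (resultant p q).
  suff : horner_eval s0 (resultant p q) != 0.
    by apply: contraNneq => ->; rewrite /horner_eval horner0.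
  have lp' : horner_eval s0 (lead_coef p) != 0 := lp.
  have lq' : horner_eval s0 (lead_coef q) != 0 := lq.
  rewrite (map_resultant lp' lq') resultant_eq0 -leqNgt.
  set w := gcdp _ _; have w0 : w != 0 by rewrite gcdp_eq0 negb_and map_eval_neq0.
  rewrite leqNgt; apply/negP => sw.
  have /closed_rootP[t] : size w != 1%N by rewrite gtn_eqF.
  rewrite root_gcd => /andP[/rootP rp /rootP rq].
  by have [] := H s0 S0 t; rewrite ?Hp ?Hq /ev2 ?rp ?rq eqxx.
move=> s Rs t; apply/orP; rewrite -negb_and; apply: contraNN Rs => /andP[/eqP fst /eqP gst].
have := congr1 (fun w => ev2 w s t) R.
rewrite /ev2 rmorphD !rmorphM hornerD !hornerM -/(ev2 p s t) -/(ev2 q s t) -Hp -Hq fst gst.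
by rewrite !mulr0 addr0 map_polyC /= hornerC /horner_eval => ->.
Qed.

End PolyFun2.

Section Pencil.
Variables (K : closedFieldType) (N d : nat).
Hypothesis d_gt0 : (0 < d)%N.
Local Notation V := N.+1.
Implicit Types (F : 'I_V -> {mpoly K[V]}) (k e : nat).
Local Notation u_ k := (U_(inord k) *+ d)%MM.

Definition cyc : 'S_V := perm (@ord_pred_inj V).

Definition fermat : 'I_V -> {mpoly K[V]} := fun j => 'X_[U_(j) *+ d].
(** Permuting by [cyc] turns this system into [fermat], so in the permuted pencil it is s that
    multiplies the x_j^d. *)
Definition cfermat : 'I_V -> {mpoly K[V]} := symf cyc^-1%g fermat.

Definition pencil F (s t : K) : 'I_V -> {mpoly K[V]} :=
  fun j => F j + s *: cfermat j + t *: fermat j.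

Lemma fermat_hform : hform d fermat.
Proof. by move=> j; rewrite dhomogX /= mdegMn mdeg1 mul1n. Qed.

Lemma cfermat_hform : hform d cfermat.
Proof. exact: symf_hform fermat_hform. Qed.

Lemma pencil_hform F s t : hform d F -> hform d (pencil F s t).
Proof.
move=> HF j; apply: rpredD; first apply: rpredD => //.
  by apply: rpredZ; apply: cfermat_hform.
by apply: rpredZ; apply: fermat_hform.
Qed.

Lemma sym_fermat j : symf cyc fermat j = 'X_[U_(cyc j) *+ d].
Proof.
rewrite /symf /fermat msymX; congr 'X_[_]; apply/mnmP => i.
rewrite mnmE !mulmnE !mnm1E; congr (nat_of_bool _ * _)%N.
by rewrite -(inj_eq (@perm_inj _ cyc) j) permKV.
Qed.

Lemma sym_pencil F s t j :
  symf cyc (pencil F s t) j = symf cyc F j + s *: fermat j + t *: symf cyc fermat j.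
Proof. by rewrite /symf !msymD !msymZ /cfermat /symf (msymVK cyc). Qed.

Lemma fermat_coef (O E : K -> Prop) j m : ideal_pair O E -> O (fermat j)@_m.
Proof. by move=> ip; rewrite mcoeffX; case: eqP => _; [exact: (ip_O1 ip) | exact: (ip_O0 ip)]. Qed.

Lemma cfermat_coef (O E : K -> Prop) j m : ideal_pair O E -> O (cfermat j)@_m.
Proof. by move=> ip; rewrite mcoeff_sym; apply: fermat_coef ip. Qed.

Lemma minor_fermat k U : (k <= V)%N -> all_hit d k U -> uniq U -> minor d U fermat k = 1.
Proof.
move=> kV hU uU; apply: (@minor_trig _ _ _ d_gt0 _ _ _ (fun _ => ord0) (fun _ => 0) (fun _ => 0%N)) => // j _.
  by rewrite scale0r addr0.
by rewrite eqxx.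
Qed.

(** [cyc] sends j to j - 1 and 0 to N. Since the form of index N is left out, the chain of indices
    does not close, and [w], which orders them as N, 0, 1, ..., N - 1, decreases along it. *)
Lemma minor_cyc k U c : (k <= N)%N -> all_hit d k U -> uniq U ->
  minor d U (fun j => fermat j + c *: symf cyc fermat j) k = 1.
Proof.
move=> kN hU uU; pose w (i : 'I_V) := (if i == N :> nat then 0 else i.+1)%N.
apply: (@minor_trig _ _ _ d_gt0 _ _ _ (fun j => cyc (inord j)) (fun _ => c) w) => // [|j jk|j jk _].
- exact: ltnW.
- by rewrite sym_fermat.
have jN : (j < N)%N by exact: leq_trans kN.
have ej : nat_of_ord (inord j : 'I_V) = j by rewrite inordK // ltnW.
rewrite permE /w /= ej (ltn_eqF jN) {ej}.
case: j jk jN => [|j] jk jN; first by rewrite add0n modn_small // eqxx.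
have -> : ((j.+1 + V).-1 %% V)%N = j by rewrite addSn /= modnDr modn_small // ltnW // ltnW.
by case: ifP.
Qed.

Lemma polyfun2_minor F k U (h : ('I_V -> {mpoly K[V]}) -> 'I_V -> {mpoly K[V]}) F0 F1 F2 :
  (k <= V)%N -> all_hit d k U ->
  (forall s t j, h (pencil F s t) j = F0 j + s *: F1 j + t *: F2 j) ->
  polyfun2 (fun s t => minor d U (h (pencil F s t)) k).
Proof.
move=> kV /allP hU Hh; apply: polyfun2_detq => a b aU _.
have [E|[j [m [_ E]]]] := row_coef K b kV (hU a aU).
  by apply: eq_polyfun2 (polyfun2_const 0) => s t; rewrite E.
apply: (eq_polyfun2 (f := fun s t => (F0 (inord j))@_m + s * (F1 (inord j))@_m + t * (F2 (inord j))@_m)).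
  by move=> s t; rewrite E Hh !mcoeffD !mcoeffZ.
apply: polyfun2D; [apply: polyfun2D; first exact: polyfun2_const |];
  apply: polyfun2M; try exact: polyfun2_const; [exact: polyfun2_s | exact: polyfun2_t].
Qed.

Lemma polyfun2_pencil F k U : (k <= V)%N -> all_hit d k U ->
  polyfun2 (fun s t => minor d U (pencil F s t) k).
Proof. by move=> kV hU; apply: (polyfun2_minor (h := id)). Qed.

Lemma polyfun2_sym_pencil F k U : (k <= V)%N -> all_hit d k U ->
  polyfun2 (fun s t => minor d U (symf cyc (pencil F s t)) k).
Proof. by move=> kV hU; apply: (polyfun2_minor (h := symf cyc)) => // s t j; apply: sym_pencil. Qed.

Section Valuation.
Variables (O M : K -> Prop) (ip : ideal_pair O M).
Hypothesis M1 : ~ M 1.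
Hypothesis MO : forall x, M x -> O x.
Definition large (s : K) := s != 0 /\ M s^-1.

Variable F : 'I_V -> {mpoly K[V]}.
Hypothesis HF : hform d F.
Hypothesis OF : forall j m, O (F j)@_m.

Lemma unit_neq0 x : M (x - 1) -> x != 0.
Proof. by move=> H; apply: contraPneq H => ->; rewrite sub0r => /(ip_EN ip); rewrite opprK. Qed.

(** Divided by s, the permuted pencil is congruent modulo [M] to the triangular system of
    [minor_cyc] with c = t / s. *)
Lemma sym_pencil_neq0 k U s t : (k <= N)%N -> all_hit d k U -> uniq U -> large s -> O (t / s) ->
  minor d U (symf cyc (pencil F s t)) k != 0.
Proof.
move=> kN hU uU [s0 Ms] Ots.
have kV := leqW kN.
pose F1 j := s^-1 *: symf cyc F j + fermat j + (t / s) *: symf cyc fermat j.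
rewrite (@eq_minor _ _ _ _ (fun j => s *: F1 j)) //; last first.
  move=> j _; rewrite sym_pencil /F1 !scalerDr !scalerA mulfV // scale1r.
  by rewrite -addrA -[in RHS]addrA; congr (_ + (_ + _)); rewrite mulrCA mulfV // mulr1.
rewrite minorZ // mulf_neq0 ?expf_neq0 //.
apply: unit_neq0; rewrite -(minor_cyc (t / s) kN hU uU).
have Oc j m : O (symf cyc fermat j)@_m by rewrite mcoeff_sym; apply: fermat_coef ip.
have Os j m : O (symf cyc F j)@_m by rewrite mcoeff_sym.
apply: (minor_cong ip) => // j m jk; rewrite /F1 !mcoeffD !mcoeffZ.
- apply: (ip_OD ip); first apply: (ip_OD ip); try apply: (ip_OM ip) => //.
    exact: MO.
  exact: fermat_coef ip.
- by apply: (ip_OD ip); [exact: fermat_coef ip | apply: (ip_OM ip)].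
- rewrite [X in M X](_ : _ = (symf cyc F (inord j))@_m * s^-1); last by ring.
  by apply: (ip_EM ip).
Qed.

(** Here |t| > |s| > 1: divided by t, the pencil is congruent to [fermat]. *)
Lemma pencil_neq0 k U s t : (k <= V)%N -> all_hit d k U -> uniq U -> large s -> t != 0 -> M (s / t) ->
  minor d U (pencil F s t) k != 0.
Proof.
move=> kV hU uU [s0 Ms] t0 Mst.
have Mt : M t^-1.
  have -> : t^-1 = s^-1 * (s / t) by rewrite mulrA mulVf // mul1r.
  by apply: (ip_EM ip) => //; apply: MO.
pose F1 j := t^-1 *: F j + (s / t) *: cfermat j + fermat j.
rewrite (@eq_minor _ _ _ _ (fun j => t *: F1 j)) //; last first.
  move=> j _; rewrite /pencil /F1 !scalerDr !scalerA mulfV // scale1r.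
  by congr (_ + _ + _); rewrite mulrCA mulfV // mulr1.
rewrite minorZ // mulf_neq0 ?expf_neq0 //.
apply: unit_neq0; rewrite -(minor_fermat kV hU uU).
apply: (minor_cong ip) => // j m jk; rewrite /F1 ?mcoeffD ?mcoeffZ.
- apply: (ip_OD ip); first apply: (ip_OD ip); try apply: (ip_OM ip) => //.
  + exact: MO.
  + exact: MO.
  + exact: cfermat_coef ip.
  exact: fermat_coef ip.
- exact: fermat_coef ip.
- rewrite addrK; apply: (ip_ED ip); rewrite mulrC; apply: (ip_EM ip) => //.
  exact: cfermat_coef ip.
Qed.

(* Every minor of the permuted pencil occurring in the genericity condition up
   to degree E; it is a unit for |t| <= |s|, whereas the Macaulay determinants
   of the pencil itself are units for |t| > |s| > 1. *)
Definition goodness E s t : K :=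
  \prod_(ke <- [seq (k, e) | k <- iota 0 V, e <- iota 0 E.+1])
    minor d (hits N d ke.1 ke.2) (symf cyc (pencil F s t)) ke.1.

Lemma goodnessP E s t : reflect
  (forall k e, (k <= N)%N -> (e <= E)%N -> minor d (hits N d k e) (symf cyc (pencil F s t)) k != 0)
  (goodness E s t != 0).
Proof.
rewrite /goodness prodf_seq_neq0; apply: (iffP allP) => [H k e kN eE|H ke].
  by apply: (H (k, e)); apply: allpairs_f; rewrite mem_iota.
by move=> /allpairsP[[k e] [ki ei ->]]; apply: H; [move: ki | move: ei]; rewrite mem_iota add0n ?ltnS // => /andP[].
Qed.

End Valuation.
End Pencil.

(** * Macaulay's quotient *)

Section DetX.
Variables (K : closedFieldType) (N d : nat).
Hypothesis d_gt0 : (0 < d)%N.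
Local Notation V := N.+1.
Implicit Types (F : 'I_V -> {mpoly K[V]}) (k e : nat) (U : seq 'X_{1..V}).
Local Notation u_ k := (U_(inord k) *+ d)%MM.
Local Notation fermat_ := (@fermat K N d).

(** On pivoted rows the Macaulay matrix of [fermat] is the identity, so this is a characteristic
    polynomial: monic, and of a degree independent of F, which makes the division stable under
    perturbation. *)
Definition detX U F : {poly K} :=
  detq U (fun a b => ((row d F V a)@_b)%:P + 'X * ((row d (fermat_) V a)@_b)%:P).

Lemma row_fermat a : hit d V a -> row d (fermat_) V a = 'X_[a].
Proof.
move=> h; have [j [_ dj ->]] := rowP (fermat_) (leqnn V) h.
by rewrite /fermat -mpolyXD mnm_subK.
Qed.

Lemma detX_eval U F t : all_hit d V U ->
  (detX U F).[t] = minor d U (fun j => F j + t *: fermat_ j) V.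
Proof.
move=> /allP hU; rewrite -[LHS]/(horner_eval t (detX U F)) rmorph_detq.
apply: eq_detq => a b aU _.
have [E|[j [m [_ E]]]] := row_coef K b (leqnn V) (hU a aU);
  rewrite !E /= /horner_eval ?polyC0 ?mulr0 ?addr0 ?horner0 //.
by rewrite hornerD hornerM !hornerC hornerX mcoeffD mcoeffZ.
Qed.

Lemma detX_charpoly U F : all_hit d V U -> uniq U ->
  detX U F = char_poly (\matrix_(i < size U, j < size U)
    - (row d F V (tnth (in_tuple U) i))@_(tnth (in_tuple U) j)).
Proof.
move=> /allP hU uU; rewrite /detX /detq /char_poly /char_poly_mx; congr (\det _).
apply/matrixP => i j; rewrite !mxE row_fermat ?hU ?mem_tnth // mcoeffX.
have x0 := tnth (in_tuple U) i; rewrite !(tnth_nth x0) nth_uniq //= polyCN opprK addrC.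
by congr (_ + _); rewrite -val_eqE /=; case: eqP => _; rewrite ?mulr1 ?mulr0.
Qed.

Lemma detX_monic U F : all_hit d V U -> uniq U -> detX U F \is monic.
Proof. by move=> hU uU; rewrite detX_charpoly // char_poly_monic. Qed.

Lemma size_detX U F : all_hit d V U -> uniq U -> size (detX U F) = (size U).+1.
Proof. by move=> hU uU; rewrite detX_charpoly // size_char_poly. Qed.

Lemma detX_O (O E : K -> Prop) U F : ideal_pair O E -> all_hit d V U ->
  (forall j m, O (F j)@_m) -> coefs_in O (detX U F).
Proof.
move=> ip /allP hU OF; have ipP := ip_poly (ip_self ip).
apply: (ip_O_detq ipP) => a b aU _; apply: (ip_OD ipP).
  apply: coefs_in_polyC; first exact: ip_O0 ip.
  by have [->|[j [m [_ ->]]]] := row_coef K b (leqnn V) (hU a aU); [exact: ip_O0 ip|].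
apply: coefs_in_mulX; first exact: ip_O0 ip.
apply: coefs_in_polyC; first exact: ip_O0 ip.
rewrite row_fermat ?hU // mcoeffX; case: eqP => _; [exact: ip_O1 ip | exact: ip_O0 ip].
Qed.

Lemma detX_cong (O E : K -> Prop) U F F' : ideal_pair O E -> all_hit d V U ->
  (forall j m, O (F j)@_m) -> (forall j m, O (F' j)@_m) ->
  (forall j m, E ((F j)@_m - (F' j)@_m)) ->
  coefs_in E (detX U F - detX U F').
Proof.
move=> ip /allP hU OF OF' EF; have ipP := ip_poly ip.
have entry F0 a b : (forall j m, O (F0 j)@_m) -> a \in U ->
    coefs_in O (((row d F0 V a)@_b)%:P + 'X * ((row d (fermat_) V a)@_b)%:P).
  move=> OF0 aU; have O0 := ip_O0 ip; apply: (ip_OD ipP).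
    apply: coefs_in_polyC => //.
    by have [->|[j [m [_ ->]]]] := row_coef K b (leqnn V) (hU a aU).
  apply: coefs_in_mulX => //; apply: coefs_in_polyC => //.
  by rewrite row_fermat ?hU // mcoeffX; case: eqP => _ //; exact: ip_O1 ip.
apply: (ip_detq_cong ipP) => a b aU _; try exact: entry.
rewrite opprD addrACA subrr addr0 -polyCB; apply: coefs_in_polyC; first exact: ip_E0 ip.
have [E1|[j [m [_ E1]]]] := row_coef K b (leqnn V) (hU a aU); rewrite !E1 //.
by rewrite subrr; apply: ip_E0 ip.
Qed.

Lemma nonreds_uniq e : uniq (nonreds N d V e).
Proof. by rewrite filter_uniq ?ms_uniq. Qed.

Definition res e F : K := (detX (hits N d V e) F %/ detX (nonreds N d V e) F).[0].

Lemma row_piv F k (a : 'X_{1..V}) (i : 'I_V) : (i < k)%N -> (k <= V)%N -> (d <= a i)%N ->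
  (forall j : 'I_V, (j < i)%N -> (a j < d)%N) -> row d F k a = 'X_[a - U_(i) *+ d] * F i.
Proof.
move=> + + di Hj; elim: k => // k IH ik kV.
have [ik'|ki] := ltnP i k.
  rewrite rowS_hit; first by apply: IH => //; apply: ltnW.
  apply: (hit_le (j := i.+1)) => //; rewrite hitS.
  by rewrite (_ : inord i = i) ?di ?orbT //; apply: val_inj; rewrite /= inordK.
have {ki ik} -> : k = i by apply/eqP; rewrite eqn_leq ki -ltnS ik.
have nh : ~~ hit d i a.
  rewrite /hit -leqNgt leqn0 /cnt sum_nat_eq0; apply/forallP => j.
  rewrite eqb0 -ltnNge; apply: Hj; rewrite inordK //.
  by apply: ltn_trans (ltn_ord i); apply: ltn_ord.
have ei : inord i = i by apply: val_inj; rewrite /= inordK.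
by rewrite /= (negbTE nh) ei di.
Qed.

Local Notation D := (macD N d).

Lemma mexp_mdeg (a : macMono N d) : mdeg (mexp a) = D.
Proof. by apply/eqP; rewrite /mexp; case: a. Qed.

Lemma macRow_row F (a : macMono N d) : macRow F a = row d F V (mexp a).
Proof.
have h : hit d V (mexp a) by apply: hit_crit => //; rewrite mexp_mdeg.
have [i0 di0] : exists i0 : 'I_V, (d <= mexp a i0)%N.
  by have [j [_ dj _]] := rowP (fermat_) (leqnn V) h; exists (inord j).
rewrite /macRow /macPiv; case: pickP => [i /andP[di /forallP Hi]|none]; rewrite [odflt _ _]/=.
  by rewrite (@row_piv F V _ i) // => j; apply/implyP.
case: (@arg_minnP _ i0 (fun i => d <= mexp a i)%N val di0) => i di Hi.
have := none i; rewrite di /= => /negbT /forallPn[j]; rewrite negb_imply -leqNgt => /andP[ji dj].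
by have := Hi j dj; rewrite leqNgt ji.
Qed.

Lemma cnt_card (a : 'X_{1..V}) : cnt d V a = #|[pred i : 'I_V | (d <= a i)%N]|.
Proof.
rewrite -sum1_card /cnt [RHS]big_mkcond /=; apply: eq_bigr => i _.
by rewrite inord_val inE; case: (d <= a i)%N.
Qed.

Lemma macMt_detX F (a b : macMono N d) :
  macMt F a b = ((row d F V (mexp a))@_(mexp b))%:P + 'X * ((row d (fermat_) V (mexp a))@_(mexp b))%:P.
Proof.
rewrite /macMt /macM !macRow_row; congr (_ + 'X * _%:P).
congr (_@_(_)); have h : hit d V (mexp a) by apply: hit_crit => //; rewrite mexp_mdeg.
have [j [_ dj E]] := rowP (@macG K N d) (leqnn V) h.
by rewrite E row_fermat // /macG mpolyXn -mpolyXD mnm_subK.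
Qed.

Lemma mexp_inj : injective (@mexp N d).
Proof. by move=> a b /val_inj /val_inj. Qed.

Lemma mexp_surj (a : 'X_{1..V}) : mdeg a = D -> exists b : macMono N d, mexp b = a.
Proof.
move=> Ha; have lt : (mdeg a < D.+1)%N by rewrite Ha.
have H : mdeg (BMultinom lt) == D by rewrite /= Ha.
by exists (exist _ (BMultinom lt) H).
Qed.

Lemma macaulay_resE F : macaulay_res d F = res D F.
Proof.
rewrite /macaulay_res /res; congr (_ %/ _).[0].
  rewrite detT_detq; transitivity (detq (map (@mexp N d) (enum (macMono N d)))
    (fun a b => ((row d F V a)@_b)%:P + 'X * ((row d (fermat_) V a)@_b)%:P)).
    by rewrite [RHS]detq_map; apply: eq_detq => a b _ _; apply: macMt_detX.
  apply: perm_detq; apply: uniq_perm; last move=> a.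
  - by rewrite map_inj_uniq ?enum_uniq //; exact: mexp_inj.
  - exact: hits_uniq.
  rewrite hits_crit // mem_ms; apply/mapP/eqP => [[b _ ->]|/mexp_surj[b <-]].
    exact: mexp_mdeg.
  by exists b; rewrite ?mem_enum.
rewrite detT_detq; transitivity (detq (map (fun a => @mexp N d (val a)) (enum {: {x : macMono N d | ~~ macReduced x}}))
    (fun a b => ((row d F V a)@_b)%:P + 'X * ((row d (fermat_) V a)@_b)%:P)).
  by rewrite [RHS]detq_map; apply: eq_detq => a b _ _; apply: macMt_detX.
have red (b : macMono N d) : nonred d V (mexp b) = ~~ macReduced b.
  have := @hit_crit _ _ d_gt0 (mexp b); rewrite mexp_mdeg => /(_ (ltnSn _)).
  by rewrite /nonred /hit /macReduced cnt_card; lia.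
apply: perm_detq; apply: uniq_perm; last move=> a.
- by rewrite map_inj_uniq ?enum_uniq // => a b /mexp_inj /val_inj.
- exact: nonreds_uniq.
rewrite mem_filter_ms; apply/mapP/andP => [[b _ ->]|[na /eqP /mexp_surj[b Eb]]].
  by rewrite mexp_mdeg red (valP b).
have Hb : ~~ macReduced b by rewrite -red Eb.
by exists (exist _ b Hb); rewrite ?mem_enum.
Qed.

End DetX.

(** The interface between the absolute value and the algebra. The last two fields give large and
    arbitrarily small parameters that avoid the roots of a prescribed polynomial; M (s / x) stands
    for |s| < |x|. *)
Record valuation_pair (K : closedFieldType) (O M : K -> Prop) : Prop := ValuationPair {
  vp_ip : ideal_pair O M;
  vp_M1 : ~ M 1;
  vp_MO : forall x, M x -> O x;
  vp_val : forall x y : K, x != 0 -> O (y / x) \/ (y != 0 /\ M (x / y));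
  vp_large : forall r : {poly K}, r != 0 -> exists2 s, large M s & r.[s] != 0;
  vp_small : forall (r : {poly K}) x, r != 0 -> x != 0 ->
    exists s, [/\ s != 0, M s, M (s / x) & r.[s] != 0] }.

Lemma polyfun2_mul_neq0 (K : closedFieldType) (f g : K -> K -> K) :
  polyfun2 f -> polyfun2 g -> (exists s t, f s t != 0) -> (exists s t, g s t != 0) ->
  exists s t, f s t * g s t != 0.
Proof.
move=> [p Hp] [q Hq] [s1 [t1 f0]] [s2 [t2 g0]].
have p0 : p != 0 by apply: contraNneq f0 => E; rewrite Hp E /ev2 rmorph0 horner0.
have q0 : q != 0 by apply: contraNneq g0 => E; rewrite Hq E /ev2 rmorph0 horner0.
have [s [t H]] := ev2_neq0 (mulf_neq0 p0 q0); exists s, t.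
by move: H; rewrite /ev2 rmorphM hornerM -/(ev2 p s t) -/(ev2 q s t) -Hp -Hq.
Qed.

Lemma polyfun2_slice (K : closedFieldType) (f : K -> K -> K) s : polyfun2 f ->
  exists p : {poly K}, forall t, f s t = p.[t].
Proof. by move=> [p Hp]; exists (map_poly (horner_eval s) p) => t; rewrite Hp. Qed.

Lemma poly_eq_eval (K : closedFieldType) (p q : {poly K}) : (forall t, p.[t] = q.[t]) -> p = q.
Proof.
move=> H; apply/eqP; rewrite -subr_eq0; apply/negP => /negP /closed_nonrootP[t].
by rewrite rootE hornerD hornerN H subrr eqxx.
Qed.

Lemma coprimep_roots (K : closedFieldType) (p q : {poly K}) : p != 0 ->
  (forall t, root p t -> ~~ root q t) -> coprimep p q.
Proof.
move=> p0 H; rewrite /coprimep; apply/negP => /negP /closed_rootP[t].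
by rewrite root_gcd => /andP[/H /negP].
Qed.

(** * Divisibility of det M by det M' *)

Section Divisibility.
Variables (K : closedFieldType) (N d : nat) (O M : K -> Prop).
Hypothesis d_gt0 : (0 < d)%N.
Hypothesis vp : valuation_pair O M.
Local Notation V := N.+1.
Let ip := vp_ip vp.
Implicit Types (F : 'I_V -> {mpoly K[V]}) (k e : nat).

Definition integral F := forall j m, O (F j)@_m.

Lemma large_neq0_exists : exists s, large M s.
Proof. by have [s H _] := vp_large vp (oner_neq0 _); exists s. Qed.

Lemma polyfun2_goodness F E : polyfun2 (goodness d F E).
Proof.
apply: polyfun2_prod => ke /allpairsP[[k e] [ki _ ->]].
apply: polyfun2_sym_pencil; last exact: all_hit_hits.
by apply: ltnW; move: ki; rewrite mem_iota add0n.
Qed.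

Lemma goodness_large F E s t : hform d F -> integral F -> large M s -> O (t / s) ->
  goodness d F E s t != 0.
Proof.
move=> HF OF Ls Ots; apply/goodnessP => // k e kN eE.
apply: (sym_pencil_neq0 d_gt0 ip (vp_M1 vp) (vp_MO vp)) => //; first exact: all_hit_hits.
exact: hits_uniq.
Qed.

(** The product serves two purposes: divisibility examines the roots of det M', nonvanishing of the
    resultant those of det M. *)
Definition macaulay_pair e F : K := minor d (hits N d V e) F V * minor d (nonreds N d V e) F V.

Lemma polyfun2_macaulay_pair F e : polyfun2 (fun s t => macaulay_pair e (pencil d F s t)).
Proof.
by apply: polyfun2M; apply: polyfun2_pencil => //; [exact: all_hit_hits | exact: all_hit_nonreds].
Qed.

Lemma macaulay_pair_large F e s t : hform d F -> integral F -> large M s -> t != 0 -> M (s / t) ->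
  macaulay_pair e (pencil d F s t) != 0.
Proof.
move=> HF OF Ls t0 Mst; apply: mulf_neq0;
  apply: (pencil_neq0 d_gt0 ip (vp_M1 vp) (vp_MO vp)) => //.
- exact: all_hit_hits.
- exact: hits_uniq.
- exact: all_hit_nonreds.
- exact: nonreds_uniq.
Qed.

Lemma large_ratio s : large M s -> s ^+ 2 != 0 /\ M (s / s ^+ 2).
Proof.
move=> [s0 Ms]; rewrite expf_neq0 //; split => //.
by rewrite expr2 invfM mulrA mulfV // mul1r.
Qed.

(** For large s the ranges |t| <= |s| and |t| > |s| cover every t; [no_common_root] carries the
    alternative over to all s outside a finite set. *)
Lemma good_parameters F e E : hform d F -> integral F ->
  exists2 r : {poly K}, r != 0 & forall s, r.[s] != 0 -> forall t,
    goodness d F E s t != 0 \/ macaulay_pair e (pencil d F s t) != 0.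
Proof.
move=> HF OF; apply: (no_common_root (vp_large vp)).
- exact: polyfun2_goodness.
- exact: polyfun2_macaulay_pair.
- have [s Ls] := large_neq0_exists; exists s, 0; apply: goodness_large => //.
  by rewrite mul0r; exact: ip_O0 ip.
- have [s Ls] := large_neq0_exists; have [h1 h2] := large_ratio Ls.
  by exists s, (s ^+ 2); apply: macaulay_pair_large.
move=> s Ls t; have [s0 _] := Ls.
have [Ot|[t0 Mst]] := vp_val vp t s0; first by left; apply: goodness_large.
by right; apply: macaulay_pair_large.
Qed.

(** The cross identity holds where the minors for fewer forms do not vanish. That locus is dense:
    for large s one half of the conditions holds at (s, 0) and the other at (s, s^2). *)
Lemma pencil_identity F e : (V * d.-1 < e)%N -> hform d F -> integral F ->
  exists c c' : K, [/\ c != 0, c' != 0 & forall s t,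
   c * (minor d (hits N d V e) (pencil d F s t) V * minor d (nonreds N d V e) (symf (cyc N) (pencil d F s t)) V) =
   c' * (minor d (hits N d V e) (symf (cyc N) (pencil d F s t)) V * minor d (nonreds N d V e) (pencil d F s t) V)].
Proof.
move=> He HF OF; have [c [c' [c0 c'0 H]]] := cross_identity K d_gt0 (cyc N) He.
exists c, c'; split => // s t; apply/eqP; rewrite -subr_eq0 -mulrN; apply/eqP.
have hh := all_hit_hits N d V e; have hn := all_hit_nonreds N d V e.
pose good0 s t := \prod_(ke <- [seq (k, e') | k <- iota 0 V, e' <- iota 0 e.+1])
    minor d (hits N d ke.1 ke.2) (pencil d F s t) ke.1.
apply: (polyfun2_cancel (f := fun s t => goodness d F e s t * good0 s t)
  (g := fun s t => _ * (minor d _ (pencil d F s t) V * minor d _ (symf _ (pencil d F s t)) V) +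
     c' * - (minor d _ (symf _ (pencil d F s t)) V * minor d _ (pencil d F s t) V))).
- apply: polyfun2M; first exact: polyfun2_goodness.
  apply: polyfun2_prod => ke /allpairsP[[k e'] [ki _ ->]].
  apply: polyfun2_pencil; last exact: all_hit_hits.
  by apply: ltnW; move: ki; rewrite mem_iota add0n.
- apply: polyfun2D; apply: polyfun2M; try exact: polyfun2_const.
    by apply: polyfun2M; [exact: polyfun2_pencil | exact: polyfun2_sym_pencil].
  apply: (eq_polyfun2 (f := fun s t => -1 * (minor d (hits N d V e) (symf (cyc N) (pencil d F s t)) V * minor d (nonreds N d V e) (pencil d F s t) V))).
    by move=> s' t'; rewrite mulN1r.
  apply: polyfun2M; first exact: polyfun2_const.
  by apply: polyfun2M; [exact: polyfun2_sym_pencil | exact: polyfun2_pencil].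
- have [s' Ls] := large_neq0_exists.
  apply: polyfun2_mul_neq0; first exact: polyfun2_goodness.
  + apply: polyfun2_prod => ke /allpairsP[[k e'] [ki _ ->]].
    apply: polyfun2_pencil; last exact: all_hit_hits.
    by apply: ltnW; move: ki; rewrite mem_iota add0n.
  + by exists s', 0; apply: goodness_large => //; rewrite mul0r; exact: ip_O0 ip.
  have [h1 h2] := large_ratio Ls; exists s', (s' ^+ 2).
  rewrite /good0 prodf_seq_neq0; apply/allP => ke /allpairsP[[k e'] [ki _ ->]].
  apply: (pencil_neq0 d_gt0 ip (vp_M1 vp) (vp_MO vp)) => //; last exact: hits_uniq.
    by apply: ltnW; move: ki; rewrite mem_iota add0n.
  exact: all_hit_hits.
move=> s' t'; rewrite mulf_eq0 negb_or => /andP[/goodnessP g1 g2].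
rewrite H ?mulrN ?subrr //; first exact: pencil_hform.
move=> j e' jV le; split; last exact: g1.
move: g2; rewrite /good0 prodf_seq_neq0 => /allP /(_ (j, e')); apply.
by apply: allpairs_f; rewrite mem_iota add0n.
Qed.

Definition shifted F s := fun j => F j + s *: cfermat K d j.

Lemma shifted_hform F s : hform d F -> hform d (shifted F s).
Proof. by move=> HF j; apply: rpredD => //; apply: rpredZ; apply: cfermat_hform. Qed.

Lemma shifted_integral F s : integral F -> O s -> integral (shifted F s).
Proof.
move=> OF Os j m; rewrite mcoeffD mcoeffZ; apply: (ip_OD ip) => //.
by apply: (ip_OM ip) => //; apply: cfermat_coef ip.
Qed.

Lemma shifted_close F s : integral F ->
  forall j m, exists2 z, O z & (F j)@_m - (shifted F s j)@_m = s * z.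
Proof.
move=> OF j m; exists (- (cfermat K d j)@_m); first by apply: (ip_ON ip); apply: cfermat_coef ip.
by rewrite mcoeffD mcoeffZ opprD addrA subrr add0r mulrN.
Qed.

Lemma detX_shifted U F s t : all_hit d V U ->
  (detX d U (shifted F s)).[t] = minor d U (pencil d F s t) V.
Proof. by move=> hU; rewrite detX_eval. Qed.

(* Divisibility holds at good parameters s, where det M' of the pencil and of its
   permuted copy have no common root, and passes to the limit s -> 0. *)
Lemma nonreds_dvd_hits F e : (V * d.-1 < e)%N -> hform d F -> integral F ->
  detX d (nonreds N d V e) F %| detX d (hits N d V e) F.
Proof.
move=> He HF OF.
have hh := all_hit_hits N d V e; have hn := all_hit_nonreds N d V e.
have uh := hits_uniq N d V e; have un := nonreds_uniq N d e.
have [r r0 Hr] := good_parameters e e HF OF.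
have [c [c' [c0 c'0 Hid]]] := pencil_identity He HF OF.
have good s : r.[s] != 0 -> detX d (nonreds N d V e) (shifted F s) %| detX d (hits N d V e) (shifted F s).
  move=> rs.
  have [w Hw] := polyfun2_slice s (polyfun2_sym_pencil F (leqnn V) hn).
  have [a Ha] := polyfun2_slice s (polyfun2_sym_pencil F (leqnn V) hh).
  set B := detX d _ _; set A := detX d _ _.
  have E : A * w = (c^-1 * c') *: a * B.
    apply: poly_eq_eval => t; rewrite !hornerM hornerZ !detX_shifted // -Hw -Ha.
    by apply: (mulfI c0); rewrite Hid; field.
  have B0 : B != 0 by rewrite monic_neq0 // detX_monic.
  (* At a root t of B the second alternative for good s fails, so the permuted system is
     nondegenerate for fewer forms and its det M' is nonzero at t. *)
  have cop : coprimep B w.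
    apply: coprimep_roots => // t; rewrite !rootE detX_shifted // => /eqP Bt.
    rewrite -Hw; apply: nonreds_neq0 => // j e' jV le.
    have [/goodnessP|] := Hr s rs t; first by apply.
    by rewrite /macaulay_pair Bt mulr0 eqxx.
  by rewrite -(Gauss_dvdpl _ cop) E dvdp_mull.
have sz F' : size (detX d (nonreds N d V e) F') = (size (nonreds N d V e)).+1.
  exact: size_detX.
apply/modp_eq0P/eqP; apply/negP => /negP R0.
(* For |s| < |x| with s good, the remainder of the shifted system is zero and differs from this one
   by multiples of s, which is too little to produce x. *)
pose x := lead_coef (detX d (hits N d V e) F %% detX d (nonreds N d V e) F).
have x0 : x != 0 by rewrite lead_coef_eq0.
have [s [s0 Ms Msx rs]] := vp_small vp r0 x0.
have Os := vp_MO vp Ms.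
have ipE := ip_principal s ip.
have OFs := shifted_integral OF Os.
have dE := shifted_close s OF.
have [_] := ip_monic_div_cong (A := detX d (hits N d V e) F) (A' := detX d (hits N d V e) (shifted F s)) ipE
  (detX_monic F hn un) (detX_monic (shifted F s) hn un)
  (detX_O ip hn OF) (detX_O ip hn OFs) (detX_O ip hh OFs)
  (etrans (sz _) (esym (sz _))) (detX_cong ipE hh OF OFs dE) (detX_cong ipE hn OF OFs dE)
  (proj1 (ip_monic_div (ip_self ip) (detX_monic (shifted F s) hn un)
    (detX_O ip hn OFs) (detX_O ip hh OFs))).
rewrite (modp_eq0 (good s rs)) subr0 => /(_ (size (detX d (hits N d V e) F %% detX d (nonreds N d V e) F)).-1).
rewrite -lead_coefE -/x => -[z Oz Ex]; apply: (vp_M1 vp).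
have z0 : z != 0 by apply: contraNneq x0 => e0; rewrite Ex e0 mulr0.
have -> : 1 = z * (s / x) by rewrite Ex invfM; field; rewrite z0.
exact: ip_EM ip _ _ Oz Msx.
Qed.

End Divisibility.

Lemma dhomog_Ud (K : fieldType) n d (i : 'I_n) : 'X_[K, U_(i) *+ d] \is d.-homog.
Proof. by rewrite dhomogX /= mdegMn mdeg1 mul1n. Qed.

Lemma dhomogDZ (K : fieldType) n d c (p q : {mpoly K[n]}) :
  p \is d.-homog -> q \is d.-homog -> p + c *: q \is d.-homog.
Proof. by move=> Hp Hq; apply: rpredD => //; apply: rpredZ. Qed.

(** * The resultant is bounded by the values *)

Section ResBound.
Variables (K : closedFieldType) (N d e : nat) (O M : K -> Prop).
Hypothesis d_gt0 : (0 < d)%N.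
Hypothesis vp : valuation_pair O M.
Local Notation V := N.+1.
Hypothesis He : (V * d.-1 < e)%N.
Let ip := vp_ip vp.
Implicit Types (F : 'I_V -> {mpoly K[V]}) (x : 'I_V -> K).
Local Notation integral := (integral O).
Let hh := all_hit_hits N d V e.
Let hn := all_hit_nonreds N d V e.
Let uh := hits_uniq N d V e.
Let un := nonreds_uniq N d e.

Lemma res_quotient_O F : integral F ->
  coefs_in O (detX d (hits N d V e) F %/ detX d (nonreds N d V e) F).
Proof.
move=> OF; apply: (proj1 (ip_monic_div (ip_self ip) (detX_monic F hn un)
    (detX_O ip hn OF) (detX_O ip hh OF))).
Qed.

Lemma res_O F : integral F -> O (res d e F).
Proof. by move=> OF; rewrite /res horner_coef0; apply: res_quotient_O. Qed.

Lemma res_cong (E : K -> Prop) F F' : ideal_pair O E -> integral F -> integral F' ->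
  (forall j m, E ((F j)@_m - (F' j)@_m)) -> E (res d e F - res d e F').
Proof.
move=> ipE OF OF' dE; rewrite /res !horner_coef0 -coefB.
have sz F0 : size (detX d (nonreds N d V e) F0) = (size (nonreds N d V e)).+1 by exact: size_detX.
apply: (proj1 (ip_monic_div_cong (A := detX d (hits N d V e) F) (A' := detX d (hits N d V e) F')
  ipE (detX_monic F hn un) (detX_monic F' hn un) (detX_O ip hn OF) (detX_O ip hn OF')
  (detX_O ip hh OF') (etrans (sz _) (esym (sz _)))
  (detX_cong ipE hh OF OF' dE) (detX_cong ipE hn OF OF' dE) (res_quotient_O OF'))).
Qed.

Lemma eval_minor0 U F : all_hit d V U -> (detX d U F).[0] = minor d U F V.
Proof. by move=> hU; rewrite detX_eval //; apply: eq_minor => // j _; rewrite scale0r addr0. Qed.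

Lemma row_eval0 F x a : (forall j, (F j).@[x] = 0) -> hit d V a -> (row d F V a).@[x] = 0.
Proof.
by move=> Fx h; have [j [_ _ ->]] := rowP F (leqnn V) h; rewrite mevalM Fx mulr0.
Qed.

(** It is the nonvanishing of det M' that passes the zero of det M on to the quotient; the
    perturbation by [vanishing] secures it. *)
Lemma res_zero F x : hform d F -> integral F -> minor d (nonreds N d V e) F V != 0 ->
  (exists i, x i != 0) -> (forall j, (F j).@[x] = 0) -> res d e F = 0.
Proof.
move=> HF OF w0 [i xi] Fx.
have /dvdpP[q Eq] := nonreds_dvd_hits d_gt0 vp He HF OF.
have B0 : detX d (nonreds N d V e) F != 0 by rewrite monic_neq0 // detX_monic.
rewrite /res Eq mulpK //.
have : (q * detX d (nonreds N d V e) F).[0] = 0.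
  rewrite -Eq eval_minor0 //; apply: (detq_null (v := fun b => 'X_[b].@[x])).
    apply/hasP; exists (U_(i) *+ e)%MM.
      by rewrite hits_crit // mem_ms mdegMn mdeg1 mul1n.
    rewrite mevalX prodf_seq_neq0; apply/allP => j _; rewrite mulmnE mnm1E /=.
    by have [<-|_] := eqVneq i j; rewrite ?mul1n ?mul0n ?expr0 ?oner_neq0 ?expf_neq0.
  move=> a; rewrite mem_filter_ms => /andP[ha /eqP ae].
  rewrite -[RHS](row_eval0 Fx ha).
  have Hr : row d F V a \is e.-homog by rewrite -ae; apply: row_homog.
  rewrite [in RHS](dhomog_ms Hr) raddf_sum hits_crit //; apply: eq_bigr => b _.
  by symmetry; exact: mevalZ.
move/eqP; rewrite hornerM mulf_eq0 => /orP[/eqP //|].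
by rewrite eval_minor0 // (negbTE w0).
Qed.

Lemma nonred_pred (a : 'X_{1..V}) : nonred d V a -> hit d N a.
Proof. by rewrite nonredS // => /orP[/nonred_hit|/andP[]]. Qed.

Lemma all_hit_nonreds_pred : all_hit d N (nonreds N d V e).
Proof. by apply/allP => a; rewrite mem_filter => /andP[/nonred_pred]. Qed.

(** Of two indices with exponent at least d, one is below N, so no nonreduced row has the last form
    as pivot. *)
Lemma minor_nonreds_pred F :
  minor d (nonreds N d V e) F V = minor d (nonreds N d V e) F N.
Proof.
apply: eq_detq => a b; rewrite mem_filter => /andP[/nonred_pred h _] _.
by rewrite rowS_hit.
Qed.

(* A system vanishing at x whose det M' equals 1. *)
Definition vanishing x : 'I_V -> {mpoly K[V]} := fun j =>
  'X_[U_(j) *+ d] - (x j / x ord_max) ^+ d *: 'X_[U_(ord_max) *+ d].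

Lemma meval_Ud x i : 'X_[U_(i) *+ d].@[x] = x i ^+ d.
Proof. by rewrite -mpolyXn rmorphXn /= mevalXU. Qed.

Lemma vanishing_eval x j : x ord_max != 0 -> (vanishing x j).@[x] = 0.
Proof.
by move=> x0; rewrite mevalB mevalZ !meval_Ud expr_div_n divfK ?subrr ?expf_neq0.
Qed.

Lemma vanishing_hform x : hform d (vanishing x).
Proof.
by move=> j; rewrite /vanishing -scaleNr; apply: dhomogDZ; apply: dhomog_Ud.
Qed.

Lemma minor_vanishing x : minor d (nonreds N d V e) (vanishing x) N = 1.
Proof.
apply: (@minor_trig _ _ _ d_gt0 _ _ _ (fun _ => ord_max) (fun j => - (x (inord j) / x ord_max) ^+ d)
  (fun i => (i < N)%N : nat)) => //; first exact: all_hit_nonreds_pred.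
  by move=> j _; rewrite /vanishing scaleNr.
by move=> j jN _; rewrite /= ltnn inordK ?jN // ltnW.
Qed.

(** Homogenised as u F + s [vanishing], det M' is 1 at (u, s) = (0, 1). If it vanished on the line u
    = 1, homogeneity would make it vanish for all u != 0, hence everywhere. *)
Lemma perturbed_minor_neq0 F x : exists2 r : {poly K}, r != 0 & forall s, r.[s] != 0 ->
  minor d (nonreds N d V e) (fun j => F j + s *: vanishing x j) V != 0.
Proof.
pose f (u s : K) := minor d (nonreds N d V e) (fun j => u *: F j + s *: vanishing x j) N.
have hp := all_hit_nonreds_pred.
have pf : polyfun2 f.
  apply: polyfun2_detq => a b aU _; have h : hit d N a := allP hp a aU.
  have [E|[j [m [_ E]]]] := row_coef K b (leqnSn N) h.
    by apply: eq_polyfun2 (polyfun2_const 0) => s t; rewrite E.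
  apply: (eq_polyfun2 (f := fun s t => s * (F (inord j))@_m + t * (vanishing x (inord j))@_m)).
    by move=> s t; rewrite E [RHS]mcoeffD; congr (_ + _); symmetry; exact: mcoeffZ.
  by apply: polyfun2D; apply: polyfun2M; try exact: polyfun2_const; [exact: polyfun2_s | exact: polyfun2_t].
have [r Hr] := polyfun2_slice 1 pf.
have E s : minor d (nonreds N d V e) (fun j => F j + s *: vanishing x j) V = r.[s].
  by rewrite minor_nonreds_pred -Hr; apply: eq_minor => // j _; rewrite scale1r.
exists r => [|s]; last by rewrite E.
apply/negP => /eqP r0.
have f01 : f 0 1 = 1.
  rewrite -[RHS](minor_vanishing x) /f; apply: eq_minor => // j _ /=.
  by rewrite scale0r add0r scale1r.
have : f 0 1 = 0; last by move/eqP; rewrite f01 oner_eq0.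
apply: (polyfun2_cancel (polyfun2_s K) pf); first by exists 1, 0; rewrite oner_neq0.
move=> u s u0; transitivity (minor d (nonreds N d V e) (fun j => u *: (F j + (u^-1 * s) *: vanishing x j)) N).
  by rewrite /f; apply: eq_minor => // j _ /=; rewrite [RHS]scalerDr scalerA mulrA mulfV // mul1r.
by rewrite minorZ // -minor_nonreds_pred E r0 horner0 mulr0.
Qed.

(* If F(x) is small then F is close to a system vanishing at x. *)
Lemma res_le_value (E : K -> Prop) F x k eta : ideal_pair O E -> hform d F -> integral F ->
  (forall i, O (x i)) -> x k != 0 -> O (x k)^-1 -> ~ M (x k) -> (forall j, E (F j).@[x]) ->
  eta != 0 -> O eta -> E eta -> E (res d e F).
Proof.
move=> ipE HF OF Ox xk0 Oxk nMxk Efx eta0 Oeta Eeta.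
(* [vanishing] divides by the last coordinate; if that is zero, it is replaced by eta, which changes
   the point only within E. *)
have [y [Oy yN yk dy]] : exists y : 'I_V -> K, [/\ forall i, O (y i), y ord_max != 0, y k = x k
    & forall i, E (x i - y i)].
  have [xN|xN] := eqVneq (x ord_max) 0; last first.
    by exists x; split => // i; rewrite subrr; exact: ip_E0 ipE.
  exists (fun i => if i == ord_max then eta else x i); split.
  - by move=> i; case: eqP.
  - by rewrite eqxx.
  - by case: eqP => // kN; rewrite kN xN eqxx in xk0.
  - move=> i; case: eqP => [->|_]; last by rewrite subrr; exact: ip_E0 ipE.
    by rewrite xN sub0r; apply: (ip_EN ipE).
have EFy j : E (F j).@[y].
  rewrite -[X in E X](subKr (F j).@[x]); apply: (ip_EB ipE) => //.
  exact: (ip_meval_cong ipE).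
pose c j := (F j).@[y] / x k ^+ d.
have Ec j : E (c j) by apply: (ip_EMr ipE) => //; rewrite -exprVn; apply: (ip_OX ip).
have Oc j : O (c j).
  apply: (ip_OM ip); first by apply: (ip_meval_O ip).
  by rewrite -exprVn; apply: (ip_OX ip).
pose F1 j := F j - c j *: 'X_[U_(k) *+ d].
have F1y j : (F1 j).@[y] = 0.
  by rewrite mevalB mevalZ meval_Ud yk divfK ?subrr ?expf_neq0.
have [r r0 Hr] := perturbed_minor_neq0 F1 y.
(* The factor y_N^d clears the denominators of [vanishing y], and eta puts the result into E. *)
have z0 : eta * y ord_max ^+ d != 0 by rewrite mulf_neq0 ?expf_neq0.
have [s [s0 Ms Msz rs]] := vp_small vp r0 z0.
have Os : O s := vp_MO vp Ms.
have OUd (i : 'I_V) m : O ('X_[K, U_(i) *+ d])@_m by exact: fermat_coef ip.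
have Omz : O (s / (eta * y ord_max ^+ d)) := vp_MO vp Msz.
have sE : s = (s / (eta * y ord_max ^+ d)) * (eta * y ord_max ^+ d) by rewrite divfK.
have Es : E s.
  rewrite sE; apply: (ip_EM ipE) => //; apply: (ip_EMr ipE) => //; exact: (ip_OX ip).
have tE j : s * (y j / y ord_max) ^+ d = (s / (eta * y ord_max ^+ d)) * (eta * y j ^+ d).
  by rewrite expr_div_n; field; rewrite eta0 expf_neq0.
have Et j : E (s * (y j / y ord_max) ^+ d).
  rewrite tE; apply: (ip_EM ipE) => //; apply: (ip_EMr ipE) => //; exact: (ip_OX ip).
have Ot j : O (s * (y j / y ord_max) ^+ d).
  rewrite tE; apply: (ip_OM ip) => //; apply: (ip_OM ip) => //; exact: (ip_OX ip).
pose F2 j := F1 j + s *: vanishing y j.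
have coefF2 j m : (F2 j)@_m = (F j)@_m - c j * ('X_[U_(k) *+ d])@_m +
    (s * ('X_[U_(j) *+ d])@_m - s * (y j / y ord_max) ^+ d * ('X_[U_(ord_max) *+ d])@_m).
  have vE : (vanishing y j)@_m = ('X_[U_(j) *+ d])@_m - (y j / y ord_max) ^+ d * ('X_[U_(ord_max) *+ d])@_m.
    by rewrite mcoeffB mcoeffZ.
  rewrite /F2; move: (vanishing y j) vE => v vE; rewrite mcoeffD mcoeffZ vE mulrBr mulrA.
  by rewrite mcoeffB mcoeffZ.
have OF2 : integral F2.
  move=> j m; rewrite coefF2; apply: (ip_OD ip); apply: (ip_OB ip) => //;
    by apply: (ip_OM ip).
have E2 j m : E ((F j)@_m - (F2 j)@_m).
  rewrite coefF2 [X in E X](_ : _ = c j * ('X_[U_(k) *+ d])@_m - s * ('X_[U_(j) *+ d])@_m +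
    s * (y j / y ord_max) ^+ d * ('X_[U_(ord_max) *+ d])@_m); last by ring.
  by apply: (ip_ED ipE); [apply: (ip_EB ipE) |]; apply: (ip_EMr ipE).
rewrite -[X in E X](subrK (res d e F2)); apply: (ip_ED ipE); first exact: res_cong.
rewrite (@res_zero F2 y) //.
- exact: (ip_E0 ipE).
- move=> j; apply: dhomogDZ; last exact: vanishing_hform.
  by rewrite /F1 -scaleNr; apply: dhomogDZ => //; apply: dhomog_Ud.
- exact: Hr.
- by exists ord_max.
by move=> j; rewrite mevalD F1y mevalZ vanishing_eval // mulr0 addr0.
Qed.

End ResBound.

(** * Homogeneous Nullstellensatz *)

Section Ideals.
Variables (K : closedFieldType) (n : nat).
Local Notation poly := {mpoly K[n]}.
Implicit Types (p q f g : poly) (L : seq poly) (m : 'X_{1..n}).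

Fixpoint in_ideal L p : Prop :=
  if L is f :: L' then exists q, in_ideal L' (p - q * f) else p = 0.

Lemma ideal0 L : in_ideal L 0.
Proof. by elim: L => //= f L IH; exists 0; rewrite mul0r subr0. Qed.

Lemma idealD L p q : in_ideal L p -> in_ideal L q -> in_ideal L (p + q).
Proof.
elim: L p q => [p q -> ->|f L IH p q [a Ha] [b Hb]] /=; first by rewrite addr0.
by exists (a + b); rewrite mulrDl opprD addrACA; apply: IH.
Qed.

Lemma idealM L p q : in_ideal L p -> in_ideal L (q * p).
Proof.
elim: L p => [p ->|f L IH p [a Ha]] /=; first by rewrite mulr0.
by exists (q * a); rewrite -mulrA -mulrBr; apply: IH.
Qed.

Lemma idealN L p : in_ideal L p -> in_ideal L (- p).
Proof. by rewrite -mulN1r; apply: idealM. Qed.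

Lemma idealB L p q : in_ideal L p -> in_ideal L q -> in_ideal L (p - q).
Proof. by move=> Hp Hq; apply: idealD => //; apply: idealN. Qed.

Lemma idealZ L c p : in_ideal L p -> in_ideal L (c *: p).
Proof. by rewrite -mul_mpolyC; apply: idealM. Qed.

Lemma ideal_sum L (I : eqType) (s : seq I) (h : I -> poly) :
  {in s, forall i, in_ideal L (h i)} -> in_ideal L (\sum_(i <- s) h i).
Proof.
move=> H; rewrite big_seq; apply: (big_ind (in_ideal L)) => //; first exact: ideal0.
exact: idealD.
Qed.

Lemma ideal_cons L f p : in_ideal L p -> in_ideal (f :: L) p.
Proof. by move=> H; exists 0; rewrite mul0r subr0. Qed.

Lemma ideal_head L f : in_ideal (f :: L) f.
Proof. by exists 1; rewrite mul1r subrr; apply: ideal0. Qed.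

Lemma ideal_mem L f : f \in L -> in_ideal L f.
Proof.
elim: L => // g L IH; rewrite inE => /orP[/eqP ->|/IH]; first exact: ideal_head.
exact: ideal_cons.
Qed.

Definition homog_gens L := forall f, f \in L -> exists e, f \is e.-homog.

Lemma homog_gens_cons f L e : f \is e.-homog -> homog_gens L -> homog_gens (f :: L).
Proof. by move=> Hf HL g; rewrite inE => /orP[/eqP ->|/HL //]; exists e. Qed.

Lemma pihomogZ e c p : pihomog mdeg e (c *: p) = c *: pihomog mdeg e p.
Proof. exact: linearZ. Qed.

Lemma pihomogM e d q f : f \is d.-homog -> pihomog mdeg (e + d) (q * f) = pihomog mdeg e q * f.
Proof.
move=> Hf; rewrite [in LHS](mpolyE q) mulr_suml raddf_sum pihomogE mulr_suml [RHS]big_mkcond.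
apply: eq_bigr => m _; rewrite -scalerAl.
have H : 'X_[m] * f \is (mdeg m + d).-homog by apply: dhomogM => //; rewrite dhomogX.
transitivity (q@_m *: pihomog mdeg (e + d) ('X_[m] * f)); first exact: pihomogZ.
case: eqP => [<-|/eqP me]; first by rewrite pihomog_dE // scalerAl.
by rewrite (pihomog_ne0 _ H) ?scaler0 // eqn_add2r.
Qed.

Lemma pihomogM_lt e d q f : (e < d)%N -> f \is d.-homog -> pihomog mdeg e (q * f) = 0.
Proof.
move=> ed Hf; rewrite [in LHS](mpolyE q) mulr_suml raddf_sum big1 // => m _; rewrite -scalerAl.
have H : 'X_[m] * f \is (mdeg m + d).-homog by apply: dhomogM => //; rewrite dhomogX.
transitivity (q@_m *: pihomog mdeg e ('X_[m] * f)); first exact: pihomogZ.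
by rewrite (pihomog_ne0 _ H) ?scaler0 // gtn_eqF // (leq_trans ed) ?leq_addl.
Qed.

Lemma ideal_pihomog L e p : homog_gens L -> in_ideal L p -> in_ideal L (pihomog mdeg e p).
Proof.
elim: L e p => [|f L IH] e p HL /=; first by move=> ->; rewrite pihomog0.
move=> [q Hq]; have [d Hf] := HL f (mem_head _ _).
have HL' : homog_gens L by move=> g gL; apply: HL; rewrite inE gL orbT.
have := IH e _ HL' Hq; rewrite pihomogB.
have [ed|de] := ltnP e d.
  by rewrite (pihomogM_lt _ ed Hf) subr0 => H; exists 0; rewrite mul0r subr0.
by rewrite -{2}(subnK de) pihomogM // => H; exists (pihomog mdeg (e - d) q).
Qed.

Lemma ideal_split L f d e p : homog_gens L -> f \is d.-homog -> p \is (e + d).-homog ->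
  in_ideal (f :: L) p -> exists2 g, g \is e.-homog & in_ideal L (p - g * f).
Proof.
move=> HL Hf Hp [q Hq]; exists (pihomog mdeg e q); first exact: pihomogP.
by have := ideal_pihomog (e + d) HL Hq; rewrite pihomogB pihomogM // (pihomog_dE Hp).
Qed.

Definition full L e := forall m, mdeg m = e -> in_ideal L 'X_[m].

Lemma full_homog L e p : full L e -> p \is e.-homog -> in_ideal L p.
Proof.
move=> HL Hp; rewrite (dhomog_ms Hp); apply: ideal_sum => m; rewrite mem_ms => /eqP me.
by apply: idealZ; apply: HL.
Qed.

Lemma mnm_factor m e : (e <= mdeg m)%N -> exists m1 m2, m = (m1 + m2)%MM /\ mdeg m2 = e.
Proof.
elim: e => [|e IH] le; first by exists m, 0%MM; rewrite addm0 mdeg0.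
have [m1 [m2 [E E2]]] := IH (ltnW le).
have /existsP[i mi] : [exists i, m1 i != 0%N].
  apply: contraTT le; rewrite negb_exists => /forallP H; rewrite -leqNgt.
  rewrite E mdegD E2 mdegE big1 ?add0n // => i _; apply/eqP; exact: negbNE (H i).
exists (m1 - U_(i))%MM, (U_(i) + m2)%MM; split; last by rewrite mdegD mdeg1 E2.
by rewrite addmA submK // lep1mP.
Qed.

Lemma full_le L e e' : (e <= e')%N -> full L e -> full L e'.
Proof.
move=> le H m me; have [|m1 [m2 [-> E2]]] := @mnm_factor m e; first by rewrite me.
by rewrite mpolyXD; apply: idealM; apply: H.
Qed.

(** The ideal contains no power of the irrelevant ideal; adjoining further forms while keeping this
    property leads to a zero. *)
Definition big L := forall e, ~ full L e.

Definition sub_ideal L L' := forall p, in_ideal L p -> in_ideal L' p.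

Lemma sub_ideal_cons L L' f : sub_ideal L L' -> sub_ideal (f :: L) (f :: L').
Proof. by move=> H p [q Hq]; exists q; apply: H. Qed.

Lemma dhomogU (i : 'I_n) : ('X_i : poly) \is 1.-homog.
Proof. by rewrite dhomogX /= mdeg1. Qed.

Lemma dhomogUBZ (i k : 'I_n) a : ('X_i - a *: 'X_k : poly) \is 1.-homog.
Proof. by rewrite -scaleNr; apply: dhomogDZ; exact: dhomogU. Qed.

(* If all x_i - a x_k were eventually surjective modulo L, so would be their product
   over the eigenvalues of multiplication by x_i / x_k, which is zero modulo L. *)
Lemma extend_zero L (i k : 'I_n) E : homog_gens L -> big L -> full ('X_k :: L) E.+1 ->
  exists a : K, big (('X_i - a *: 'X_k) :: L).
Proof.
move=> HL bL fk; apply: NNPP => Hna.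
have Ha a : exists e, full (('X_i - a *: 'X_k) :: L) e.
  by apply: NNPP => He; apply: Hna; exists a => e fe; apply: He; exists e.
pose s := ms n E.
(* In degree E + 1 every form is a multiple of x_k modulo L, so multiplication by x_i on degree E
   factors through x_k; M is a matrix for x_i / x_k. *)
have [M HM] : exists M : 'X_{1..n} -> 'X_{1..n} -> K, {in s, forall b,
    in_ideal L ('X_i * 'X_[b] - 'X_k * \sum_(c <- s) M b c *: 'X_[c])}.
  apply: (@seq_choice _ _ (fun _ => 0) s (fun b r => in_ideal L ('X_i * 'X_[b] - 'X_k * \sum_(c <- s) r c *: 'X_[c]))).
  move=> b; rewrite mem_ms => /eqP bE.
  have Hd : ('X_i * 'X_[b] : poly) \is (E + 1).-homog.
    by rewrite addnC; apply: dhomogM; [exact: dhomogU | rewrite dhomogX /= bE].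
  have [|g Hg Hin] := ideal_split HL (dhomogU k) Hd.
    by apply: full_homog fk _; rewrite -addn1.
  by exists (fun c => g@_c); rewrite -(dhomog_ms Hg) mulrC [X in _ - X]mulrC mulrC.
case Es : (size s) => [|n'].
  by apply: (bL E) => m /eqP; rewrite -mem_ms -/s (size0nil Es).
pose A := \matrix_(i0 < n'.+1, j < n'.+1) M (nth 0%MM s i0) (nth 0%MM s j).
pose phi (u : 'rV[K]_n'.+1) : poly := \sum_(j < n'.+1) u 0 j *: 'X_[nth 0%MM s j].
have bigs (h : 'X_{1..n} -> poly) : \sum_(c <- s) h c = \sum_(j < n'.+1) h (nth 0%MM s j).
  by rewrite (big_nth 0%MM) Es big_mkord.
have phiE u : in_ideal L ('X_i * phi u - 'X_k * phi (u *m A)).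
  have phiA : phi (u *m A) = \sum_(j < n'.+1) u 0 j *: \sum_(c <- s) M (nth 0%MM s j) c *: 'X_[c].
    rewrite /phi; under eq_bigr => j _ do rewrite mxE scaler_suml.
    rewrite exchange_big; apply: eq_bigr => j _.
    rewrite bigs scaler_sumr; apply: eq_bigr => l _.
    by rewrite mxE scalerA.
  rewrite phiA /phi !mulr_sumr -sumrB; apply: ideal_sum => j _.
  rewrite -!scalerAr -scalerBr; apply: idealZ; apply: HM.
  by apply: mem_nth; rewrite Es.
have phiD u v : phi (u + v) = phi u + phi v.
  by rewrite /phi -big_split; apply: eq_bigr => j _; rewrite mxE scalerDl.
have phiN u a : phi (a *: u) = a *: phi u.
  by rewrite /phi scaler_sumr; apply: eq_bigr => j _; rewrite mxE scalerA.
have phi0 : phi 0 = 0 by rewrite /phi big1 // => j _; rewrite mxE scale0r.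
have phi_lin u a : in_ideal L (('X_i - a *: 'X_k) * phi u - 'X_k * phi (u *m (A - a%:M))).
  have -> : phi (u *m (A - a%:M)) = phi (u *m A) - a *: phi u.
    by rewrite mulmxBr mul_mx_scalar phiD -scaleN1r !phiN scaleN1r.
  have := phiE u; congr (in_ideal L _).
  by rewrite mulrBl mulrBr -scalerAl -scalerAr opprB addrA addrAC; ring.
have [r Er] := closed_field_poly_normal (char_poly A).
have CH := Cayley_Hamilton A.
rewrite Er (monicP (char_poly_monic A)) scale1r in CH.
have prodE (l : seq K) u : in_ideal L ((\prod_(a <- l) ('X_i - a *: 'X_k)) * phi u -
    'X_k ^+ size l * phi (u *m horner_mx A (\prod_(a <- l) ('X - a%:P)))).
  elim: l u => [|a l IH] u.
    by rewrite !big_nil /= expr0 !mul1r rmorph1 mulmx1 subrr; apply: ideal0.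
  rewrite !big_cons /= exprS rmorphM rmorphB /= horner_mx_X horner_mx_C.
  set T := \prod_(a <- l) ('X_i - a *: 'X_k); set B := horner_mx A _.
  rewrite mulmxA.
  have h1 := idealM T (phi_lin u a).
  have h2 := idealM 'X_k (IH (u *m (A - a%:M))).
  have E0 (T' P Q x y z : poly) N : T' * (P * x - Q * y) + Q * (T' * y - Q ^+ N * z) = P * T' * x - Q * Q ^+ N * z by ring.
  by have := idealD h1 h2; rewrite E0.
have kill : forall m, mdeg m = E -> in_ideal L ((\prod_(a <- r) ('X_i - a *: 'X_k)) * 'X_[m]).
  move=> m /eqP; rewrite -mem_ms -/s => ms_.
  have lt : (index m s < n'.+1)%N by rewrite -Es index_mem.
  have -> : 'X_[m] = phi (delta_mx 0 (Ordinal lt)).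
    rewrite /phi (bigD1 (Ordinal lt)) //= mxE !eqxx scale1r nth_index // big1 ?addr0 //.
    by move=> j /negbTE nj; rewrite mxE eqxx /= nj scale0r.
  have := prodE r (delta_mx 0 (Ordinal lt)).
  by rewrite CH mulmx0 phi0 mulr0 subr0.
(* The factors x_i - a x_k are removed one at a time at the cost of raising the degree; the empty
   product says that L is full. *)
suff [e fe] : exists e, full L e by apply: (bL e).
have {kill} : exists e0, forall m, mdeg m = e0 -> in_ideal L ((\prod_(a <- r) ('X_i - a *: 'X_k)) * 'X_[m]).
  by exists E.
move: r {Er CH} => r; elim: r => [|a r IH] [e0 H0].
  by exists e0 => m me; have := H0 m me; rewrite big_nil mul1r.
apply: IH; have [e1 f1] := Ha a; exists (maxn e0 e1 + 1)%N => m me.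
have [||g Hg Hin] := @ideal_split L ('X_i - a *: 'X_k) 1 (maxn e0 e1) 'X_[m] HL (dhomogUBZ i k a).
- by rewrite dhomogX /= me.
- have le1 : (e1 <= mdeg m)%N by rewrite me (leq_trans (leq_maxr e0 e1)) // leq_addr.
  exact: full_le le1 f1 _ _.
set T := \prod_(a <- r) _.
have -> : T * 'X_[m] = T * ('X_[m] - g * ('X_i - a *: 'X_k)) + T * ('X_i - a *: 'X_k) * g by ring.
apply: idealD; first exact: idealM.
rewrite (dhomog_ms Hg) mulr_sumr; apply: ideal_sum => m'; rewrite mem_ms => /eqP m'e.
rewrite -scalerAr; apply: idealZ.
have [|m1 [m2 [-> E2]]] := @mnm_factor m' e0; first by rewrite m'e leq_maxl.
rewrite mpolyXD mulrCA; apply: idealM.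
by have := H0 m2 E2; rewrite big_cons mulrC -/T [X in in_ideal L X]mulrC; congr (in_ideal L _); ring.
Qed.

Lemma extend_zeros L (k : 'I_n) E (l : seq 'I_n) : homog_gens L -> big L -> full ('X_k :: L) E.+1 ->
  exists (a : 'I_n -> K) L', [/\ homog_gens L', big L', sub_ideal L L' &
    forall i, i \in l -> in_ideal L' ('X_i - a i *: 'X_k)].
Proof.
move=> HL bL fk; elim: l => [|i l [a [L' [HL' bL' sL' Hl]]]].
  by exists (fun _ => 0), L; split => // p.
have fk' : full ('X_k :: L') E.+1 by move=> m /fk; apply: sub_ideal_cons.
have [ai bi] := extend_zero i HL' bL' fk'.
exists (fun j => if j == i then ai else a j), (('X_i - ai *: 'X_k) :: L'); split => //.
- exact: homog_gens_cons (dhomogUBZ i k ai) HL'.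
- by move=> p /sL'; apply: ideal_cons.
move=> j; rewrite inE; have [->|ji] := eqVneq j i; first by move=> _; apply: ideal_head.
by move=> /= /Hl; apply: ideal_cons.
Qed.

Definition has_zero L := exists a : 'I_n -> K, (exists i, a i != 0) /\ forall f, f \in L -> f.@[a] = 0.

(** Modulo the enlarged ideal x_i = a_i x_k, so a form f of degree m is f(a) x_k^m. If f(a) != 0 for
    a generator, x_k^m lies in the ideal; but all forms of large degree are multiples of it modulo
    the ideal, which would then be full. *)
Lemma zero_of_big L (k : 'I_n) E : homog_gens L -> big L -> full ('X_k :: L) E.+1 -> has_zero L.
Proof.
move=> HL bL fk; have [a0 [L' [HL' bL' sL' Hl]]] := extend_zeros (enum 'I_n) HL bL fk.
pose a i := if i == k then 1 else a0 i.
have Ha i : in_ideal L' ('X_i - a i *: 'X_k).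
  rewrite /a; have [->|_] := eqVneq i k; first by rewrite scale1r subrr; apply: ideal0.
  by apply: Hl; rewrite mem_enum.
have fk' : full ('X_k :: L') E.+1 by move=> m /fk; apply: sub_ideal_cons.
have HX m : in_ideal L' ('X_[m] - (\prod_i a i ^+ m i) *: 'X_k ^+ mdeg m).
  have HXn i j : in_ideal L' ('X_i ^+ j - a i ^+ j *: 'X_k ^+ j).
    elim: j => [|j IH]; first by rewrite !expr0 scale1r subrr; apply: ideal0.
    have E0 (P Q c c' : poly) : P * (P ^+ j - c' * Q ^+ j) + (c' * Q ^+ j) * (P - c * Q) =
       P ^+ j.+1 - (c * c') * Q ^+ j.+1 by rewrite !exprS; ring.
    have := idealD (idealM 'X_i IH) (idealM ((a i ^+ j)%:MP * 'X_k ^+ j) (Ha i)).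
    by rewrite -!mul_mpolyC E0 -mpolyCM -exprS mul_mpolyC.
  have Hprod (l : seq 'I_n) : in_ideal L' (\prod_(i <- l) 'X_i ^+ m i -
      (\prod_(i <- l) a i ^+ m i) *: 'X_k ^+ (\sum_(i <- l) m i)%N).
    elim: l => [|i l IH]; first by rewrite !big_nil expr0 scale1r subrr; apply: ideal0.
    rewrite !big_cons exprD.
    have E0 (P A Q W c c' : poly) : A * (P - c * Q) + (c * Q) * (A - c' * W) =
       A * P - (c' * c) * (W * Q) by ring.
    have := idealD (idealM ('X_i ^+ m i) IH) (idealM ((\prod_(j <- l) a j ^+ m j)%:MP * 'X_k ^+ (\sum_(j <- l) m j)) (HXn i (m i))).
    by rewrite -!mul_mpolyC E0 mpolyCM.
  by have := Hprod (index_enum 'I_n); rewrite -mpolyXE_id -mdegE.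
have fullj j m : mdeg m = (E.+1 + j)%N -> exists g, in_ideal L' ('X_[m] - g * 'X_k ^+ j).
  elim: j m => [|j IH] m me; first by exists 'X_[m]; rewrite expr0 mulr1 subrr; apply: ideal0.
  have [||g Hg Hin] := @ideal_split L' 'X_k 1 (E.+1 + j) 'X_[m] HL' (dhomogU k).
  - by rewrite dhomogX /= me addn1 addnS.
  - have le : (E.+1 <= mdeg m)%N by rewrite me leq_addr.
    exact: full_le le fk' _ _.
  have [G HG] : exists G : 'X_{1..n} -> poly, {in ms n (E.+1 + j), forall m', in_ideal L' ('X_[m'] - G m' * 'X_k ^+ j)}.
    apply: (@seq_choice _ _ 0 _ (fun m' G => in_ideal L' ('X_[m'] - G * 'X_k ^+ j))) => m'.
    by rewrite mem_ms => /eqP /IH.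
  exists (\sum_(m' <- ms n (E.+1 + j)) g@_m' *: G m').
  have -> : 'X_[m] - (\sum_(m' <- ms n (E.+1 + j)) g@_m' *: G m') * 'X_k ^+ j.+1 =
     'X_[m] - g * 'X_k + 'X_k * (g - (\sum_(m' <- ms n (E.+1 + j)) g@_m' *: G m') * 'X_k ^+ j).
    by rewrite exprS; ring.
  apply: idealD => //; apply: idealM; rewrite {1}(dhomog_ms Hg) mulr_suml -sumrB.
  by apply: ideal_sum => m' Hm'; rewrite -scalerAl -scalerBr; apply: idealZ; apply: HG.
exists a; split; first by exists k; rewrite /a eqxx oner_neq0.
move=> f fL; have [df Hf] := HL f fL.
have H1 : in_ideal L' (f - f.@[a] *: 'X_k ^+ df).
  have -> : f.@[a] = \sum_(m <- ms n df) f@_m * \prod_i a i ^+ m i.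
    rewrite {1}(dhomog_ms Hf) raddf_sum; apply: eq_bigr => m _.
    by rewrite -mevalX; exact: mevalZ.
  rewrite {1}(dhomog_ms Hf) scaler_suml -sumrB.
  apply: ideal_sum => m; rewrite mem_ms => /eqP md.
  by rewrite -scalerA -scalerBr; apply: idealZ; rewrite -md.
apply: NNPP => /eqP fa; apply: (bL' (E.+1 + df)%N) => m me.
have Hxk : in_ideal L' ('X_k ^+ df).
  have := idealB (sL' _ (ideal_mem fL)) H1; rewrite subKr => /(idealZ (f.@[a])^-1).
  by rewrite scalerA mulVf // scale1r.
have [g Hg] := fullj df m me.
by rewrite -[X in in_ideal L' X](subrK (g * 'X_k ^+ df)); apply: idealD => //; apply: idealM.
Qed.

(** Variables are adjoined while the ideal stays [big]. With all of them degree 1 would be full, so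
    at some x_k the property is lost, and a zero with x_k = 1 exists. *)
Lemma zero_of_big_gens L (l : seq 'I_n) : (0 < n)%N -> homog_gens L -> big L ->
  (forall i, i \in l \/ in_ideal L 'X_i) -> has_zero L.
Proof.
move=> n0; elim: l L => [|k l IH] L HL bL Hl.
  exfalso; apply: (bL 1%N) => m /eqP /mdeg1P[i /eqP ->].
  by have [] := Hl i.
have [bk|] := classic (big ('X_k :: L)).
  have [| |a [a0 Ha]] := IH ('X_k :: L) _ bk.
  - exact: homog_gens_cons (dhomogU k) HL.
  - move=> i; have [->|ik] := eqVneq i k; first by right; apply: ideal_head.
    have [|] := Hl i; last by right; apply: ideal_cons.
    by rewrite inE (negbTE ik) /=; left.
  by exists a; split => // f fL; apply: Ha; rewrite inE fL orbT.
move=> /not_all_ex_not[e /NNPP fe]; apply: (@zero_of_big L k e) => //.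
exact: full_le (leqnSn e) fe.
Qed.

Lemma homogeneous_nullstellensatz L : (0 < n)%N -> homog_gens L -> ~ has_zero L ->
  exists e, full L e.
Proof.
move=> n0 HL Hz; apply: NNPP => He; apply: Hz.
apply: (@zero_of_big_gens L (enum 'I_n)) => //; last by left; rewrite mem_enum.
by move=> e fe; apply: He; exists e.
Qed.

End Ideals.

(** * Nonvanishing of the resultant *)

Section Descent.
Variables (K : fieldType) (N d : nat).
Hypothesis d_gt0 : (0 < d)%N.
Local Notation V := N.+1.
Local Notation poly := {mpoly K[V]}.
Implicit Types (F : 'I_V -> poly) (k e : nat).
Variable F : 'I_V -> poly.
Hypothesis HF : hform d F.

Definition comb k e (p : poly) :=
  exists q : nat -> poly, (forall j, q j \is e.-homog) /\ p = \sum_(j < k) q j * F (inord j).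

Lemma comb_span k e p : (k <= V)%N ->
  (forall j, (j < k)%N -> minor d (hits N d j e) F j != 0) ->
  comb k e p -> inspan (hits N d k (e + d)) (row d F k) p.
Proof.
move=> kV nz [q [Hq ->]]; rewrite -(big_mkord xpredT (fun j => q j * F (inord j))).
apply: inspan_sum => j; rewrite mem_index_iota => jk.
exact: (ideal_span HF kV nz jk (Hq j)).
Qed.

Lemma comb0 k e : comb k e 0.
Proof.
exists (fun _ => 0); split; first by move=> j; rewrite dhomog0.
by rewrite big1 // => j _; rewrite mul0r.
Qed.

Lemma combD k e p q : comb k e p -> comb k e q -> comb k e (p + q).
Proof.
move=> [a [Ha ->]] [b [Hb ->]]; exists (fun j => a j + b j); split.
  by move=> j; apply: rpredD.
by rewrite -big_split; apply: eq_bigr => j _; rewrite mulrDl.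
Qed.

Lemma combM k e e' p q : q \is e'.-homog -> comb k e p -> comb k (e' + e) (q * p).
Proof.
move=> Hq [a [Ha ->]]; exists (fun j => q * a j); split.
  by move=> j; apply: dhomogM.
by rewrite mulr_sumr; apply: eq_bigr => j _; rewrite mulrA.
Qed.

Lemma combZ k e c p : comb k e p -> comb k e (c *: p).
Proof.
move=> [a [Ha ->]]; exists (fun j => c *: a j); split.
  by move=> j; apply: rpredZ.
by rewrite scaler_sumr; apply: eq_bigr => j _; rewrite scalerAl.
Qed.

Lemma combB k e p q : comb k e p -> comb k e q -> comb k e (p - q).
Proof. by move=> Hp Hq; rewrite -[- q]scaleN1r; apply: combD => //; apply: combZ. Qed.

Lemma comb_sum k e (I : eqType) (s : seq I) (h : I -> poly) :
  {in s, forall i, comb k e (h i)} -> comb k e (\sum_(i <- s) h i).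
Proof.
move=> H; rewrite big_seq; apply: (big_ind (comb k e)) => //; first exact: comb0.
exact: combD.
Qed.

Lemma comb_gen k e j q : (j < k)%N -> q \is e.-homog -> comb k e (q * F (inord j)).
Proof.
move=> jk Hq; exists (fun i => if i == j then q else 0); split.
  by move=> i; case: eqP => _ //; rewrite dhomog0.
rewrite (bigD1 (Ordinal jk)) //= eqxx big1 ?addr0 // => i ne.
have /negbTE -> : nat_of_ord i != j by apply: contraNneq ne => e0; apply/eqP/val_inj.
by rewrite mul0r.
Qed.

Lemma comb_le k k' e p : (k <= k')%N -> comb k e p -> comb k' e p.
Proof.
move=> le [q [Hq ->]]; rewrite -(big_mkord xpredT (fun j => q j * F (inord j))).
apply: comb_sum => j; rewrite mem_index_iota => jk.
by apply: comb_gen => //; apply: leq_trans le.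
Qed.

Lemma comb_row k e a : (k <= V)%N -> hit d k a -> mdeg a = (e + d)%N -> comb k e (row d F k a).
Proof.
move=> kV h ae; have [j [jk dj ->]] := rowP F kV h; apply: comb_gen => //.
rewrite dhomogX /= -(eqn_add2r d) -ae.
by rewrite -{2}(mnm_subK dj) mdeg_shift.
Qed.

Lemma row_decomp k e p : (k <= V)%N -> minor d (hits N d k (e + d)) F k != 0 ->
  p \is (e + d).-homog -> exists v, [/\ v \is (e + d).-homog,
    {in ms V (e + d), forall a, hit d k a -> v@_a = 0} & comb k e (p - v)].
Proof.
move=> kV nz Hp; have [c ->] := rows_span HF kV nz Hp.
rewrite (perm_big _ (perm_ms N d k (e + d))) big_cat /=.
set H := \sum_(i <- hits _ _ _ _) _; set S := \sum_(i <- stds _ _ _ _) _.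
exists S; split; last 1 first.
- rewrite addrK; apply: comb_sum => a; rewrite mem_filter_ms => /andP[h /eqP ae].
  by apply: combZ; apply: comb_row.
- rewrite /S big_seq; apply: rpred_sum => a; rewrite mem_filter_ms => /andP[h /eqP ae].
  by apply: rpredZ; rewrite row_std // dhomogX /= ae.
move=> a ae h; rewrite /S raddf_sum big_seq big1 // => b.
rewrite mem_filter_ms => /andP[hb _]; rewrite row_std //.
transitivity (c b * ('X_[b])@_a); first exact: mcoeffZ.
by rewrite mcoeffX; case: eqP => [E|_]; rewrite ?mulr0 //; rewrite E h in hb.
Qed.

(* Standard monomials are independent modulo the first k forms. *)
Lemma std_free k e v : (k <= V)%N -> minor d (hits N d k (e + d)) F k != 0 ->
  (forall j, (j < k)%N -> minor d (hits N d j e) F j != 0) ->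
  v \is (e + d).-homog -> {in ms V (e + d), forall a, hit d k a -> v@_a = 0} ->
  comb k e v -> v = 0.
Proof.
move=> kV nz nzj Hv Hstd Hc; have [h Eh] := comb_span kV nzj Hc.
pose c a := if hit d k a then - h a else v@_a.
have c0 : {in ms V (e + d), forall a, c a = 0}.
  apply: (detq_free (M := fun a b => (row d F k a)@_b)); first by rewrite minor_full.
  move=> b bE; rewrite (perm_big _ (perm_ms N d k (e + d))) big_cat /=.
  have e1 : \sum_(a <- hits N d k (e + d)) c a * (row d F k a)@_b = - v@_b.
    rewrite Eh raddf_sum -sumrN big_seq [RHS]big_seq; apply: eq_bigr => a.
    rewrite mem_filter /c => /andP[-> _]; rewrite mulNr; congr (- _).
    by symmetry; exact: mcoeffZ.
  have e2 : \sum_(a <- stds N d k (e + d)) c a * (row d F k a)@_b = v@_b.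
    rewrite [in RHS](dhomog_ms Hv) raddf_sum (perm_big _ (perm_ms N d k (e + d))) big_cat /=.
    rewrite [X in _ = X + _]big_seq [X in _ = X + _]big1 ?add0r; last first.
      move=> a; rewrite mem_filter => /andP[ha ae]; rewrite Hstd // scale0r; exact: mcoeff0.
    rewrite big_seq [RHS]big_seq; apply: eq_bigr => a.
    rewrite mem_filter /c => /andP[ha _]; rewrite (negbTE ha) row_std //.
    by symmetry; exact: mcoeffZ.
  by rewrite e1 e2 addNr.
rewrite (dhomog_ms Hv) big_seq big1 // => a ae.
have := c0 a ae; rewrite /c; case: ifP => [ha _|_ ->]; last by rewrite scale0r.
by rewrite Hstd // scale0r.
Qed.

(** Above degree N(d - 1), standard monomials for the first N forms are divisible by the last
    variable; this is what permits descent in the degree. *)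
Lemma last_pos (a : 'X_{1..V}) : ~~ hit d N a -> (N * d.-1 < mdeg a)%N -> (0 < a ord_max)%N.
Proof.
move=> h; apply: contraTT; rewrite -!leqNgt leqn0 => /eqP a0.
move: h; rewrite /hit -leqNgt leqn0 /cnt sum_nat_eq0 => /forallP H.
rewrite mdegE big_ord_recr /= a0 addn0 -[X in (X * _)%N](card_ord N) -sum_nat_const.
apply: leq_sum => i _; have := H i; rewrite eqb0 -ltnNge.
have -> : inord i = widen_ord (leqnSn N) i :> 'I_V by apply: val_inj; rewrite /= inordK // ltnW // ltnS.
by move=> lt; rewrite -ltnS prednK.
Qed.

(* Multiplication by the last variable is injective modulo F_0, .., F_(N-1),
   whence a full degree descends down to the critical one. *)
Lemma full_descent e E : (N * d.-1 <= e)%N -> (e < E)%N ->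
  (forall k e', (k <= N)%N -> (e' <= E + d)%N -> minor d (hits N d k e') F k != 0) ->
  (forall m, mdeg m = (e.+1 + d)%N -> comb V e.+1 'X_[m]) ->
  forall m, mdeg m = (e + d)%N -> comb V e 'X_[m].
Proof.
move=> He eE nz Hfull m me.
have nzN e' : (e' <= E + d)%N -> minor d (hits N d N e') F N != 0 by move=> ?; apply: nz.
have [|q [Hq Eq]] := Hfull (U_(ord_max) + m)%MM; first by rewrite mdegD mdeg1 me.
have NN : inord N = ord_max :> 'I_V by apply: val_inj; rewrite /= inordK.
rewrite mpolyXD big_ord_recr /= NN in Eq.
have [c Ec] := rows_span HF (leqnSn N) (nzN e.+1 (leq_trans eE (leq_addr _ _))) (Hq N).
(* The standard part of the cofactor of F_N is x_N Q; its other part lies in the ideal of the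
   earlier forms. So x_N (x^m - Q F_N) lies in that ideal too. *)
pose Q := \sum_(b <- stds N d N e.+1) c b *: ('X_[b - U_(ord_max)] : poly).
have HQ : Q \is e.-homog.
  rewrite /Q big_seq; apply: rpred_sum => b; rewrite mem_filter_ms => /andP[hb /eqP be].
  apply: rpredZ; rewrite dhomogX /=.
  have bp : (0 < b ord_max)%N by apply: last_pos => //; rewrite be.
  have := congr1 mdeg (submK (_ : U_(ord_max) <= b)%MM); rewrite lep1mP -lt0n bp => /(_ isT).
  by rewrite mdegD mdeg1 be addn1 => -[->].
have C1 : comb N e.+1 ('X_(ord_max) * ('X_[m] - Q * F ord_max)).
  have -> : 'X_(ord_max) * ('X_[m] - Q * F ord_max) = \sum_(i < N) q i * F (inord i) +
      \sum_(b <- hits N d N e.+1) c b *: (F ord_max * row d F N b).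
    have SQ : \sum_(b <- stds N d N e.+1) c b *: row d F N b = 'X_(ord_max) * Q.
      rewrite /Q mulr_sumr big_seq [RHS]big_seq; apply: eq_bigr => b.
      rewrite mem_filter_ms => /andP[hb /eqP be]; rewrite row_std // -scalerAr -mpolyXD addmC submK //.
      by rewrite lep1mP -lt0n; apply: last_pos => //; rewrite be.
    have HH : \sum_(b <- hits N d N e.+1) c b *: (F ord_max * row d F N b) =
        (\sum_(b <- hits N d N e.+1) c b *: row d F N b) * F ord_max.
      by rewrite mulr_suml; apply: eq_bigr => b _; rewrite -scalerAl mulrC.
    by rewrite mulrBr Eq Ec (perm_big _ (perm_ms N d N e.+1)) big_cat /= SQ HH; ring.
  apply: combD; first by exists q.
  apply: comb_sum => b; rewrite mem_filter_ms => /andP[hb /eqP be]; apply: combZ.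
  have [j [jN dj ->]] := rowP F (leqnSn N) hb.
  rewrite mulrCA mulrA; apply: comb_gen => //.
  have -> : e.+1 = (e.+1 - d + d)%N by rewrite subnK // -be (leq_trans dj) ?mnm_le_mdeg.
  apply: dhomogM => //; rewrite dhomogX /= -(eqn_add2r d) subnK; last by rewrite -be (leq_trans dj) ?mnm_le_mdeg.
  by rewrite -be -{2}(mnm_subK dj) mdeg_shift.
have Hu : 'X_[m] - Q * F ord_max \is (e + d).-homog.
  by apply: rpredB; [rewrite dhomogX /= me | apply: dhomogM].
have [v [Hv Hstd Hc]] := row_decomp (leqnSn N) (nzN (e + d)%N (leq_add (ltnW eE) (leqnn d))) Hu.
have Cv : comb N e.+1 ('X_(ord_max) * v).
  have -> : 'X_(ord_max) * v = 'X_(ord_max) * ('X_[m] - Q * F ord_max) -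
     'X_(ord_max) * ('X_[m] - Q * F ord_max - v) by ring.
  apply: combB => //; rewrite -add1n; apply: combM => //.
  by rewrite dhomogX /= mdeg1.
(* Multiplication by x_N leaves the exponents of index below N alone, so the product is still
   supported on standard monomials. *)
have v0 : 'X_(ord_max) * v = 0.
  apply: (std_free (leqnSn N) _ _ _ _ Cv).
  - by apply: nzN; rewrite leq_add2r.
  - move=> j jN; apply: nz; first exact: ltnW.
    exact: leq_trans eE (leq_addr _ _).
  - by rewrite -[(e.+1 + d)%N]/(1 + (e + d))%N; apply: dhomogM => //; rewrite dhomogX /= mdeg1.
  move=> a ae ha; rewrite mulrC; apply/eqP; rewrite mcoeff_eq0.
  rewrite (perm_mem (msuppMX _ _)); apply/mapP => -[b bv Ea].
  have hb : hit d N b.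
    rewrite /hit; move: ha; rewrite Ea /hit /cnt.
    under eq_bigr => j _.
      rewrite mnmDE mnm1E; have -> : (ord_max == inord j :> 'I_V) = false.
        apply/eqP => /(congr1 val) /=; rewrite inordK; first by move=> E0; have := ltn_ord j; rewrite -E0 ltnn.
        by apply: ltnW; rewrite ltnS.
      rewrite add0n; over.
    by [].
  have bE : b \in ms V (e + d).
    by rewrite mem_ms; move: ae; rewrite Ea mem_ms mdegD mdeg1 addSn eqSS.
  by move: bv; rewrite mcoeff_msupp Hstd ?eqxx.
have {}v0 : v = 0.
  by apply/eqP; move/eqP: v0; rewrite mulf_eq0 => /orP[/eqP X0|//];
    have := congr1 (mcoeff U_(ord_max)%MM) X0; rewrite mcoeffX eqxx mcoeff0 => /eqP; rewrite oner_eq0.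
rewrite -[X in comb _ _ X](subrK (Q * F ord_max)); apply: combD.
  by apply: comb_le (leqnSn N) _; move: Hc; rewrite v0 subr0.
by rewrite -NN; apply: comb_gen.
Qed.

Lemma minor_full_neq0 e E : (N * d.-1 <= e)%N -> (e <= E)%N ->
  (forall k e', (k <= N)%N -> (e' <= E + d)%N -> minor d (hits N d k e') F k != 0) ->
  (forall m, mdeg m = (E + d)%N -> comb V E 'X_[m]) ->
  minor d (hits N d V (e + d)) F V != 0.
Proof.
move=> He eE nz HE.
have {HE} H : forall i, (e <= i <= E)%N -> forall m, mdeg m = (i + d)%N -> comb V i 'X_[m].
  move=> i /andP[ei iE]; rewrite -(subKn iE) in ei *; elim: (E - i)%N ei => [|j IH] ei.
    by rewrite subn0.
  have [jE|Ej] := ltnP j E; last first.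
    have e0 : (E - j.+1 = E - j)%N by clear -Ej; lia.
    by rewrite e0; apply: IH; rewrite -e0.
  apply: (@full_descent _ E) => //; first exact: leq_trans He ei.
    by rewrite ltn_subrL (leq_trans _ jE).
  rewrite subnSK //; apply: IH; apply: leq_trans ei _; exact: leq_sub2l.
apply: minor_neq0_span => // m; rewrite mem_ms => /eqP me.
rewrite -(@hits_crit N d d_gt0); last by move: He d_gt0; rewrite mulSn; clear; move: (N * _)%N; lia.
apply: comb_span => //; first by move=> j jV; apply: nz => //; rewrite (leq_trans eE) ?leq_addr.
by apply: H => //; rewrite leqnn eE.
Qed.

End Descent.

Lemma in_ideal_map (K : closedFieldType) n (I : eqType) (F : I -> {mpoly K[n]}) (l : seq I) p :
  uniq l -> in_ideal (map F l) p -> exists q : I -> {mpoly K[n]}, p = \sum_(i <- l) q i * F i.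
Proof.
elim: l p => [|i l IH] p /=; first by move=> _ ->; exists (fun _ => 0); rewrite big_nil.
move=> /andP[il ul] [a /(IH _ ul)[q Eq]].
exists (fun j => if j == i then a else q j); rewrite big_cons eqxx.
rewrite -[LHS](subrK (a * F i)) Eq addrC; congr (_ + _).
by apply: eq_big_seq => j jl; case: eqP => // E; rewrite -E jl in il.
Qed.

Lemma comb_sym (K : fieldType) N (s : 'S_N.+1) (F : 'I_N.+1 -> {mpoly K[N.+1]}) k e p :
  comb F k e p -> comb (symf s F) k e (msym s p).
Proof.
move=> [q [Hq ->]]; exists (fun j => msym s (q j)); split; first by move=> j; apply: msym_homog.
by rewrite msym_sum; apply: eq_bigr => j _; rewrite msymM.
Qed.

Section ResNonzero.
Variables (K : closedFieldType) (N d : nat) (O M : K -> Prop).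
Hypothesis d_gt0 : (0 < d)%N.
Hypothesis vp : valuation_pair O M.
Local Notation V := N.+1.
Let ip := vp_ip vp.
Implicit Types (F : 'I_V -> {mpoly K[V]}).

Lemma common_denominator (l : seq K) : exists x, [/\ x != 0, O x & {in l, forall a, O (x * a)}].
Proof.
elim: l => [|a l [x [x0 Ox Hx]]]; first by exists 1; split; rewrite ?oner_neq0 //; exact: ip_O1 ip.
have [Oa|[a0 Ma]] := vp_val vp a (oner_neq0 K).
  rewrite divr1 in Oa; exists x; split => // b; rewrite inE => /orP[/eqP ->|/Hx //].
  exact: (ip_OM ip).
have Oa := vp_MO vp Ma; rewrite div1r in Oa.
exists (a^-1 * x); split; first by rewrite mulf_neq0 ?invr_neq0.
  exact: (ip_OM ip).
move=> b; rewrite inE => /orP[/eqP ->|/Hx Hb].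
  by rewrite mulrAC mulVf // mul1r.
by rewrite -mulrA; apply: (ip_OM ip).
Qed.

(** The product of the roots is q(0) up to sign. If all roots were at least |x| in size, then
    |x|^deg q <= |q(0)| <= |s|. *)
Lemma small_root (q : {poly K}) s z x : q \is monic -> x != 0 -> q.[0] = s * z -> O z ->
  M (s / x ^+ (size q).-1) -> exists2 t, root q t & M (t / x).
Proof.
move=> mq x0 q0 Oz Ms; apply: NNPP => Hn.
have [r Er] := closed_field_poly_normal q; rewrite (monicP mq) scale1r in Er.
have Hr : {in r, forall t, t != 0 /\ O (x / t)}.
  move=> t tr; have rt : root q t by rewrite Er root_prod_XsubC.
  have nM : ~ M (t / x) by move=> Mt; apply: Hn; exists t.
  have t0 : t != 0 by apply: contraPneq nM => -> []; rewrite mul0r; exact: ip_E0 ip.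
  by split => //; have [//|[_ /nM]] := vp_val vp x t0.
have Es : (size q).-1 = size r by rewrite Er size_prod_XsubC.
have E1 : q.[0] = (-1) ^+ size r * \prod_(t <- r) t.
  rewrite Er horner_prod; elim: (r) => [|t l IH]; first by rewrite !big_nil mulr1.
  by rewrite !big_cons IH hornerXsubC /= exprS; ring.
have E2 : (\prod_(t <- r) (x / t)) * \prod_(t <- r) t = x ^+ size r.
  rewrite -big_split /= big_seq.
  rewrite (eq_bigr (fun _ => x)) => [|t /Hr[t0 _]]; last by rewrite divfK.
  by rewrite -big_seq big_const_seq count_predT iter_mulr_1.
have OP : O (\prod_(t <- r) (x / t)).
  rewrite big_seq; apply: (big_ind O); [exact: ip_O1 ip | exact: ip_OM ip | by move=> t /Hr[]].
apply: (vp_M1 vp).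
have -> : 1 = ((-1) ^+ size r * (\prod_(t <- r) (x / t)) * z) * (s / x ^+ (size q).-1).
  have xn : x ^+ size r != 0 by rewrite expf_neq0.
  apply: (mulIf xn); rewrite mul1r Es -[RHS]mulrA (divfK xn) -[LHS]E2.
  have -> : (-1) ^+ size r * \prod_(t <- r) (x / t) * z * s = (\prod_(t <- r) (x / t)) * ((-1) ^+ size r * (s * z)) by ring.
  by rewrite -q0 E1 [(-1) ^+ _ * (_ * _)]mulrA -expr2 sqrr_sign mul1r.
apply: (ip_EM ip) => //; apply: (ip_OM ip) => //; apply: (ip_OM ip) => //.
by apply: (ip_OX ip); apply: (ip_ON ip); exact: ip_O1 ip.
Qed.

(* "Every form of degree E + d lies in the ideal" is an open condition. *)
Lemma comb_open F E : hform d F -> (forall m, mdeg m = (E + d)%N -> comb F V E 'X_[m]) ->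
  exists x, [/\ x != 0, O x & forall s t, M (s / x) -> M (t / x) ->
    forall m, mdeg m = (E + d)%N -> comb (pencil d F s t) V E 'X_[m]].
Proof.
move=> HF Hm; pose S := ms V (E + d).
have Hch : {in S, forall m, exists q : nat -> {mpoly K[V]},
    (forall j, q j \is E.-homog) /\ 'X_[m] = \sum_(j < V) q j * F (inord j)}.
  by move=> m; rewrite mem_ms => /eqP /Hm.
have [q Hq] := seq_choice (fun _ => 0) Hch.
pose A (m : 'X_{1..V}) := \sum_(j < V) q m j * cfermat K d (inord j).
pose B (m : 'X_{1..V}) := \sum_(j < V) q m j * fermat K d (inord j).
have [x [x0 Ox Hx]] := common_denominator ([seq (A a)@_b | a <- S, b <- S] ++ [seq (B a)@_b | a <- S, b <- S]).
exists x; split => // s t Ms Mt m /eqP me.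
pose P (a : 'X_{1..V}) := \sum_(j < V) q a j * pencil d F s t (inord j).
have PE a : a \in S -> P a = 'X_[a] + s *: A a + t *: B a.
  move=> aS; rewrite (proj2 (Hq a aS)) /P /A /B !scaler_sumr -!big_split; apply: eq_bigr => j _.
  by rewrite /pencil /= !mulrDr !scalerAr.
have small u c : M (u / x) -> O (x * c) -> M (u * c).
  move=> Mu Oc; have -> : u * c = (x * c) * (u / x) by field.
  exact: (ip_EM ip).
have MA a b : a \in S -> b \in S -> M (s * (A a)@_b).
  by move=> aS bS; apply: small => //; apply: Hx; rewrite mem_cat (allpairs_f (fun a b => (A a)@_b)).
have MB a b : a \in S -> b \in S -> M (t * (B a)@_b).
  by move=> aS bS; apply: small => //; apply: Hx; rewrite mem_cat orbC (allpairs_f (fun a b => (B a)@_b)).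
have Pcoef a b : a \in S -> (P a)@_b = (a == b)%:R + s * (A a)@_b + t * (B a)@_b.
  by move=> aS; rewrite PE // !mcoeffD !mcoeffZ mcoeffX.
have On (c : bool) : O c%:R by case: c; [exact: ip_O1 ip | exact: ip_O0 ip].
(* For small s and t the old combinations, with pencil forms inserted, have a coefficient matrix
   congruent to the identity, so they still span. *)
have nz : detq S (fun a b => (P a)@_b) != 0.
  apply: (unit_neq0 ip (vp_M1 vp)).
  rewrite -(@detq1 _ _ S (fun a b => (a == b)%:R)) ?ms_uniq //.
  apply: (ip_detq_cong ip) => a b aS bS.
  - by rewrite Pcoef //; apply: (ip_OD ip); [apply: (ip_OD ip) => // |]; apply: (vp_MO vp); auto.
  - exact: On.
  - rewrite Pcoef // [X in M X](_ : _ = s * (A a)@_b + t * (B a)@_b); last by ring.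
    by apply: (ip_ED ip); auto.
have [c Hc] := detq_span (fun b => (m == b)%:R) (ms_uniq V (E + d)) nz.
have HP a : a \in S -> comb (pencil d F s t) V E (P a).
  by move=> aS; exists (q a); split => //; exact: (proj1 (Hq a aS)).
have Phom a : a \in S -> P a \is (E + d).-homog.
  move=> aS; apply: rpred_sum => j _; apply: dhomogM; first exact: (proj1 (Hq a aS)).
  exact: pencil_hform.
have -> : 'X_[m] = \sum_(a <- S) c a *: P a.
  apply: (@eq_dhomog _ _ _ _ (E + d)); first by rewrite dhomogX.
    by rewrite big_seq; apply: rpred_sum => a aS; apply: rpredZ; apply: Phom.
  move=> b bS; rewrite mcoeffX Hc // raddf_sum; apply: eq_bigr => a _.
  by symmetry; exact: mcoeffZ.
by apply: comb_sum => a aS; apply: combZ; apply: HP.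
Qed.

(** If the resultant is 0, then for small good s the quotient of the shifted system has a small root
    t. There det M vanishes, so the permuted pencil is nondegenerate for fewer forms. Its ideal is
    still full in degree E + d, so descent makes its det M nonzero, against the cross identity. *)
Lemma res_neq0 e F : (V * d.-1 < e)%N -> hform d F -> integral O F ->
  (forall x : 'I_V -> K, (exists i, x i != 0) -> exists j, (F j).@[x] != 0) -> res d e F != 0.
Proof.
move=> He HF OF Hz; apply/negP => /eqP r0.
have hh := all_hit_hits N d V e; have hn := all_hit_nonreds N d V e.
have uh := hits_uniq N d V e; have un := nonreds_uniq N d e.
have de : (d <= e)%N by move: He d_gt0; rewrite mulSn; clear; move: (N * _)%N; lia.
have He' : (N * d.-1 <= e - d)%N by move: He d_gt0; rewrite mulSn; clear; move: (N * _)%N; lia.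
have [E [eE HE]] : exists E, (e - d <= E)%N /\ forall m, mdeg m = (E + d)%N -> comb F V E 'X_[m].
  have HL : homog_gens [seq F j | j <- enum 'I_V] by move=> f /mapP[j _ ->]; exists d.
  have [] := homogeneous_nullstellensatz (ltn0Sn N) HL.
    move=> [a [a0 Ha]]; have [j] := Hz a a0.
    by rewrite Ha ?eqxx //; apply: map_f; rewrite mem_enum.
  move=> e0 f0; exists (maxn e0 (e - d)); split; first exact: leq_maxr.
  move=> m me; have le : (e0 <= mdeg m)%N by rewrite me (leq_trans (leq_maxl e0 (e - d))) // leq_addr.
  have [q Eq] := in_ideal_map (enum_uniq 'I_V) (full_le le f0 erefl).
  set E := maxn _ _ in me *.
  exists (fun j => pihomog mdeg E (q (inord j))); split; first by move=> j; apply: pihomogP.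
  have Hm : ('X_[m] : {mpoly K[V]}) \is (E + d).-homog by rewrite dhomogX /= me.
  rewrite -(pihomog_dE Hm) Eq big_enum /= raddf_sum.
  apply: eq_bigr => j _; rewrite inord_val.
  by rewrite -(pihomogM _ _ (HF j)).
have [x [x0 Ox Hx]] := comb_open HF HE.
have [r rn0 Hr] := good_parameters d_gt0 vp e (E + d) HF OF.
have [c [c' [c0 c'0 Hid]]] := pencil_identity d_gt0 vp He HF OF.
pose n := size (hits N d V e).
(* Exponent n + 1 covers both uses: deg q <= n in [small_root], and |s| < |x| also when n = 0. *)
have xn0 : x ^+ n.+1 != 0 by rewrite expf_neq0.
have [s [s0 Ms Msx rs]] := vp_small vp rn0 xn0.
have Os := vp_MO vp Ms.
have Mk k : (k <= n.+1)%N -> M (s / x ^+ k).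
  move=> kn; have -> : s / x ^+ k = x ^+ (n.+1 - k) * (s / x ^+ n.+1).
    rewrite -{2}(subnK kn) exprD; field; by rewrite !expf_neq0.
  by apply: (ip_EM ip) => //; apply: (ip_OX ip).
pose Fs := shifted d F s.
have HFs : hform d Fs := shifted_hform s HF.
have OFs : integral O Fs := shifted_integral d vp OF Os.
have dv := nonreds_dvd_hits d_gt0 vp He HFs OFs.
have B0 : detX d (nonreds N d V e) Fs != 0 by rewrite monic_neq0 // detX_monic.
pose q := detX d (hits N d V e) Fs %/ detX d (nonreds N d V e) Fs.
have Eq : detX d (hits N d V e) Fs = q * detX d (nonreds N d V e) Fs by rewrite divpK.
have mq : q \is monic.
  have := detX_monic Fs hh uh; rewrite Eq !monicE lead_coefM.
  by rewrite (monicP (detX_monic Fs hn un)) mulr1.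
have sq : ((size q).-1 <= n)%N.
  by rewrite size_divp // size_detX // size_detX //= -/n; lia.
have [z Oz q0] : exists2 z, O z & q.[0] = s * z.
  have := res_cong d e vp (ip_principal s ip) OF OFs (shifted_close d vp s OF).
  rewrite r0 sub0r => -[z Oz Ez]; exists (- z); first exact: (ip_ON ip).
  by rewrite mulrN -Ez opprK.
have [t rt Mt] := small_root mq x0 q0 Oz (Mk _ (leqW sq)).
have comb_pencil m : mdeg m = (E + d)%N -> comb (pencil d F s t) V E 'X_[m].
  by apply: Hx => //; have := Mk 1%N isT; rewrite expr1.
have good : goodness d F (E + d) s t != 0.
  have [//|] := Hr s rs t; rewrite /macaulay_pair -detX_shifted // Eq hornerM.
  by rewrite (rootP rt) !mul0r eqxx.
have [w Hw] := polyfun2_slice s (polyfun2_sym_pencil F (leqnn V) hn).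
have [a Ha] := polyfun2_slice s (polyfun2_sym_pencil F (leqnn V) hh).
(* Cancelling det M' as a polynomial in t keeps the identity meaningful at t even if det M' vanishes
   there. *)
have Epoly : c *: q * w = c' *: a.
  apply: (mulIf B0); apply: poly_eq_eval => u.
  rewrite !hornerM !hornerZ -mulrA mulrCA mulrA.
  have := Hid s u; rewrite -!detX_shifted // -Hw -Ha Eq hornerM => H.
  by rewrite -[RHS]mulrA -H; ring.
have at0 : minor d (hits N d V e) (symf (cyc N) (pencil d F s t)) V = 0.
  have := congr1 (fun p => p.[t]) Epoly; rewrite hornerM !hornerZ (rootP rt) mulr0 mul0r -Ha.
  by move/esym/eqP; rewrite mulf_eq0 (negbTE c'0) => /eqP.
move/eqP: at0; apply/negP; rewrite -(subnK de).
apply: (minor_full_neq0 d_gt0 (symf_hform (cyc N) (pencil_hform s t HF)) He' eE).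
  by move=> k e' kN eE'; move/goodnessP: good; apply.
move=> m me.
have -> : ('X_[m] : {mpoly K[V]}) = msym (cyc N) ('X_[[multinom m (cyc N i) | i < V]] : {mpoly K[V]}).
  by rewrite msymX; congr 'X_[_]; apply/mnmP => i; rewrite !mnmE permKV.
by apply: comb_sym; apply: comb_pencil; rewrite mdeg_mperm.
Qed.

End ResNonzero.

(** * Lifts of one map *)

Lemma meval_homogZ (K : fieldType) n d (p : {mpoly K[n]}) (x : 'I_n -> K) c :
  p \is d.-homog -> p.@[fun i => c * x i] = c ^+ d * p.@[x].
Proof.
move=> /dhomogP Hp; rewrite !mevalE mulr_sumr; apply: eq_big_seq => m /Hp md.
rewrite mulrCA; congr (_ * _); rewrite -md /= mdegE.
under eq_bigr do rewrite exprMn.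
by rewrite big_split /= prodrXr.
Qed.

Lemma meval_line (K : fieldType) n (p : {mpoly K[n]}) (u v : 'I_n -> K) :
  exists q : {poly K}, forall t, q.[t] = p.@[fun i => u i + t * v i].
Proof.
exists (\sum_(m <- msupp p) p@_m *: \prod_i ((u i)%:P + (v i)%:P * 'X) ^+ m i) => t.
rewrite mevalE horner_sum; apply: eq_bigr => m _; rewrite hornerZ horner_prod.
congr (_ * _); apply: eq_bigr => i _; rewrite horner_exp; congr (_ ^+ _).
by rewrite hornerD hornerM !hornerC hornerX mulrC.
Qed.

(* With x_i^e = sum_j C_j Phi_j, the proportionality factor at a point with x_i = 1 is
   the value of sum_j C_j Psi_j; along a line in x_i = 1 this is a polynomial without
   roots, hence constant. *)
Lemma lifts_proportional (K : closedFieldType) N d (Phi Psi : 'I_N.+1 -> {mpoly K[N.+1]}) :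
  is_lift d Phi -> is_lift d Psi -> same_map Phi Psi ->
  exists2 C : K, C != 0 & forall x, nzv x -> forall i, (Psi i).@[x] = C * (Phi i).@[x].
Proof.
move=> [hPhi zPhi] [hPsi zPsi] same.
pose V := N.+1.
have HL : homog_gens [seq Phi j | j <- enum 'I_V] by move=> f /mapP[j _ ->]; exists d; exact: hPhi.
have [] := homogeneous_nullstellensatz (ltn0Sn N) HL.
  move=> [a [a0 Ha]]; have [j] := zPhi a a0.
  by rewrite /evalv Ha ?eqxx //; apply: map_f; rewrite mem_enum.
move=> e fe.
(* The point (1, ..., 1) lies on every hyperplane x_i = 1, so it yields the same constant whichever
   i is used. *)
have [C [C0 HC]] : exists c : K, c != 0 /\ forall i, evalv Psi (fun _ => 1) i = c * evalv Phi (fun _ => 1) i.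
  by apply: same; exists ord0; rewrite oner_neq0.
exists C => // x [i xi] j.
pose y k := x k / x i.
have yi : y i = 1 by rewrite /y mulfV.
have [q Eq] := in_ideal_map (enum_uniq 'I_V) (fe (U_(i) *+ e)%MM (etrans (mdegMn _ _) (etrans (congr1 (muln^~ e) (mdeg1 i)) (mul1n e)))).
pose A := \sum_(j <- enum 'I_V) q j * Psi j.
have HA z : z i = 1 -> exists c, [/\ c != 0, A.@[z] = c & forall k, (Psi k).@[z] = c * (Phi k).@[z]].
  move=> zi; have [c [c0 Hc]] : exists c : K, c != 0 /\ forall k, evalv Psi z k = c * evalv Phi z k.
    by apply: same; exists i; rewrite zi oner_neq0.
  exists c; split => //.
  have : ('X_[U_(i) *+ e] : {mpoly K[V]}).@[z] = 1 by rewrite meval_Ud zi expr1n.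
  rewrite Eq /A !raddf_sum /= => E1; rewrite -[RHS]mulr1 -E1 mulr_sumr; apply: eq_bigr => k _.
  by rewrite !mevalM mulrCA; congr (_ * _); exact: Hc.
have [p Hp] := meval_line A (fun _ => 1) (fun k => y k - 1).
have Hline t : exists c, [/\ c != 0, p.[t] = c & forall k, (Psi k).@[fun k => 1 + t * (y k - 1)] = c * (Phi k).@[fun k => 1 + t * (y k - 1)]].
  have [|c [c0 Ac Hc]] := HA (fun k => 1 + t * (y k - 1)); first by rewrite yi subrr mulr0 addr0.
  by exists c; split => //; rewrite Hp.
have sp : size p == 1%N.
  apply/negPn/negP => /closed_rootP[t /rootP pt].
  by have [c [c0 E1 _]] := Hline t; rewrite -E1 pt eqxx in c0.
have pC : p.[1] = p.[0].
  by have [a _ ->] := size_poly1P _ sp; rewrite !hornerC.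
have e1 : (fun k => 1 + 1 * (y k - 1)) =1 y by move=> k; rewrite mul1r addrC subrK.
have e0 : (fun k => 1 + 0 * (y k - 1)) =1 (fun _ => 1) by move=> k; rewrite mul0r addr0.
have [c1 [_ pc1 H1]] := Hline 1; have [c2 [_ pc2 H2]] := Hline 0.
have c2C : c2 = C.
  have [k Hk] := zPhi (fun _ => 1) (ex_intro _ ord0 (oner_neq0 K)).
  apply: (mulIf Hk); have := H2 k; rewrite !(meval_eq _ e0) => <-; exact: HC.
have Hy k : (Psi k).@[y] = C * (Phi k).@[y].
  by have := H1 k; rewrite !(meval_eq _ e1) -pc1 pC pc2 c2C.
have xy : x =1 (fun k => x i * y k) by move=> k; rewrite /y mulrCA mulfV // mulr1.
rewrite !(meval_eq _ xy) (meval_homogZ _ _ (hPsi j)) (meval_homogZ _ _ (hPhi j)) Hy.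
by rewrite mulrCA.
Qed.

(** * Real absolute values *)

From mathcomp Require Import all_order Rstruct.
From Stdlib Require Import Reals.
From mathcomp Require Import ring lra.
Import Order.TTheory GRing.Theory Num.Theory.
Local Open Scope ring_scope.

Section BigMax.
Variables (I : eqType).
Implicit Types (s : seq I) (f : I -> R).

Lemma bigmax_ge s f i : i \in s -> f i <= \big[Num.max/0]_(j <- s) f j.
Proof.
elim: s => // j s IH; rewrite inE big_cons le_max => /orP[/eqP -> |/IH ->]; first by rewrite lexx.
by rewrite orbT.
Qed.

Lemma bigmax_lub s f b : 0 <= b -> {in s, forall i, f i <= b} -> \big[Num.max/0]_(j <- s) f j <= b.
Proof.
move=> b0; elim: s => [|j s IH] H; first by rewrite big_nil.
rewrite big_cons ge_max H ?mem_head //=; apply: IH => i si; apply: H; by rewrite inE si orbT.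
Qed.

Lemma bigmax_ge0 s f : 0 <= \big[Num.max/0]_(j <- s) f j.
Proof. by elim: s => [|j s IH]; rewrite ?big_nil // big_cons le_max IH orbT. Qed.

Lemma bigmax_attained s f : 0 < \big[Num.max/0]_(j <- s) f j ->
  exists2 i, i \in s & \big[Num.max/0]_(j <- s) f j = f i.
Proof.
elim: s => [|j s IH]; first by rewrite big_nil ltxx.
rewrite big_cons; case: (leP (f j) (\big[Num.max/0]_(j0 <- s) f j0)) => H.
  by move=> /IH[i si E]; exists i; rewrite // inE si orbT.
by exists j; rewrite ?mem_head.
Qed.

End BigMax.

Section AbsoluteValue.
Variables (K : closedFieldType) (absv : K -> R).
Hypothesis na : nonarch_abs absv.

Lemma abs_ge0 x : 0 <= absv x. Proof. by case: na. Qed.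
Lemma absM x y : absv (x * y) = absv x * absv y. Proof. by case: na. Qed.
Lemma absD x y : absv (x + y) <= Num.max (absv x) (absv y). Proof. by case: na. Qed.
Lemma abs0 : absv 0 = 0. Proof. by case: na => _ H _ _; apply/H. Qed.
Lemma abs_gt0 x : x != 0 -> 0 < absv x.
Proof.
move=> x0; rewrite lt_neqAle abs_ge0 andbT eq_sym; case: na => _ H _ _.
by apply: contraNneq x0 => /H ->.
Qed.

Lemma abs1 : absv 1 = 1.
Proof.
have n0 : absv 1 != 0 by rewrite gt_eqF // abs_gt0 // oner_neq0.
by apply: (mulfI n0); rewrite -absM !mulr1.
Qed.

Lemma absX x n : absv (x ^+ n) = absv x ^+ n.
Proof. by elim: n => [|n IH]; rewrite ?expr0 ?abs1 // !exprS absM IH. Qed.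

Lemma absN x : absv (- x) = absv x.
Proof.
have sq : absv (-1) ^+ 2 = 1 ^+ 2 by rewrite -absX sqrrN !expr1n abs1.
have e1 : absv (-1) = 1.
  by move/eqP: sq; rewrite eqf_sqr => /orP[/eqP //|/eqP H]; have := abs_ge0 (-1); rewrite H; lra.
by rewrite -mulN1r absM e1 mul1r.
Qed.

Lemma absV x : x != 0 -> absv x^-1 = (absv x)^-1.
Proof.
move=> x0; have n0 : absv x != 0 by rewrite gt_eqF // abs_gt0.
by apply: (mulfI n0); rewrite -absM !mulfV // abs1.
Qed.

Lemma absB_le x y b : absv x <= b -> absv y <= b -> absv (x - y) <= b.
Proof. by move=> Hx Hy; rewrite (le_trans (absD _ _)) // absN ge_max Hx. Qed.

Definition vring (x : K) : Prop := absv x <= 1.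
Definition vmax (x : K) : Prop := absv x < 1.
Definition vball (eps : R) (x : K) : Prop := absv x <= eps.

Lemma vring_mul x y : vring x -> vring y -> vring (x * y).
Proof. by rewrite /vring absM => Hx Hy; apply: mulr_ile1 => //; apply: abs_ge0. Qed.

Lemma vball_pair eps : 0 <= eps -> ideal_pair vring (vball eps).
Proof.
move=> e0; split.
- by rewrite /vring abs1.
- by move=> a b Ha Hb; apply: absB_le.
- exact: vring_mul.
- by rewrite /vball abs0.
- by move=> a b Ha Hb; rewrite /vball (le_trans (absD _ _)) // ge_max; apply/andP.
- by move=> a b Ha Hb; rewrite /vball absM -[eps]mul1r ler_pM ?abs_ge0.
Qed.

Lemma vmax_pair : ideal_pair vring vmax.
Proof.
split.
- by rewrite /vring abs1.
- by move=> a b Ha Hb; apply: absB_le.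
- exact: vring_mul.
- by rewrite /vmax abs0 ltr01.
- by move=> a b Ha Hb; rewrite /vmax (le_lt_trans (absD _ _)) // gt_max; apply/andP.
- move=> a b Ha Hb; rewrite /vmax absM; apply: le_lt_trans Hb.
  by rewrite -[X in _ <= X]mul1r ler_wpM2r // abs_ge0.
Qed.

Lemma pow_nonroot (p : K) (r : {poly K}) n0 : p != 0 -> absv p != 1 -> r != 0 ->
  exists2 n, leq n0 n & r.[p ^+ n] != 0.
Proof.
move=> p0 p1 r0; pose l := [seq p ^+ n | n <- iota n0 (size r)].
have ul : uniq l.
  rewrite map_inj_uniq ?iota_uniq // => i j /(congr1 absv); rewrite !absX.
  by apply: ieexprIn; rewrite ?abs_gt0.
have /allPn[_ /mapP[n + ->] rn] : ~~ all (root r) l.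
  apply/negP => H; have := max_poly_roots r0 H ul.
  by rewrite size_map size_iota ltnn.
by rewrite mem_iota => /andP[? _]; exists n.
Qed.

Hypothesis nt : nontrivial_abs absv.

Lemma pseudo_uniformizer : exists p, [/\ p != 0, absv p < 1 & absv p != 1].
Proof.
have [x [x0 x1]] := nt.
have xn0 : x != 0 by apply: contraNneq x0 => ->; rewrite abs0.
case: (ltgtP (absv x) 1) => [lt|gt|E]; last by rewrite E eqxx in x1.
  by exists x; split.
have lt : absv x^-1 < 1 by rewrite absV // invf_lt1 // abs_gt0.
by exists x^-1; split; rewrite ?invr_eq0 // lt_eqF.
Qed.

Lemma pow_small (a b : R) : 0 <= a -> a < 1 -> 0 < b ->
  exists n0, forall n, leq n0 n -> a ^+ n < b.
Proof.
move=> a0 a1 b0.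
have Ha : Rlt (Rabs a) (IZR 1) by rewrite Rabs_pos_eq; [apply/RltP | apply/RleP].
have [n0 H] := pow_lt_1_zero a Ha b (elimT RltP b0).
exists n0 => n /ssrnat.leP Hn; apply/RltP; have := H n Hn.
rewrite RpowE Rabs_pos_eq //; apply/RleP; exact: exprn_ge0.
Qed.

Lemma valuation : valuation_pair vring vmax.
Proof.
have [p [p0 plt p1]] := pseudo_uniformizer.
split.
- exact: vmax_pair.
- by rewrite /vmax abs1 ltxx.
- by move=> x; apply: ltW.
- move=> x y x0; case: (leP (absv (y / x)) 1) => H; [by left | right].
  have y0 : y != 0 by apply: contraTneq H => ->; rewrite mul0r abs0 ltNge ler01.
  split => //; rewrite /vmax -invf_div absV ?mulf_neq0 ?invr_eq0 // invf_lt1 //.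
  exact: lt_trans ltr01 H.
- move=> r r0.
  have [||n n1 rn] := @pow_nonroot p^-1 r 1 _ _ r0; rewrite ?invr_eq0 //.
    by rewrite absV // invr_eq1.
  exists (p^-1 ^+ n) => //; split; first by rewrite expf_neq0 ?invr_eq0.
  rewrite /vmax exprVn invrK absX; case: n n1 {rn} => // n _.
  by rewrite exprn_ilt1 // abs_ge0.
- move=> r x r0 x0.
  have b0 : 0 < Num.min 1 (absv x) by rewrite lt_min ltr01 abs_gt0.
  have [n0 Hn0] := pow_small (abs_ge0 p) plt b0.
  have [n n0n rn] := pow_nonroot n0 p0 p1 r0.
  have := Hn0 n n0n; rewrite -absX lt_min => /andP[h1 h2].
  exists (p ^+ n); split => //; first by rewrite expf_neq0.
  by rewrite /vmax absM absV // ltr_pdivrMr ?abs_gt0 // mul1r.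
Qed.

End AbsoluteValue.

Lemma bigmaxZ (I : Type) (s : seq I) (f : I -> R) c : 0 <= c ->
  \big[Num.max/0]_(i <- s) (c * f i) = c * \big[Num.max/0]_(i <- s) f i.
Proof.
move=> c0; elim: s => [|i s IH]; first by rewrite !big_nil mulr0.
by rewrite !big_cons IH maxr_pMr.
Qed.

#[local] Arguments ln x%_ring_scope.

Lemma lnM (x y : R) : 0 < x -> 0 < y -> ln (x * y) = ln x + ln y.
Proof. by move=> /RltP x0 /RltP y0; exact: ln_mult. Qed.

Lemma ln1 : ln 1 = 0. Proof. exact: ln_1. Qed.

Lemma lnV (x : R) : 0 < x -> ln x^-1 = - ln x.
Proof.
move=> x0; have xn : x != 0 by rewrite gt_eqF.
by apply/eqP; rewrite -addr_eq0 -lnM ?invr_gt0 // mulVf // ln1.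
Qed.

Lemma lnX (x : R) n : 0 < x -> ln (x ^+ n) = n%:R * ln x.
Proof.
move=> x0; elim: n => [|n IH]; first by rewrite expr0 ln1 mul0r.
by rewrite exprS lnM ?exprn_gt0 // IH -[n.+1]addn1 natrD mulrDl mul1r addrC.
Qed.

Lemma ler_ln (x y : R) : 0 < x -> x <= y -> ln x <= ln y.
Proof.
move=> x0; rewrite le_eqVlt => /orP[/eqP -> //|/RltP xy].
by apply: ltW; apply/RltP; apply: ln_increasing => //; apply/RltP.
Qed.

(** * Norms and chordal distance on representatives *)

Section VNorm.
Variables (K : closedFieldType) (absv : K -> R).
Hypothesis na : nonarch_abs absv.
Variable n : nat.
Implicit Types (x y : 'I_n -> K).

Lemma abs_le_vnorm x i : absv (x i) <= vnorm absv x.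
Proof. by apply: (bigmax_ge (fun i => absv (x i))); rewrite mem_index_enum. Qed.

Lemma vnorm_lub x b : 0 <= b -> (forall i, absv (x i) <= b) -> vnorm absv x <= b.
Proof. by move=> b0 H; apply: bigmax_lub. Qed.

Lemma vnorm_ge0 x : 0 <= vnorm absv x.
Proof. exact: bigmax_ge0. Qed.

Lemma vnorm_gt0 x : nzv x -> 0 < vnorm absv x.
Proof. by move=> [i xi]; apply: lt_le_trans (abs_le_vnorm x i); apply: abs_gt0. Qed.

Lemma vnorm_attained x : nzv x -> exists k, absv (x k) = vnorm absv x.
Proof. by move=> /vnorm_gt0 /bigmax_attained[k _ E]; exists k. Qed.

Lemma eq_vnorm x y : x =1 y -> vnorm absv x = vnorm absv y.
Proof. by move=> E; apply: eq_bigr => i _; rewrite E. Qed.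

Lemma vnormZ c x : vnorm absv (fun i => c * x i) = absv c * vnorm absv x.
Proof.
rewrite /vnorm -bigmaxZ ?abs_ge0 //; apply: eq_bigr => i _; exact: absM.
Qed.

Lemma chordal_le x y i j : nzv x -> nzv y ->
  absv (x i * y j - x j * y i) <= chordal absv x y * (vnorm absv x * vnorm absv y).
Proof.
move=> /vnorm_gt0 x0 /vnorm_gt0 y0; rewrite /chordal divfK ?gt_eqF ?mulr_gt0 //.
apply: le_trans (bigmax_ge (fun i => \big[Num.max/0]_(j < n) absv (x i * y j - x j * y i)) (mem_index_enum i)).
exact: (bigmax_ge (fun j => absv (x i * y j - x j * y i)) (mem_index_enum j)).
Qed.

Lemma chordal_ge0 x y : 0 <= chordal absv x y.
Proof. by apply: divr_ge0; [exact: bigmax_ge0 | rewrite mulr_ge0 ?vnorm_ge0]. Qed.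

(** Take j with |y_j| maximal. If |y_k| were smaller, both terms of x_k y_j = (x_k y_j - x_j y_k) +
    x_j y_k would be below ||x|| ||y||, which is the size of the left side. *)
Lemma chordal_common x y k : nzv x -> nzv y -> chordal absv x y < 1 ->
  absv (x k) = vnorm absv x -> absv (y k) = vnorm absv y.
Proof.
move=> nx ny c1 xk; have x0 := vnorm_gt0 nx; have y0 := vnorm_gt0 ny.
have [j yj] := vnorm_attained ny.
apply/eqP; rewrite eq_le abs_le_vnorm /= leNgt; apply/negP => lt.
have h := chordal_le k j nx ny.
have lt1 : absv (x k * y j - x j * y k) < vnorm absv x * vnorm absv y.
  by apply: le_lt_trans h _; rewrite -[X in _ < X]mul1r ltr_pM2r // mulr_gt0.
have lt2 : absv (x j * y k) < vnorm absv x * vnorm absv y.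
  rewrite (absM na); apply: le_lt_trans (_ : vnorm absv x * absv (y k) < _).
    by rewrite ler_wpM2r ?abs_ge0 ?abs_le_vnorm.
  by rewrite ltr_pM2l.
have : absv (x k * y j) < vnorm absv x * vnorm absv y.
  rewrite -[x k * y j](subrK (x j * y k)); apply: le_lt_trans (absD na _ _) _.
  by rewrite gt_max lt1.
by rewrite (absM na) xk yj ltxx.
Qed.

End VNorm.

(** * The height of a minimal lift *)

Section MinimalLift.
Variables (K : closedFieldType) (absv : K -> R) (N d : nat).
Variable Psi : 'I_N.+1 -> {mpoly K[N.+1]}.
Hypothesis na : nonarch_abs absv.
Hypothesis nt : nontrivial_abs absv.
Hypothesis d_gt0 : leq 1 d.
Hypothesis lift : is_lift d Psi.
Hypothesis minimal : lift_norm absv Psi = 1.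
Local Notation V := N.+1.
Local Notation r := (absv (macaulay_res d Psi)).
Let vp := valuation na nt.

Lemma lift_integral : integral (vring absv) Psi.
Proof.
move=> j m; have [Hm|/memN_msupp_eq0 ->] := boolP (m \in msupp (Psi j)); last first.
  by rewrite /vring (abs0 na) ler01.
rewrite /vring -minimal /lift_norm.
apply: le_trans (bigmax_ge (fun i => \big[Num.max/0]_(m <- msupp (Psi i)) absv (Psi i)@_m) (mem_index_enum j)).
exact: (bigmax_ge (fun m => absv (Psi j)@_m)).
Qed.

Lemma crit : leq (V * d.-1).+1 (macD N d). Proof. exact: ltnSn. Qed.

Lemma res_abs_gt0 : 0 < r.
Proof.
rewrite macaulay_resE //; apply: abs_gt0 => //; case: lift => h z.
apply: (res_neq0 d_gt0 vp crit h lift_integral) => x nx.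
by have [j Hj] := z x nx; exists j.
Qed.

Lemma res_abs_le1 : r <= 1.
Proof. by rewrite macaulay_resE //; apply: (res_O _ _ vp lift_integral). Qed.

Definition unimodular (x : 'I_V -> K) k := (forall i, absv (x i) <= 1) /\ absv (x k) = 1.

Lemma value_bounds x k : unimodular x k -> r <= vnorm absv (evalv Psi x) <= 1.
Proof.
move=> [x1 xk]; have xk0 : x k != 0.
  by apply: contra_eq_neq xk => ->; rewrite (abs0 na) eq_sym oner_eq0.
have ip := vmax_pair na.
have Ov j : absv (evalv Psi x j) <= 1 by apply: (ip_meval_O ip) => // m; apply: lift_integral.
apply/andP; split; last by apply: vnorm_lub.
case: lift => h z; have [j Hj] := z x (ex_intro _ k xk0).
rewrite macaulay_resE //.
(* The ball of radius ||Psi(x)|| turns membership of the resultant into the inequality; a nonzero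
   value Psi_j(x) is the required nonzero element of the ball. *)
apply: (@res_le_value _ _ _ _ _ _ d_gt0 vp crit (vball absv (vnorm absv (evalv Psi x))) _ x k (evalv Psi x j)) => //.
- by apply: vball_pair; rewrite ?vnorm_ge0.
- exact: lift_integral.
- by rewrite /vring absV // xk invr1.
- by rewrite /vmax xk ltxx.
- by move=> i; apply: (abs_le_vnorm absv (evalv Psi x)).
- exact: Ov.
- exact: (abs_le_vnorm absv (evalv Psi x)).
Qed.

Lemma value_close x y k k' : unimodular x k -> unimodular y k' ->
  (forall i, absv (x i - y i) < r) -> vnorm absv (evalv Psi x) = vnorm absv (evalv Psi y).
Proof.
suff le x' y' l l' : unimodular x' l -> unimodular y' l' ->
    (forall i, absv (x' i - y' i) < r) -> vnorm absv (evalv Psi x') <= vnorm absv (evalv Psi y').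
  move=> ux uy H; apply/eqP; rewrite eq_le (le _ _ _ _ ux uy) //=.
  by apply: (le _ _ _ _ uy ux) => i; rewrite -absN // opprB.
move=> ux uy H; have [x1 xk] := ux; have [y1 _] := uy.
(* The maximum of the finitely many differences gives a closed ball of radius still below r, hence
   below the norm of the value at y'. *)
pose b := vnorm absv (fun i => x' i - y' i).
have br : b < r.
  have b0 : 0 <= b by exact: vnorm_ge0.
  move: b0; rewrite le_eqVlt => /orP[/eqP <-|]; first exact: res_abs_gt0.
  by move=> /bigmax_attained[i _ E]; rewrite /b /vnorm E.
have cl j : absv (evalv Psi x' j - evalv Psi y' j) <= b.
  apply: (ip_meval_cong (vball_pair na (vnorm_ge0 absv (fun i => x' i - y' i)))) => //.
    by move=> m; apply: lift_integral.
  by move=> i; apply: (abs_le_vnorm absv (fun i => x' i - y' i)).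
have /andP[ry _] := value_bounds uy.
apply: vnorm_lub => [|i]; first exact: vnorm_ge0.
rewrite -[evalv Psi x' i](subrK (evalv Psi y' i)); apply: le_trans (absD na _ _) _.
rewrite ge_max (abs_le_vnorm absv (evalv Psi y')) andbT.
by apply: le_trans (cl i) _; apply: ltW; apply: lt_le_trans br ry.
Qed.

Lemma normalise_unimodular x k : nzv x -> absv (x k) = vnorm absv x ->
  unimodular (fun i => (x k)^-1 * x i) k.
Proof.
move=> nx xk; have x0 := vnorm_gt0 na nx.
have xk0 : x k != 0 by apply: contraTneq x0 => E; rewrite -xk E (abs0 na) ltxx.
split=> [i|]; last by rewrite mulVf // abs1.
by rewrite (absM na) absV // xk mulrC ler_pdivrMr // mul1r abs_le_vnorm.
Qed.

Lemma value_normalise x k : nzv x -> absv (x k) = vnorm absv x ->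
  vnorm absv (evalv Psi x) =
  vnorm absv x ^+ d * vnorm absv (evalv Psi (fun i => (x k)^-1 * x i)).
Proof.
move=> nx xk; have x0 := vnorm_gt0 na nx.
have xk0 : x k != 0 by apply: contraTneq x0 => E; rewrite -xk E (abs0 na) ltxx.
case: lift => h _.
rewrite (@eq_vnorm _ _ _ (evalv Psi (fun i => _ * _)) (fun j => (x k)^-1 ^+ d * evalv Psi x j)); last first.
  by move=> j; rewrite /evalv (meval_homogZ _ _ (h j)).
rewrite vnormZ // absX // absV // xk mulrA -exprMn mulfV; last by rewrite gt_eqF.
by rewrite expr1n mul1r.
Qed.

Definition height x := ln (vnorm absv (evalv Psi x)) / d%:R - ln (vnorm absv x).

Lemma dR_gt0 : 0 < d%:R :> R. Proof. by rewrite ltr0n. Qed.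

Lemma height_normalise x k : nzv x -> absv (x k) = vnorm absv x ->
  height x = ln (vnorm absv (evalv Psi (fun i => (x k)^-1 * x i))) / d%:R.
Proof.
move=> nx xk; rewrite /height (value_normalise nx xk).
have /andP[lo _] := value_bounds (normalise_unimodular nx xk).
have x0 := vnorm_gt0 na nx.
rewrite lnM ?exprn_gt0 // ?(lt_le_trans res_abs_gt0 lo) // lnX // mulrDl mulrAC.
have dn : d%:R != 0 :> R by rewrite gt_eqF ?dR_gt0.
by rewrite mulfV // mul1r addrAC subrr add0r.
Qed.

Lemma height_bounds x : nzv x -> - (ln r^-1 / d%:R) <= height x <= 0.
Proof.
move=> nx; have [k xk] := vnorm_attained na nx; rewrite (height_normalise nx xk).
have /andP[lo hi] := value_bounds (normalise_unimodular nx xk).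
have r0 := res_abs_gt0; have dR := dR_gt0.
rewrite lnV // mulNr opprK ler_pM2r ?invr_gt0 // ler_ln //=.
rewrite pmulr_lle0 ?invr_gt0 // -ln1; apply: ler_ln => //.
exact: lt_le_trans lo.
Qed.

Lemma height_locally_constant x y : nzv x -> nzv y -> chordal absv x y < r -> height x = height y.
Proof.
move=> nx ny c; have [k xk] := vnorm_attained na nx.
have yk := chordal_common na nx ny (lt_le_trans c res_abs_le1) xk.
have x0 := vnorm_gt0 na nx; have y0 := vnorm_gt0 na ny.
rewrite (height_normalise nx xk) (height_normalise ny yk); congr (ln _ / _).
apply: (value_close (normalise_unimodular nx xk) (normalise_unimodular ny yk)) => i.
have xk0 : x k != 0 by apply: contraTneq x0 => E; rewrite -xk E (abs0 na) ltxx.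
have yk0 : y k != 0 by apply: contraTneq y0 => E; rewrite -yk E (abs0 na) ltxx.
have -> : (x k)^-1 * x i - (y k)^-1 * y i = (x i * y k - x k * y i) / (x k * y k).
  by field; rewrite xk0 yk0.
rewrite (absM na) absV ?mulf_neq0 // (absM na) xk yk.
apply: le_lt_trans c; rewrite ler_pdivrMr ?mulr_gt0 //; exact: chordal_le.
Qed.

(** The factor 1 / r arises at distances at least r: there distance / r >= 1, so it may multiply the
    bound on the oscillation. *)
Lemma height_lipschitz x y : nzv x -> nzv y ->
  `|height x - height y| <= ln r^-1 / (d%:R * r) * chordal absv x y.
Proof.
move=> nx ny; have r0 := res_abs_gt0; have dR := dR_gt0.
have L0 : 0 <= ln r^-1 by rewrite -ln1; apply: ler_ln => //; rewrite invf_ge1 // res_abs_le1.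
have [c|c] := ltP (chordal absv x y) r.
  by rewrite (height_locally_constant nx ny c) subrr normr0 mulr_ge0 ?chordal_ge0 // divr_ge0 // mulr_ge0 ?ltW.
have /andP[x1 x2] := height_bounds nx; have /andP[y1 y2] := height_bounds ny.
apply: le_trans (_ : ln r^-1 / d%:R <= _); first by rewrite ler_norml; apply/andP; split; lra.
have -> : ln r^-1 / (d%:R * r) * chordal absv x y = ln r^-1 / d%:R * (chordal absv x y / r).
  by rewrite invfM; move: (chordal _ _ _) => t; rewrite !mulrA mulrAC.
rewrite ler_peMr //; first by rewrite divr_ge0 ?ler0n.
by rewrite ler_pdivlMr // mul1r.
Qed.

End MinimalLift.

Theorem theorem12 (K : closedFieldType) (absv : K -> R) (N d : nat)
  (Phi Psi : 'I_N.+1 -> {mpoly K[N.+1]}) :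
  nonarch_abs absv -> nontrivial_abs absv -> complete_abs absv ->
  leq 2 d ->
  is_lift d Phi ->
  (* Psi is a minimal lift of the same morphism phi; Res(phi) := Res(Psi) *)
  is_lift d Psi -> same_map Phi Psi -> lift_norm absv Psi = 1 ->
  let r := absv (macaulay_res d Psi) in
  (forall x y : 'I_N.+1 -> K, nzv x -> nzv y ->
     `|gPhi absv d Phi x - gPhi absv d Phi y| <= ln (r^-1) / (d%:R * r) * chordal absv x y) /\
  (forall x y : 'I_N.+1 -> K, nzv x -> nzv y ->
     chordal absv x y < r -> gPhi absv d Phi x = gPhi absv d Phi y) /\
  (exists delta : R, 0 < delta /\
     forall x y : 'I_N.+1 -> K, nzv x -> nzv y ->
       chordal absv x y < delta -> gPhi absv d Phi x = gPhi absv d Phi y).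
Proof.
move=> na nt _ d2 lPhi lPsi same minimal r.
have d_gt0 : leq 1 d := ltnW d2.
have [C C0 HC] := lifts_proportional lPhi lPsi same.
have gE x : nzv x -> gPhi absv d Phi x = height absv d Psi x - ln (absv C) / d%:R.
  move=> nx; rewrite /gPhi /height.
  rewrite (@eq_vnorm _ _ _ (evalv Psi x) (fun i => C * evalv Phi x i)); last exact: HC.
  rewrite vnormZ // lnM ?abs_gt0 //; first by rewrite mulrDl addrAC [_ / _ + _]addrC addrK.
  by apply: vnorm_gt0 => //; case: lPhi => _; apply.
have loc x y : nzv x -> nzv y -> chordal absv x y < r -> gPhi absv d Phi x = gPhi absv d Phi y.
  move=> nx ny c; rewrite !gE //; congr (_ - _).
  exact: (height_locally_constant na nt d_gt0 lPsi minimal).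
split; last first.
  split; first exact: loc.
  by exists r; split; [exact: (res_abs_gt0 na nt d_gt0 lPsi minimal) | exact: loc].
move=> x y nx ny; rewrite !gE // opprB addrA subrK.
exact: (height_lipschitz na nt d_gt0 lPsi minimal).
Qed.
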